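(* For each equation $\mathcal L$: $u_t=A(t,x)u_{xx}+B(t,x)u_x+C(t,x)u$ (analytic $A,B,C$, $A\ne0$) and each Lie symmetry operator $Q$ of $\mathcal L$, there is a one-to-one correspondence between $Q_0$-invariant solutions of the determining equation ${\rm DE}_0(\mathcal L)$ and one-parametric families of solutions of $\mathcal L$ associated with $Q$. Namely, the reduction of $\mathcal L$ by an operator $\partial_x+\eta\partial_u$, where $\eta$ is a $Q_0$-invariant solution of ${\rm DE}_0(\mathcal L)$, gives a one-parametric solution family of $\mathcal L$ associated with $Q$. Conversely, each one-parametric solution family of $\mathcal L$ associated with $Q$ consists of solutions invariant with respect to an operator $\partial_x+\eta\partial_u$, where $\eta$ is a $Q_0$-invariant solution of ${\rm DE}_0(\mathcal L)$.
   Context: All considerations are local, in a neighborhood of a nonsingular point of $Q$. ${\rm DE}_0(\mathcal L)$ is the equation for $\eta=\eta(t,x,u)$: $$\eta_t=A(\eta_{xx}+2\eta\eta_{xu}+\eta^2\eta_{uu})+A_x(\eta_x+\eta\eta_u)+(B\eta)_x+C(\eta-u\eta_u)+C_xu.$$ It is the condition that $\partial_x+\eta\partial_u$ is a reduction operator of $\mathcal L$. Reducing $\mathcal L$ by $\partial_x+\eta\partial_u$ means finding the solutions of $\mathcal L$ invariant with respect to this operator, i.e. those satisfying $u_x=\eta(t,x,u)$; they form a one-parametric family. Every Lie symmetry operator of $\mathcal L$ has the form $Q=\tau(t)\partial_t+\xi(t,x)\partial_x+(\zeta^1(t,x)u+\zeta^0(t,x))\partial_u$, and it induces the Lie symmetry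 operator $$Q_0=Q+\bigl((\zeta^1-\xi_x)\eta+\zeta^1_xu+\zeta^0_x\bigr)\partial_\eta$$ of ${\rm DE}_0(\mathcal L)$, acting in the space of $(t,x,u,\eta)$. A one-parametric family of solutions is a family $u=f(t,x,\varkappa)$ of solutions of $\mathcal L$ with $f_\varkappa\ne0$; families differing only by a reparameterization of $\varkappa$ are identified. One-parametric solution families of $\mathcal L$ associated with $Q$ are, by definition, of two kinds: singular ones, which are one-parametric families consisting of $Q$-invariant solutions of $\mathcal L$; and regular ones, obtained by acting on a fixed non-$Q$-invariant solution of $\mathcal L$ by the one-parametric transformation group generated by $Q$.
   Formalization: The family reduced by η is claimed to be associated with Q only where Q moves the solution through the point or fixes all nearby ones (a dense set of points); otherwise it fails, e.g. u_t=u_xx, Q=∂_t, η=u at u=0. The correspondence is with such η. *)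

(* Defs.v *)
(* Real analysis over Stdlib R with Coquelicot.  Functions of several variables are
   curried; neighbourhoods are taken in the products R*R and R*R*R. *)
From Stdlib Require Export Reals List.
From Coquelicot Require Export Coquelicot.
Open Scope R_scope.

Definition dt (f : R -> R -> R) (t x : R) : R := Derive (fun s => f s x) t.
Definition dx (f : R -> R -> R) (t x : R) : R := Derive (fun y => f t y) x.

Definition d1 (f : R -> R -> R -> R) (a b c : R) : R := Derive (fun s => f s b c) a.
Definition d2 (f : R -> R -> R -> R) (a b c : R) : R := Derive (fun s => f a s c) b.
Definition d3 (f : R -> R -> R -> R) (a b c : R) : R := Derive (fun s => f a b s) c.

Inductive dir2 : Set := Dir_t | Dir_x.
Inductive dir3 : Set := Dir_1 | Dir_2 | Dir_3.

Definition pd2 (d : dir2) : (R -> R -> R) -> R -> R -> R :=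
  match d with Dir_t => dt | Dir_x => dx end.
Definition pd3 (d : dir3) : (R -> R -> R -> R) -> R -> R -> R -> R :=
  match d with Dir_1 => d1 | Dir_2 => d2 | Dir_3 => d3 end.

(* C^infinity on an open set: every iterated partial derivative is continuous
   and has all its partial derivatives.  [Derive] is total, so the existence
   has to be required separately. *)
Definition smooth2_on (W : R * R -> Prop) (f : R -> R -> R) : Prop :=
  forall (l : list dir2) (t x : R), W (t, x) ->
    let g := fold_right pd2 f l in
    continuous (fun q : R * R => g (fst q) (snd q)) (t, x) /\
    ex_derive (fun s => g s x) t /\ ex_derive (fun y => g t y) x.

Definition smooth3_on (W : R * R * R -> Prop) (f : R -> R -> R -> R) : Prop :=
  forall (l : list dir3) (a b c : R), W (a, b, c) ->
    let g := fold_right pd3 f l in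
    continuous (fun q : R * R * R => g (fst (fst q)) (snd (fst q)) (snd q)) (a, b, c) /\
    ex_derive (fun s => g s b c) a /\ ex_derive (fun s => g a s c) b /\
    ex_derive (fun s => g a b s) c.

Definition smooth2_near (f : R -> R -> R) (t0 x0 : R) : Prop :=
  exists W : R * R -> Prop, open W /\ W (t0, x0) /\ smooth2_on W f.
Definition smooth3_near (f : R -> R -> R -> R) (a0 b0 c0 : R) : Prop :=
  exists W : R * R * R -> Prop, open W /\ W (a0, b0, c0) /\ smooth3_on W f.

Definition analytic2_at (f : R -> R -> R) (t0 x0 : R) : Prop :=
  exists (a : nat -> nat -> R) (r : R), 0 < r /\
    forall t x : R, Rabs (t - t0) < r -> Rabs (x - x0) < r ->
      let m := fun i j : nat => a i j * (t - t0) ^ i * (x - x0) ^ j in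
      (forall i, ex_series (fun j => Rabs (m i j))) /\
      ex_series (fun i => Series (fun j => Rabs (m i j))) /\
      f t x = Series (fun i => Series (fun j => m i j)).

(* u_t = A u_xx + B u_x + C u *)
Record equation : Type := Equation {
  cA : R -> R -> R; cB : R -> R -> R; cC : R -> R -> R }.

Definition solves_at (L : equation) (v : R -> R -> R) (t x : R) : Prop :=
  dt v t x = cA L t x * dx (dx v) t x + cB L t x * dx v t x + cC L t x * v t x.

Definition solution_near (L : equation) (v : R -> R -> R) (t0 x0 : R) : Prop :=
  smooth2_near v t0 x0 /\
  locally ((t0, x0) : R * R) (fun q => solves_at L v (fst q) (snd q)).

(* Q = tau(t) d_t + xi(t,x) d_x + (zeta1(t,x) u + zeta0(t,x)) d_u *)
Record operator : Type := Operator {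
  tau : R -> R; xi : R -> R -> R; zeta1 : R -> R -> R; zeta0 : R -> R -> R }.

Definition zeta (Q : operator) (t x u : R) : R := zeta1 Q t x * u + zeta0 Q t x.

Definition nonsingular_point (Q : operator) (t x u : R) : Prop :=
  tau Q t <> 0 \/ xi Q t x <> 0 \/ zeta Q t x u <> 0.

(* Coefficients of the second prolongation of Q in the jet variables:
     zeta^t = D_t zeta - u_t D_t tau - u_x D_t xi,
     zeta^x = D_x zeta - u_t D_x tau - u_x D_x xi,
     zeta^xx = D_x zeta^x - u_tx D_x tau - u_xx D_x xi,
   written out for tau = tau(t), xi = xi(t,x) and zeta affine in u. *)
Definition zeta_t (Q : operator) (t x u ut ux : R) : R :=
  dt (zeta1 Q) t x * u + dt (zeta0 Q) t x + zeta1 Q t x * ut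
  - Derive (tau Q) t * ut - dt (xi Q) t x * ux.
Definition zeta_x (Q : operator) (t x u ux : R) : R :=
  dx (zeta1 Q) t x * u + dx (zeta0 Q) t x + (zeta1 Q t x - dx (xi Q) t x) * ux.
Definition zeta_xx (Q : operator) (t x u ux uxx : R) : R :=
  dx (dx (zeta1 Q)) t x * u + dx (dx (zeta0 Q)) t x
  + (2 * dx (zeta1 Q) t x - dx (dx (xi Q)) t x) * ux
  + (zeta1 Q t x - 2 * dx (xi Q) t x) * uxx.

(* Infinitesimal invariance criterion: the second prolongation of Q annihilates
   u_t - A u_xx - B u_x - C u at all jets satisfying the equation. *)
Definition lie_symmetry_on (Om : R * R -> Prop) (L : equation) (Q : operator) : Prop :=
  smooth2_on Om (fun t _ => tau Q t) /\ smooth2_on Om (xi Q) /\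
  smooth2_on Om (zeta1 Q) /\ smooth2_on Om (zeta0 Q) /\
  forall t x u ut ux uxx : R, Om (t, x) ->
    ut = cA L t x * uxx + cB L t x * ux + cC L t x * u ->
    zeta_t Q t x u ut ux
    - cA L t x * zeta_xx Q t x u ux uxx
    - cB L t x * zeta_x Q t x u ux
    - cC L t x * zeta Q t x u
    - (tau Q t * dt (cA L) t x + xi Q t x * dx (cA L) t x) * uxx
    - (tau Q t * dt (cB L) t x + xi Q t x * dx (cB L) t x) * ux
    - (tau Q t * dt (cC L) t x + xi Q t x * dx (cC L) t x) * u = 0.

Definition DE0_at (L : equation) (eta : R -> R -> R -> R) (t x u : R) : Prop :=
  d1 eta t x u =
    cA L t x * (d2 (d2 eta) t x u + 2 * eta t x u * d3 (d2 eta) t x u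
                + eta t x u ^ 2 * d3 (d3 eta) t x u)
    + dx (cA L) t x * (d2 eta t x u + eta t x u * d3 eta t x u)
    + d2 (fun t x u => cB L t x * eta t x u) t x u
    + cC L t x * (eta t x u - u * d3 eta t x u)
    + dx (cC L) t x * u.

(* The graph of eta is invariant with respect to
   Q_0 = Q + ((zeta1 - xi_x) eta + zeta1_x u + zeta0_x) d_eta. *)
Definition Q0_invariant_at (Q : operator) (eta : R -> R -> R -> R) (t x u : R) : Prop :=
  tau Q t * d1 eta t x u + xi Q t x * d2 eta t x u + zeta Q t x u * d3 eta t x u =
    (zeta1 Q t x - dx (xi Q) t x) * eta t x u
    + dx (zeta1 Q) t x * u + dx (zeta0 Q) t x.

Definition Q0_invariant_solution (L : equation) (Q : operator)
    (eta : R -> R -> R -> R) (t0 x0 u0 : R) : Prop :=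
  smooth3_near eta t0 x0 u0 /\
  locally ((t0, x0, u0) : R * R * R) (fun q =>
    let '(t, x, u) := q in DE0_at L eta t x u /\ Q0_invariant_at Q eta t x u).

(* One-parametric families u = f(t,x,k), as germs at (t0,x0,k0), whose member
   k = k0 passes through (t0,x0,u0). *)
Definition solution_family (L : equation) (f : R -> R -> R -> R)
    (k0 t0 x0 u0 : R) : Prop :=
  smooth3_near f t0 x0 k0 /\ f t0 x0 k0 = u0 /\
  locally ((t0, x0, k0) : R * R * R) (fun q =>
    let '(t, x, k) := q in
    d3 f t x k <> 0 /\ solves_at L (fun t x => f t x k) t x).

Definition reparameterization (phi : R -> R) (a b : R) : Prop :=
  phi a = b /\ Derive phi a <> 0 /\
  locally a (fun k => forall n : nat, ex_derive_n phi n k).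

Definition same_family (f1 : R -> R -> R -> R) (k1 : R)
    (f2 : R -> R -> R -> R) (k2 : R) (t0 x0 : R) : Prop :=
  exists phi : R -> R, reparameterization phi k1 k2 /\
    locally ((t0, x0, k1) : R * R * R) (fun q =>
      let '(t, x, k) := q in f1 t x k = f2 t x (phi k)).

Definition Q_invariant_at (Q : operator) (v : R -> R -> R) (t x : R) : Prop :=
  tau Q t * dt v t x + xi Q t x * dx v t x = zeta Q t x (v t x).

Definition singular_family (L : equation) (Q : operator) (f : R -> R -> R -> R)
    (k0 t0 x0 u0 : R) : Prop :=
  solution_family L f k0 t0 x0 u0 /\
  locally ((t0, x0, k0) : R * R * R) (fun q =>
    let '(t, x, k) := q in Q_invariant_at Q (fun t x => f t x k) t x).

(* (t,x,u) |-> (T e t x u, X e t x u, U e t x u) is the transformation exp(eQ). *)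
Definition local_group (Q : operator) (T X U : R -> R -> R -> R -> R)
    (t0 x0 u0 : R) : Prop :=
  locally ((0, (t0, x0, u0)) : R * (R * R * R)) (fun q =>
    let '(e, (t, x, u)) := q in
    T 0 t x u = t /\ X 0 t x u = x /\ U 0 t x u = u /\
    is_derive (fun s => T s t x u) e (tau Q (T e t x u)) /\
    is_derive (fun s => X s t x u) e (xi Q (T e t x u) (X e t x u)) /\
    is_derive (fun s => U s t x u) e (zeta Q (T e t x u) (X e t x u) (U e t x u))).

(* Up to a reparameterization phi, the member with group parameter e is the
   image of the graph of the fixed solution g under exp(eQ). *)
Definition regular_family (L : equation) (Q : operator) (f : R -> R -> R -> R)
    (k0 t0 x0 u0 : R) : Prop :=
  solution_family L f k0 t0 x0 u0 /\
  exists (g : R -> R -> R) (T X U : R -> R -> R -> R -> R) (phi : R -> R),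
    solution_near L g t0 x0 /\ g t0 x0 = u0 /\
    ~ locally ((t0, x0) : R * R) (fun q => Q_invariant_at Q g (fst q) (snd q)) /\
    local_group Q T X U t0 x0 u0 /\
    reparameterization phi 0 k0 /\
    locally ((0, (t0, x0)) : R * (R * R)) (fun q =>
      let '(e, (t, x)) := q in
      U e t x (g t x) = f (T e t x (g t x)) (X e t x (g t x)) (phi e)).

Definition associated_family (L : equation) (Q : operator) (f : R -> R -> R -> R)
    (k0 t0 x0 u0 : R) : Prop :=
  singular_family L Q f k0 t0 x0 u0 \/ regular_family L Q f k0 t0 x0 u0.

(* f is the result of reducing L by d_x + eta d_u: its members satisfy
   u_x = eta(t,x,u), and near (t0,x0,u0) every solution of L with
   u_x = eta(t,x,u) is a member. *)
Definition reduction (L : equation) (eta f : R -> R -> R -> R)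
    (k0 t0 x0 u0 : R) : Prop :=
  solution_family L f k0 t0 x0 u0 /\
  locally ((t0, x0, k0) : R * R * R) (fun q =>
    let '(t, x, k) := q in d2 f t x k = eta t x (f t x k)) /\
  forall K : R -> Prop, locally k0 K ->
    locally ((t0, x0, u0) : R * R * R) (fun q =>
      let '(t1, x1, u1) := q in
      forall v : R -> R -> R,
        solution_near L v t1 x1 -> v t1 x1 = u1 ->
        locally ((t1, x1) : R * R) (fun r =>
          dx v (fst r) (snd r) = eta (fst r) (snd r) (v (fst r) (snd r))) ->
        exists k : R, K k /\
          locally ((t1, x1) : R * R) (fun r =>
            v (fst r) (snd r) = f (fst r) (snd r) k)).

(* The characteristic zeta - tau u_t - xi u_x of Q at (t,x,u), evaluated on the
   solution of L with u_x = eta passing through that point; there L gives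
   u_t = A (eta_x + eta eta_u) + B eta + C u.  It vanishes exactly where Q is
   tangent to the graph of that solution. *)
Definition characteristic (L : equation) (Q : operator) (eta : R -> R -> R -> R)
    (t x u : R) : R :=
  zeta Q t x u
  - tau Q t * (cA L t x * (d2 eta t x u + eta t x u * d3 eta t x u)
               + cB L t x * eta t x u + cC L t x * u)
  - xi Q t x * eta t x u.

(* Q permutes the solutions with u_x = eta; the point is nonsingular for this
   action if Q moves the solution passing through it or fixes all the nearby
   ones.  Excluded are points on an isolated Q-invariant member of the family,
   e.g. u = 0 for u_t = u_xx, Q = d_t, eta = u: no neighbourhood of u = 0 in
   the family u = k exp(t+x) is a single orbit or consists of fixed members. *)
Definition nonsingular_for (L : equation) (Q : operator) (eta : R -> R -> R -> R)
    (t0 x0 u0 : R) : Prop :=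
  characteristic L Q eta t0 x0 u0 <> 0 \/
  locally ((t0, x0, u0) : R * R * R) (fun q =>
    let '(t, x, u) := q in characteristic L Q eta t x u = 0).

(* Main.v *)
(** Write [G = A (eta_x + eta eta_u) + B eta + C u].  Then [DE_0] is the
    compatibility condition of the system [u_x = eta], [u_t = G], so by Frobenius
    its solutions correspond to one-parametric families [f (t, x, k)] of solutions
    of [L], and uniqueness for this system gives the bijection.  Let
    [w = zeta (f) - tau f_t - xi f_x] be the characteristic of [Q] on the members of
    the family.  Invariance of [eta] under [Q_0] is equivalent to [w_x = eta_u w],
    an equation that [f_k] also satisfies; as [Q] is a symmetry, both [w] and [f_k]
    solve [L], whence [w = h (k) f_k].  If [h = 0] the members are [Q]-invariant; if
    [h (k0) <> 0] the flow of [Q] moves the members along [k' = h (k)], so the family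
    is an orbit.  Conversely both kinds of families satisfy [w = h (k) f_k]. *)

From Stdlib Require Import Reals Lra Lia Psatz FunctionalExtensionality.
From Stdlib Require Import Classical ClassicalEpsilon Ranalysis5.
From Coquelicot Require Import Coquelicot.
(* [Defs] comes last because [Stdlib.Reals] also defines [d1]. *)
Require Import Defs.
Open Scope R_scope.

(** * Neighbourhoods, continuity and differentiability in three variables *)

(** Every equation to be integrated is scalar. As [tau] depends on t only, [xi] on (t, x) only and
    [zeta] is affine in u, the flow of Q is triangular, so one scalar ODE with a parameter suffices,
    and three real slots (parameter, time, initial value) carry the whole calculus. Scalarity also
    solves the variational equation explicitly by exponentials and primitives, whence a C^n solution
    is C^(n+1). The delicate direction goes from a regular family to w = h (k) f_k: the maps T, X, U
    given there only solve their ODEs in e, with no continuity in the initial point. They are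
    compared with a smooth flow by a uniqueness argument that needs Lipschitz bounds only where two
    orbits meet. The cases h = 0 and h (k0) <> 0 are not exhaustive: h may vanish at k0 but not
    nearby. [nonsingular_for] excludes this, and the remaining points are dense because the
    characteristic either vanishes near a point or is nonzero arbitrarily close to it. *)

(** Working form of the neighbourhood filter of nested products: a curried predicate on a cube of
    one radius, so that radii can be compared by linear arithmetic. *)
Definition near3 (a b c : R) (P : R -> R -> R -> Prop) : Prop :=
  exists d, 0 < d /\ forall x y z,
    Rabs (x - a) < d -> Rabs (y - b) < d -> Rabs (z - c) < d -> P x y z.

Lemma near3_locally (a b c : R) (P : R * R * R -> Prop) :
  locally ((a, b, c) : R * R * R) P <-> near3 a b c (fun x y z => P (x, y, z)).
Proof.
split.
- intros [e H]; exists e; split; [apply cond_pos|].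
  intros x y z h1 h2 h3; apply H; repeat split; assumption.
- intros [d [hd H]]; exists (mkposreal d hd).
  intros [[x y] z] [[h1 h2] h3]; apply H; assumption.
Qed.

Lemma near3_imp (a b c : R) (P Q : R -> R -> R -> Prop) :
  (forall x y z, P x y z -> Q x y z) -> near3 a b c P -> near3 a b c Q.
Proof. intros h [d [hd H]]; exists d; split; auto. Qed.

Lemma near3_and (a b c : R) (P Q : R -> R -> R -> Prop) :
  near3 a b c P -> near3 a b c Q -> near3 a b c (fun x y z => P x y z /\ Q x y z).
Proof.
intros [d [hd H]] [e [he K]]; exists (Rmin d e); split; [apply Rmin_pos; auto|].
pose proof (Rmin_l d e); pose proof (Rmin_r d e).
intros x y z h1 h2 h3; split; [apply H | apply K]; lra.
Qed.

Lemma near3_pt (a b c : R) (P : R -> R -> R -> Prop) : near3 a b c P -> P a b c.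
Proof.
intros [d [hd H]]; apply H; rewrite Rminus_diag, Rabs_R0; assumption.
Qed.

Lemma near3_box (a b c d : R) : 0 < d ->
  near3 a b c (fun x y z => Rabs (x - a) < d /\ Rabs (y - b) < d /\ Rabs (z - c) < d).
Proof. intros hd; exists d; split; auto. Qed.

Lemma near3_true (a b c : R) (P : R -> R -> R -> Prop) :
  (forall x y z, P x y z) -> near3 a b c P.
Proof. intros h; exists 1; split; auto; lra. Qed.

(** Allows an identity that holds near a point to be differentiated at all nearby points too. *)
Lemma near3_near3 (a b c : R) (P : R -> R -> R -> Prop) :
  near3 a b c P -> near3 a b c (fun x y z => near3 x y z P).
Proof.
intros [d [hd H]]; exists (d / 2); split; [lra|].
intros x y z h1 h2 h3; exists (d / 2); split; [lra|].
intros x' y' z' k1 k2 k3; apply H.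
- replace (x' - a) with ((x' - x) + (x - a)) by ring.
  eapply Rle_lt_trans; [apply Rabs_triang|lra].
- replace (y' - b) with ((y' - y) + (y - b)) by ring.
  eapply Rle_lt_trans; [apply Rabs_triang|lra].
- replace (z' - c) with ((z' - z) + (z - c)) by ring.
  eapply Rle_lt_trans; [apply Rabs_triang|lra].
Qed.

Lemma near3_slice1 (a b c : R) (P : R -> R -> R -> Prop) :
  near3 a b c P -> locally a (fun x => P x b c).
Proof.
intros [d [hd H]]; exists (mkposreal d hd); intros x hx.
apply H; [exact hx| |]; rewrite Rminus_diag, Rabs_R0; assumption.
Qed.

Lemma near3_slice2 (a b c : R) (P : R -> R -> R -> Prop) :
  near3 a b c P -> locally b (fun y => P a y c).
Proof.
intros [d [hd H]]; exists (mkposreal d hd); intros x hx.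
apply H; [|exact hx|]; rewrite Rminus_diag, Rabs_R0; assumption.
Qed.

Lemma near3_slice3 (a b c : R) (P : R -> R -> R -> Prop) :
  near3 a b c P -> locally c (fun z => P a b z).
Proof.
intros [d [hd H]]; exists (mkposreal d hd); intros x hx.
apply H; [| |exact hx]; rewrite Rminus_diag, Rabs_R0; assumption.
Qed.

(** * Continuity of functions of three variables *)

Definition cont3 (f : R -> R -> R -> R) (a b c : R) : Prop :=
  forall e, 0 < e -> near3 a b c (fun x y z => Rabs (f x y z - f a b c) < e).

Definition uncurry3 (f : R -> R -> R -> R) (q : R * R * R) : R :=
  f (fst (fst q)) (snd (fst q)) (snd q).

Lemma cont3_continuous (f : R -> R -> R -> R) (a b c : R) :
  cont3 f a b c <-> continuous (uncurry3 f) (a, b, c).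
Proof.
split.
- intros h; apply filterlim_locally; intros e.
  apply near3_locally; apply h; apply cond_pos.
- intros h e he.
  apply (near3_locally a b c (fun q => Rabs (uncurry3 f q - f a b c) < e)).
  exact (proj1 (filterlim_locally _ _) h (mkposreal e he)).
Qed.

Lemma near3_comp (F : R -> R -> R -> Prop) (f g h : R -> R -> R -> R) (a b c : R) :
  cont3 f a b c -> cont3 g a b c -> cont3 h a b c ->
  near3 (f a b c) (g a b c) (h a b c) F ->
  near3 a b c (fun x y z => F (f x y z) (g x y z) (h x y z)).
Proof.
intros hf hg hh [d [hd H]].
generalize (near3_and _ _ _ _ _ (hf d hd) (near3_and _ _ _ _ _ (hg d hd) (hh d hd))).
apply near3_imp; intros x y z [h1 [h2 h3]]; auto.
Qed.

Lemma cont3_comp (F f g h : R -> R -> R -> R) (a b c : R) :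
  cont3 F (f a b c) (g a b c) (h a b c) ->
  cont3 f a b c -> cont3 g a b c -> cont3 h a b c ->
  cont3 (fun x y z => F (f x y z) (g x y z) (h x y z)) a b c.
Proof.
intros HF hf hg hh e he.
exact (near3_comp _ f g h a b c hf hg hh (HF e he)).
Qed.

Lemma cont3_const (k a b c : R) : cont3 (fun _ _ _ => k) a b c.
Proof.
intros e he; apply near3_true; intros; rewrite Rminus_diag, Rabs_R0; assumption.
Qed.

Lemma cont3_fst (a b c : R) : cont3 (fun x _ _ => x) a b c.
Proof. intros e he; exists e; split; auto. Qed.
Lemma cont3_snd (a b c : R) : cont3 (fun _ y _ => y) a b c.
Proof. intros e he; exists e; split; auto. Qed.
Lemma cont3_trd (a b c : R) : cont3 (fun _ _ z => z) a b c.
Proof. intros e he; exists e; split; auto. Qed.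

Lemma cont3_plus (f g : R -> R -> R -> R) (a b c : R) :
  cont3 f a b c -> cont3 g a b c -> cont3 (fun x y z => f x y z + g x y z) a b c.
Proof.
rewrite !cont3_continuous; intros hf hg.
exact (continuous_plus (uncurry3 f) (uncurry3 g) _ hf hg).
Qed.

Lemma cont3_mult (f g : R -> R -> R -> R) (a b c : R) :
  cont3 f a b c -> cont3 g a b c -> cont3 (fun x y z => f x y z * g x y z) a b c.
Proof.
rewrite !cont3_continuous; intros hf hg.
exact (continuous_mult (uncurry3 f) (uncurry3 g) _ hf hg).
Qed.

Lemma cont3_fun1 (u : R -> R) (f : R -> R -> R -> R) (a b c : R) :
  continuous u (f a b c) -> cont3 f a b c -> cont3 (fun x y z => u (f x y z)) a b c.
Proof.
rewrite !cont3_continuous; intros hu hf.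
exact (continuous_comp (uncurry3 f) u (a, b, c) hf hu).
Qed.

Lemma cont3_ext_near (f g : R -> R -> R -> R) (a b c : R) :
  near3 a b c (fun x y z => f x y z = g x y z) -> cont3 f a b c -> cont3 g a b c.
Proof.
intros hn hf e he.
pose proof (near3_pt _ _ _ _ hn) as h0.
generalize (near3_and _ _ _ _ _ hn (hf e he)); apply near3_imp.
intros x y z [h1 h2]; rewrite <- h0, <- h1; exact h2.
Qed.

Lemma cont3_curve (f : R -> R -> R -> R) (u v w : R -> R) (s : R) :
  cont3 f (u s) (v s) (w s) -> continuous u s -> continuous v s -> continuous w s ->
  continuous (fun r => f (u r) (v r) (w r)) s.
Proof.
rewrite cont3_continuous; intros hf hu hv hw.
apply (continuous_comp (fun r => (u r, v r, w r)) (uncurry3 f)); [|exact hf].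
unfold continuous; apply (filterlim_comp_2 (G := locally (u s, v s)) (H := locally (w s))); [|exact hw|].
- apply (filterlim_comp_2 (G := locally (u s)) (H := locally (v s))); [exact hu|exact hv|].
  intros P [e He]; exists (ball (u s) e) (ball (v s) e).
  + apply locally_ball.
  + apply locally_ball.
  + intros x y h1 h2; apply He; split; assumption.
- intros P [e He]; exists (ball (u s, v s) e) (ball (w s) e).
  + apply locally_ball.
  + apply locally_ball.
  + intros x y h1 h2; apply He; split; assumption.
Qed.

Lemma near3_curve (P : R -> R -> R -> Prop) (u v w : R -> R) (s : R) :
  near3 (u s) (v s) (w s) P -> continuous u s -> continuous v s -> continuous w s ->
  locally s (fun r => P (u r) (v r) (w r)).
Proof.
intros [d [hd H]] hu hv hw.
pose proof (proj1 (filterlim_locally _ _) hu (mkposreal d hd)) as h1.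
pose proof (proj1 (filterlim_locally _ _) hv (mkposreal d hd)) as h2.
pose proof (proj1 (filterlim_locally _ _) hw (mkposreal d hd)) as h3.
generalize (filter_and _ _ h1 (filter_and _ _ h2 h3)).
apply filter_imp; intros r [k1 [k2 k3]]; apply H; assumption.
Qed.

(** The derivative as a real inequality with the increment multiplied out. The chain rule, the
    dependence of an ODE on its data and the implicit derivative are all proved by such
    estimates. *)
Lemma is_derive_eps (f : R -> R) (x l : R) :
  is_derive f x l <->
  (forall e, 0 < e -> locally x (fun y => Rabs (f y - f x - l * (y - x)) <= e * Rabs (y - x))).
Proof.
split.
- intros [_ h] e he.
  specialize (h x (fun P hP => hP) (mkposreal e he)).
  revert h; apply filter_imp; intros y hy.
  unfold minus, plus, opp, scal, norm in hy; simpl in hy.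
  unfold mult, abs in hy; simpl in hy.
  replace (f y - f x - l * (y - x)) with (f y + - f x + - ((y + - x) * l)) by ring.
  exact hy.
- intros h; split; [apply is_linear_scal_l|].
  intros x' hx' e.
  apply (@is_filter_lim_locally_unique R_AbsRing (AbsRing_NormedModule R_AbsRing)) in hx'; subst x'.
  generalize (h e (cond_pos e)); apply filter_imp; intros y hy.
  unfold minus, plus, opp, scal, norm; simpl.
  unfold mult, abs; simpl.
  replace (f y + - f x + - ((y + - x) * l)) with (f y - f x - l * (y - x)) by ring.
  exact hy.
Qed.

Lemma mvt_segment (g dg : R -> R) (a b : R) :
  (forall v, Rmin a b <= v <= Rmax a b -> is_derive g v (dg v)) ->
  exists v, Rmin a b <= v <= Rmax a b /\ g b - g a = dg v * (b - a).
Proof.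
intros h; apply MVT_gen.
- intros x hx; apply h; lra.
- intros x hx; apply continuity_pt_filterlim.
  apply (ex_derive_continuous g x); exists (dg x); apply h; exact hx.
Qed.

Lemma segment_dist (a x v d : R) :
  Rmin a x <= v <= Rmax a x -> Rabs (x - a) < d -> Rabs (v - a) < d.
Proof.
unfold Rmin, Rmax; destruct (Rle_dec a x); intros h1 h2;
  apply Rabs_def2 in h2; apply Rabs_def1; lra.
Qed.

Definition exd3 (f : R -> R -> R -> R) (a b c : R) : Prop :=
  ex_derive (fun s => f s b c) a /\ ex_derive (fun s => f a s c) b /\
  ex_derive (fun s => f a b s) c.

(** A sufficient condition for total differentiability at one point: partial derivatives exist
    nearby and are continuous at the point itself. *)
Definition C1at (f : R -> R -> R -> R) (a b c : R) : Prop :=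
  near3 a b c (exd3 f) /\
  cont3 (d1 f) a b c /\ cont3 (d2 f) a b c /\ cont3 (d3 f) a b c.

(** The increment is telescoped along three edges, (a, b, c) to (a, b, z) to (a, y, z) to (x, y, z),
    and the mean value theorem on each edge produces a partial derivative at a point close to (a, b,
    c). *)
Lemma C1at_diff (f : R -> R -> R -> R) (a b c : R) : C1at f a b c ->
  forall e, 0 < e -> near3 a b c (fun x y z =>
    Rabs (f x y z - f a b c
          - (d1 f a b c * (x - a) + d2 f a b c * (y - b) + d3 f a b c * (z - c)))
    <= e * (Rabs (x - a) + Rabs (y - b) + Rabs (z - c))).
Proof.
intros [[d0 [hd0 hex]] [h1 [h2 h3]]] e he.
destruct (near3_and _ _ _ _ _ (h1 e he) (near3_and _ _ _ _ _ (h2 e he) (h3 e he)))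
  as [d [hd H]].
exists (Rmin d d0); split; [apply Rmin_pos; auto|].
intros x y z hx hy hz.
assert (z0 : forall r, Rabs (r - r) < Rmin d d0).
{ intros r; rewrite Rminus_diag, Rabs_R0; apply Rmin_pos; auto. }
pose proof (Rmin_l d d0); pose proof (Rmin_r d d0).
assert (za := z0 a); assert (zb := z0 b).
destruct (mvt_segment (fun s => f s y z) (fun s => d1 f s y z) a x) as [v1 [k1 e1]].
{ intros v hv; pose proof (segment_dist a x v _ hv hx).
  apply Derive_correct; apply (hex v y z); lra. }
destruct (mvt_segment (fun s => f a s z) (fun s => d2 f a s z) b y) as [v2 [k2 e2]].
{ intros v hv; pose proof (segment_dist b y v _ hv hy).
  apply Derive_correct; apply (hex a v z); lra. }
destruct (mvt_segment (fun s => f a b s) (fun s => d3 f a b s) c z) as [v3 [k3 e3]].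
{ intros v hv; pose proof (segment_dist c z v _ hv hz).
  apply Derive_correct; apply (hex a b v); lra. }
apply segment_dist with (d := Rmin d d0) in k1; [|exact hx].
apply segment_dist with (d := Rmin d d0) in k2; [|exact hy].
apply segment_dist with (d := Rmin d d0) in k3; [|exact hz].
destruct (H v1 y z) as [b1 _]; [lra..|].
destruct (H a v2 z) as [_ [b2 _]]; [lra..|].
destruct (H a b v3) as [_ [_ b3]]; [lra..|].
replace (f x y z - f a b c -
   (d1 f a b c * (x - a) + d2 f a b c * (y - b) + d3 f a b c * (z - c)))
 with ((d1 f v1 y z - d1 f a b c) * (x - a) + (d2 f a v2 z - d2 f a b c) * (y - b)
       + (d3 f a b v3 - d3 f a b c) * (z - c)) by (revert e1 e2 e3; lra).
rewrite !Rmult_plus_distr_l.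
eapply Rle_trans; [apply Rabs_triang|]; apply Rplus_le_compat;
 [eapply Rle_trans; [apply Rabs_triang|]; apply Rplus_le_compat|];
 rewrite Rabs_mult; apply Rmult_le_compat_r; try apply Rabs_pos; lra.
Qed.

Lemma C1at_cont3 (f : R -> R -> R -> R) (a b c : R) : C1at f a b c -> cont3 f a b c.
Proof.
intros h e he.
(* The partial derivatives bound the linear part, and 3 bounds the remainder of [C1at_diff] taken
   with tolerance 1. *)
set (M := Rabs (d1 f a b c) + Rabs (d2 f a b c) + Rabs (d3 f a b c) + 3).
assert (hM : 0 < M).
{ unfold M; pose proof (Rabs_pos (d1 f a b c)); pose proof (Rabs_pos (d2 f a b c));
  pose proof (Rabs_pos (d3 f a b c)); lra. }
generalize (near3_and _ _ _ _ _ (C1at_diff f a b c h 1 Rlt_0_1)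
  (near3_box a b c (e / M) (Rdiv_lt_0_compat _ _ he hM))).
apply near3_imp; intros x y z [k [hx [hy hz]]].
set (r := e / M) in *.
assert (hr : e = r * M) by (unfold r; field; lra).
replace (f x y z - f a b c) with
 ((f x y z - f a b c - (d1 f a b c * (x - a) + d2 f a b c * (y - b) + d3 f a b c * (z - c)))
  + (d1 f a b c * (x - a) + d2 f a b c * (y - b) + d3 f a b c * (z - c))) by ring.
eapply Rle_lt_trans; [apply Rabs_triang|].
assert (Rabs (d1 f a b c * (x - a) + d2 f a b c * (y - b) + d3 f a b c * (z - c))
  <= Rabs (d1 f a b c) * r + Rabs (d2 f a b c) * r + Rabs (d3 f a b c) * r).
{ eapply Rle_trans; [apply Rabs_triang|]; apply Rplus_le_compat;
  [eapply Rle_trans; [apply Rabs_triang|]; apply Rplus_le_compat|];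
  rewrite Rabs_mult; apply Rmult_le_compat_l; try apply Rabs_pos; lra. }
rewrite hr; unfold M; lra.
Qed.

Lemma chain_rule (f : R -> R -> R -> R) (u v w : R -> R) (s u' v' w' : R) :
  C1at f (u s) (v s) (w s) ->
  is_derive u s u' -> is_derive v s v' -> is_derive w s w' ->
  is_derive (fun r => f (u r) (v r) (w r)) s
    (d1 f (u s) (v s) (w s) * u' + d2 f (u s) (v s) (w s) * v'
     + d3 f (u s) (v s) (w s) * w').
Proof.
intros hf hu hv hw.
assert (cu : continuous u s) by (apply (ex_derive_continuous u s); exists u'; exact hu).
assert (cv : continuous v s) by (apply (ex_derive_continuous v s); exists v'; exact hv).
assert (cw : continuous w s) by (apply (ex_derive_continuous w s); exists w'; exact hw).
set (p := d1 f (u s) (v s) (w s)); set (q := d2 f (u s) (v s) (w s));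
set (t := d3 f (u s) (v s) (w s)).
apply is_derive_eps; intros e he.
(* The remainder of f contributes [e1] times (|u'| + |v'| + |w'| + 3) and the remainders of the
   three curves contribute [e1] times (|p| + |q| + |t|); their sum is [e1 * M]. *)
set (M := Rabs p + Rabs q + Rabs t + Rabs u' + Rabs v' + Rabs w' + 3).
pose proof (Rabs_pos p); pose proof (Rabs_pos q); pose proof (Rabs_pos t);
pose proof (Rabs_pos u'); pose proof (Rabs_pos v'); pose proof (Rabs_pos w').
assert (hM : 0 < M) by (unfold M; lra).
set (e1 := e / M).
assert (he1 : 0 < e1) by (apply Rdiv_lt_0_compat; lra).
(* The cap 1 turns differentiability into the Lipschitz bound |l| + 1 of [bnd] below. *)
set (e2 := Rmin e1 1).
assert (he2 : 0 < e2) by (apply Rmin_pos; lra).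
pose proof (Rmin_l e1 1); pose proof (Rmin_r e1 1).
fold e2 in H5, H6.
pose proof (near3_curve _ u v w s (C1at_diff f _ _ _ hf e1 he1) cu cv cw) as hF.
generalize (filter_and _ _ hF (filter_and _ _ (proj1 (is_derive_eps _ _ _) hu e2 he2)
  (filter_and _ _ (proj1 (is_derive_eps _ _ _) hv e2 he2)
    (proj1 (is_derive_eps _ _ _) hw e2 he2)))).
apply filter_imp; intros r [k0 [k1 [k2 k3]]].
fold p q t in k0.
set (D := Rabs (r - s)) in *.
assert (hD : 0 <= D) by apply Rabs_pos.
assert (bnd : forall (g : R -> R) l, Rabs (g r - g s - l * (r - s)) <= e2 * D ->
   Rabs (g r - g s) <= (Rabs l + 1) * D).
{ intros g l hg.
  replace (g r - g s) with ((g r - g s - l * (r - s)) + l * (r - s)) by ring.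
  eapply Rle_trans; [apply Rabs_triang|].
  rewrite (Rabs_mult l); fold D.
  assert (e2 * D <= 1 * D) by (apply Rmult_le_compat_r; lra). lra. }
pose proof (bnd u u' k1) as b1; pose proof (bnd v v' k2) as b2; pose proof (bnd w w' k3) as b3.
set (X := f (u r) (v r) (w r)) in *; set (X0 := f (u s) (v s) (w s)) in *.
replace (X - X0 - (p * u' + q * v' + t * w') * (r - s)) with
 ((X - X0 - (p * (u r - u s) + q * (v r - v s) + t * (w r - w s)))
  + (p * (u r - u s - u' * (r - s)) + q * (v r - v s - v' * (r - s))
     + t * (w r - w s - w' * (r - s)))) by ring.
eapply Rle_trans; [apply Rabs_triang|].
assert (c1 : Rabs (p * (u r - u s - u' * (r - s)) + q * (v r - v s - v' * (r - s))
     + t * (w r - w s - w' * (r - s))) <= (Rabs p + Rabs q + Rabs t) * (e1 * D)).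
{ assert (e2 * D <= e1 * D) by (apply Rmult_le_compat_r; lra).
  rewrite !Rmult_plus_distr_r.
  eapply Rle_trans; [apply Rabs_triang|]; apply Rplus_le_compat;
  [eapply Rle_trans; [apply Rabs_triang|]; apply Rplus_le_compat|];
  rewrite Rabs_mult; apply Rmult_le_compat_l; try apply Rabs_pos; lra. }
assert (c2 : e1 * (Rabs (u r - u s) + Rabs (v r - v s) + Rabs (w r - w s))
  <= e1 * ((Rabs u' + Rabs v' + Rabs w' + 3) * D)).
{ apply Rmult_le_compat_l; lra. }
apply Rle_trans with (e1 * D * M); [unfold M; lra|].
unfold e1; right; field; lra.
Qed.

(** * Functions of class C^n on open sets *)

Definition open3 (W : R -> R -> R -> Prop) : Prop :=
  forall a b c, W a b c -> near3 a b c W.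

(** Smoothness graded by order, where [smooth3_on] quantifies over all lists of directions at once.
    The grading lets closure properties go by induction and lets ODE solutions and implicit
    functions gain one derivative at a time. *)
Fixpoint Ck (n : nat) (W : R -> R -> R -> Prop) (f : R -> R -> R -> R) : Prop :=
  (forall a b c, W a b c -> cont3 f a b c) /\
  match n with
  | O => True
  | S m => (forall a b c, W a b c -> exd3 f a b c) /\ (forall d, Ck m W (pd3 d f))
  end.

Definition Cinf (W : R -> R -> R -> Prop) (f : R -> R -> R -> R) : Prop :=
  forall n, Ck n W f.

Definition box (a0 b0 c0 d a b c : R) : Prop :=
  Rabs (a - a0) < d /\ Rabs (b - b0) < d /\ Rabs (c - c0) < d.

Lemma open3_box (a0 b0 c0 d : R) : open3 (box a0 b0 c0 d).
Proof.
intros a b c [h1 [h2 h3]].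
set (m := Rmin (d - Rabs (a - a0)) (Rmin (d - Rabs (b - b0)) (d - Rabs (c - c0)))).
assert (hm : 0 < m) by (repeat apply Rmin_pos; lra).
assert (m <= d - Rabs (a - a0) /\ m <= d - Rabs (b - b0) /\ m <= d - Rabs (c - c0)).
{ unfold m; repeat split; [apply Rmin_l| |];
  (eapply Rle_trans; [apply Rmin_r|]); [apply Rmin_l|apply Rmin_r]. }
exists m; split; [exact hm|]; intros x y z k1 k2 k3; repeat split.
- replace (x - a0) with ((x - a) + (a - a0)) by ring.
  eapply Rle_lt_trans; [apply Rabs_triang|lra].
- replace (y - b0) with ((y - b) + (b - b0)) by ring.
  eapply Rle_lt_trans; [apply Rabs_triang|lra].
- replace (z - c0) with ((z - c) + (c - c0)) by ring.
  eapply Rle_lt_trans; [apply Rabs_triang|lra].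
Qed.

Lemma box_center (a0 b0 c0 d : R) : 0 < d -> box a0 b0 c0 d a0 b0 c0.
Proof. intros; repeat split; rewrite Rminus_diag, Rabs_R0; assumption. Qed.

Lemma box_near (a0 b0 c0 : R) (P : R -> R -> R -> Prop) :
  near3 a0 b0 c0 P <->
  exists d, 0 < d /\ forall a b c, box a0 b0 c0 d a b c -> P a b c.
Proof.
split; intros [d [hd H]]; exists d; split; auto.
- intros a b c [h1 [h2 h3]]; auto.
- intros a b c h1 h2 h3; apply H; repeat split; auto.
Qed.

Lemma box_le (a0 b0 c0 d d' a b c : R) : d <= d' -> box a0 b0 c0 d a b c -> box a0 b0 c0 d' a b c.
Proof. intros h [h1 [h2 h3]]; repeat split; lra. Qed.

Lemma Ck_C0 n W f a b c : Ck n W f -> W a b c -> cont3 f a b c.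
Proof. destruct n; intros [h _]; apply h. Qed.

Lemma Ck_S n W f : Ck (S n) W f -> Ck n W f.
Proof.
revert f; induction n as [|n IH]; intros f [h0 [h1 h2]]; split; auto.
Qed.

Lemma Ck_sub n (W W' : R -> R -> R -> Prop) f :
  (forall a b c, W' a b c -> W a b c) -> Ck n W f -> Ck n W' f.
Proof.
intros hs; revert f; induction n as [|n IH]; intros f [h0 h1]; split; auto.
destruct h1 as [h1 h2]; split; auto.
Qed.

Lemma pd3_ext (f g : R -> R -> R -> R) d a b c :
  near3 a b c (fun x y z => f x y z = g x y z) -> pd3 d f a b c = pd3 d g a b c.
Proof.
intros h; destruct d; apply Derive_ext_loc.
- exact (near3_slice1 _ _ _ _ h).
- exact (near3_slice2 _ _ _ _ h).
- exact (near3_slice3 _ _ _ _ h).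
Qed.

Lemma exd3_ext (f g : R -> R -> R -> R) a b c :
  near3 a b c (fun x y z => f x y z = g x y z) -> exd3 f a b c -> exd3 g a b c.
Proof.
intros h [h1 [h2 h3]]; repeat split.
- exact (ex_derive_ext_loc _ _ _ (near3_slice1 _ _ _ _ h) h1).
- exact (ex_derive_ext_loc _ _ _ (near3_slice2 _ _ _ _ h) h2).
- exact (ex_derive_ext_loc _ _ _ (near3_slice3 _ _ _ _ h) h3).
Qed.

Lemma Ck_ext n W f g : open3 W -> (forall a b c, W a b c -> f a b c = g a b c) ->
  Ck n W f -> Ck n W g.
Proof.
intros hW; revert f g; induction n as [|n IH]; intros f g heq [h0 h1].
- split; [|exact I]; intros a b c hw.
  apply (cont3_ext_near f); [|auto].
  generalize (hW a b c hw); apply near3_imp; auto.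
- destruct h1 as [h1 h2].
  assert (hn : forall a b c, W a b c -> near3 a b c (fun x y z => f x y z = g x y z)).
  { intros a b c hw; generalize (hW a b c hw); apply near3_imp; auto. }
  split; [|split].
  + intros a b c hw; apply (cont3_ext_near f); auto.
  + intros a b c hw; apply (exd3_ext f); auto.
  + intros d; apply (IH (pd3 d f)); [|auto].
    intros a b c hw; apply pd3_ext; auto.
Qed.

Lemma Ck_C1at n W f a b c : open3 W -> Ck (S n) W f -> W a b c -> C1at f a b c.
Proof.
intros hW [h0 [h1 h2]] hw; split; [|split; [|split]].
- generalize (hW a b c hw); apply near3_imp; auto.
- exact (Ck_C0 n W _ a b c (h2 Dir_1) hw).
- exact (Ck_C0 n W _ a b c (h2 Dir_2) hw).
- exact (Ck_C0 n W _ a b c (h2 Dir_3) hw).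
Qed.

Definition partials (f : R -> R -> R -> R) (G : dir3 -> R -> R -> R -> R) (a b c : R) : Prop :=
  is_derive (fun s => f s b c) a (G Dir_1 a b c) /\
  is_derive (fun s => f a s c) b (G Dir_2 a b c) /\
  is_derive (fun s => f a b s) c (G Dir_3 a b c).

Lemma exd3_partials f a b c : exd3 f a b c -> partials f (fun d => pd3 d f) a b c.
Proof.
intros [h1 [h2 h3]]; split; [|split]; apply Derive_correct; assumption.
Qed.

Lemma partials_exd3 f G a b c : partials f G a b c -> exd3 f a b c.
Proof. intros [h1 [h2 h3]]; repeat split; eexists; eassumption. Qed.

Lemma partials_pd3 f G a b c d : partials f G a b c -> pd3 d f a b c = G d a b c.
Proof.
intros [h1 [h2 h3]]; destruct d; apply is_derive_unique; assumption.
Qed.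

(** The usual way to reach order n + 1: exhibit candidates for the partial derivatives and prove
    them C^n. Continuity of f itself then follows from [C1at_cont3]. *)
Lemma Ck_intro n W f (G : dir3 -> R -> R -> R -> R) : open3 W ->
  (forall a b c, W a b c -> partials f G a b c) ->
  (forall d, Ck n W (G d)) -> Ck (S n) W f.
Proof.
intros hW hp hG.
assert (hex : forall a b c, W a b c -> exd3 f a b c).
{ intros a b c hw; exact (partials_exd3 _ _ _ _ _ (hp a b c hw)). }
assert (hd : forall d, Ck n W (pd3 d f)).
{ intros d; apply (Ck_ext n W (G d)); auto.
  intros a b c hw; symmetry; apply partials_pd3; auto. }
split; [|split]; auto.
intros a b c hw; apply C1at_cont3; split; [|split; [|split]].
- generalize (hW a b c hw); apply near3_imp; auto.
- exact (Ck_C0 n W _ a b c (hd Dir_1) hw).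
- exact (Ck_C0 n W _ a b c (hd Dir_2) hw).
- exact (Ck_C0 n W _ a b c (hd Dir_3) hw).
Qed.

Lemma is_derive_Rconst (k x : R) : is_derive (fun _ : R => k) x 0.
Proof. exact (is_derive_const (K := R_AbsRing) (V := R_NormedModule) k x). Qed.

Lemma is_derive_Rid (x : R) : is_derive (fun y : R => y) x 1.
Proof. exact (is_derive_id (K := R_AbsRing) x). Qed.

Lemma Ck_const n W k : open3 W -> Ck n W (fun _ _ _ => k).
Proof.
intros hW; revert k; induction n as [|n IH]; intros k.
- split; auto; intros; apply cont3_const.
- apply (Ck_intro n W _ (fun _ _ _ _ => 0)); auto.
  intros a b c _; split; [|split]; apply is_derive_Rconst.
Qed.

Definition proj3 (d : dir3) (a b c : R) : R :=
  match d with Dir_1 => a | Dir_2 => b | Dir_3 => c end.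

Lemma Ck_proj3 n W d : open3 W -> Ck n W (proj3 d).
Proof.
intros hW; destruct n as [|n].
- split; auto; intros; destruct d; [apply cont3_fst|apply cont3_snd|apply cont3_trd].
- apply (Ck_intro n W _ (fun d' _ _ _ =>
    match d, d' with Dir_1, Dir_1 => 1 | Dir_2, Dir_2 => 1 | Dir_3, Dir_3 => 1 | _, _ => 0 end)).
  + exact hW.
  + intros a b c _; split; [|split]; destruct d; simpl;
    first [apply is_derive_Rconst | apply is_derive_Rid].
  + intros; apply Ck_const; exact hW.
Qed.

Lemma Ck_plus n W f g : open3 W -> Ck n W f -> Ck n W g ->
  Ck n W (fun a b c => f a b c + g a b c).
Proof.
intros hW; revert f g; induction n as [|n IH]; intros f g [f0 hf] [g0 hg].
- split; auto; intros; apply cont3_plus; auto.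
- destruct hf as [f1 f2], hg as [g1 g2].
  apply (Ck_intro n W _ (fun d a b c => pd3 d f a b c + pd3 d g a b c)); [exact hW|..].
  + intros a b c hw.
    destruct (exd3_partials _ _ _ _ (f1 a b c hw)) as [k1 [k2 k3]].
    destruct (exd3_partials _ _ _ _ (g1 a b c hw)) as [l1 [l2 l3]].
    split; [|split].
    * exact (is_derive_plus (fun s => f s b c) (fun s => g s b c) a _ _ k1 l1).
    * exact (is_derive_plus (fun s => f a s c) (fun s => g a s c) b _ _ k2 l2).
    * exact (is_derive_plus (fun s => f a b s) (fun s => g a b s) c _ _ k3 l3).
  + intros d; apply IH; auto.
Qed.

Lemma is_derive_Rmult (f g : R -> R) x f' g' :
  is_derive f x f' -> is_derive g x g' ->
  is_derive (fun y => f y * g y) x (f' * g x + f x * g').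
Proof.
intros hf hg; apply (is_derive_mult f g x f' g' hf hg); exact Rmult_comm.
Qed.

Lemma Ck_mult n W f g : open3 W -> Ck n W f -> Ck n W g ->
  Ck n W (fun a b c => f a b c * g a b c).
Proof.
intros hW; revert f g; induction n as [|n IH]; intros f g hf hg.
- destruct hf as [f0 hf], hg as [g0 hg].
  split; auto; intros; apply cont3_mult; auto.
- pose proof (Ck_S _ _ _ hf) as hf'; pose proof (Ck_S _ _ _ hg) as hg'.
  destruct hf as [f0 [f1 f2]], hg as [g0 [g1 g2]].
  apply (Ck_intro n W _
    (fun d a b c => pd3 d f a b c * g a b c + f a b c * pd3 d g a b c)); auto.
  + intros a b c hw.
    destruct (exd3_partials _ _ _ _ (f1 a b c hw)) as [k1 [k2 k3]].
    destruct (exd3_partials _ _ _ _ (g1 a b c hw)) as [l1 [l2 l3]].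
    split; [|split].
    * exact (is_derive_Rmult (fun s => f s b c) (fun s => g s b c) a _ _ k1 l1).
    * exact (is_derive_Rmult (fun s => f a s c) (fun s => g a s c) b _ _ k2 l2).
    * exact (is_derive_Rmult (fun s => f a b s) (fun s => g a b s) c _ _ k3 l3).
  + intros d; apply Ck_plus; auto.
Qed.

(** The induction keeps F general, because the chain rule replaces F by its partial derivatives
    while the inner functions stay the same and merely lose one order. *)
Lemma Ck_comp n W W' F f g h : open3 W -> open3 W' -> Ck n W' F ->
  Ck n W f -> Ck n W g -> Ck n W h ->
  (forall a b c, W a b c -> W' (f a b c) (g a b c) (h a b c)) ->
  Ck n W (fun a b c => F (f a b c) (g a b c) (h a b c)).
Proof.
intros hW hW'; revert F; induction n as [|n IH]; intros F hF hf hg hh hm.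
- split; auto; intros a b c hw.
  apply cont3_comp; [apply (Ck_C0 0 W'); auto|..]; apply (Ck_C0 0 W); auto.
- apply (Ck_intro n W _ (fun d a b c =>
     d1 F (f a b c) (g a b c) (h a b c) * pd3 d f a b c
     + d2 F (f a b c) (g a b c) (h a b c) * pd3 d g a b c
     + d3 F (f a b c) (g a b c) (h a b c) * pd3 d h a b c)); auto.
  + intros a b c hw.
    pose proof (Ck_C1at n W' F _ _ _ hW' hF (hm a b c hw)) as hc.
    destruct hf as [_ [hf _]], hg as [_ [hg _]], hh as [_ [hh _]].
    destruct (exd3_partials _ _ _ _ (hf a b c hw)) as [f1 [f2 f3]].
    destruct (exd3_partials _ _ _ _ (hg a b c hw)) as [g1 [g2 g3]].
    destruct (exd3_partials _ _ _ _ (hh a b c hw)) as [h1 [h2 h3]].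
    split; [|split].
    * exact (chain_rule F (fun s => f s b c) (fun s => g s b c) (fun s => h s b c)
              a _ _ _ hc f1 g1 h1).
    * exact (chain_rule F (fun s => f a s c) (fun s => g a s c) (fun s => h a s c)
              b _ _ _ hc f2 g2 h2).
    * exact (chain_rule F (fun s => f a b s) (fun s => g a b s) (fun s => h a b s)
              c _ _ _ hc f3 g3 h3).
  + pose proof (Ck_S _ _ _ hf); pose proof (Ck_S _ _ _ hg); pose proof (Ck_S _ _ _ hh).
    destruct hF as [_ [_ hF]], hf as [_ [_ hf]], hg as [_ [_ hg]], hh as [_ [_ hh]].
    intros d; repeat apply Ck_plus; try apply Ck_mult; auto.
    * exact (IH (d1 F) (hF Dir_1) ltac:(auto) ltac:(auto) ltac:(auto) hm).
    * exact (IH (d2 F) (hF Dir_2) ltac:(auto) ltac:(auto) ltac:(auto) hm).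
    * exact (IH (d3 F) (hF Dir_3) ltac:(auto) ltac:(auto) ltac:(auto) hm).
Qed.

Lemma Ck_exp n W f : open3 W -> Ck n W f -> Ck n W (fun a b c => exp (f a b c)).
Proof.
intros hW; revert f; induction n as [|n IH]; intros f hf.
- split; auto; intros a b c hw; apply cont3_fun1.
  + apply (ex_derive_continuous exp); eexists; apply is_derive_exp.
  + apply (Ck_C0 0 W); auto.
- apply (Ck_intro n W _ (fun d a b c => pd3 d f a b c * exp (f a b c))); auto.
  + intros a b c hw; destruct hf as [_ [hf _]].
    destruct (exd3_partials _ _ _ _ (hf a b c hw)) as [f1 [f2 f3]].
    split; [|split].
    * exact (is_derive_comp exp (fun s => f s b c) a _ _ (is_derive_exp _) f1).
    * exact (is_derive_comp exp (fun s => f a s c) b _ _ (is_derive_exp _) f2).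
    * exact (is_derive_comp exp (fun s => f a b s) c _ _ (is_derive_exp _) f3).
  + intros d; apply Ck_mult; auto; [apply hf|apply IH; apply Ck_S; auto].
Qed.

Lemma Ck_inv n W f : open3 W -> (forall a b c, W a b c -> f a b c <> 0) ->
  Ck n W f -> Ck n W (fun a b c => / f a b c).
Proof.
intros hW hz; induction n as [|n IH]; intros hf.
- split; auto; intros a b c hw; apply cont3_fun1.
  + apply (ex_derive_continuous Rinv); auto_derive; auto.
  + apply (Ck_C0 0 W); auto.
- apply (Ck_intro n W _ (fun d a b c =>
     pd3 d f a b c * (-1 * (/ f a b c * / f a b c)))); auto.
  + intros a b c hw; pose proof (hz a b c hw) as hz0; destruct hf as [_ [hf _]].
    destruct (exd3_partials _ _ _ _ (hf a b c hw)) as [f1 [f2 f3]].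
    assert (hi : is_derive Rinv (f a b c) (-1 * (/ f a b c * / f a b c))).
    { auto_derive; auto; field; auto. }
    split; [|split].
    * exact (is_derive_comp Rinv (fun s => f s b c) a _ _ hi f1).
    * exact (is_derive_comp Rinv (fun s => f a s c) b _ _ hi f2).
    * exact (is_derive_comp Rinv (fun s => f a b s) c _ _ hi f3).
  + pose proof (IH (Ck_S _ _ _ hf)).
    intros d; repeat apply Ck_mult; auto; [apply hf|apply Ck_const; auto].
Qed.

Lemma Cinf_pd3 W f d : Cinf W f -> Cinf W (pd3 d f).
Proof. intros h n; apply (h (S n)). Qed.

Lemma Cinf_partials W f a b c : Cinf W f -> W a b c -> partials f (fun d => pd3 d f) a b c.
Proof. intros h hw; apply exd3_partials; apply (h 1%nat); exact hw. Qed.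

Lemma Cinf_C1at W f a b c : open3 W -> Cinf W f -> W a b c -> C1at f a b c.
Proof. intros hW h hw; apply (Ck_C1at 0 W); auto. Qed.

Lemma Cinf_smooth3 (W : R * R * R -> Prop) f :
  smooth3_on W f <-> Cinf (fun a b c => W (a, b, c)) f.
Proof.
split.
- intros h n; revert f h; induction n as [|n IH]; intros f h.
  + split; auto; intros a b c hw; apply cont3_continuous; exact (proj1 (h nil a b c hw)).
  + split; [|split].
    * intros a b c hw; apply cont3_continuous; exact (proj1 (h nil a b c hw)).
    * intros a b c hw; exact (proj2 (h nil a b c hw)).
    * intros d; apply IH; intros l a b c hw.
      (* The last letter of the list is the derivative applied first, so appending [d] passes from f
         to [pd3 d f]. *)
      generalize (h (l ++ d :: nil)%list a b c hw); rewrite fold_right_app; auto.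
- intros h l a b c hw g.
  assert (hg : Cinf (fun a b c => W (a, b, c)) g).
  { unfold g; clear g; induction l as [|d l IH]; [exact h|apply Cinf_pd3; exact IH]. }
  split.
  + apply (cont3_continuous g); exact (Ck_C0 0 _ g a b c (hg O) hw).
  + exact (proj1 (proj2 (hg 1%nat)) a b c hw).
Qed.

Lemma smooth3_near_box f a0 b0 c0 :
  smooth3_near f a0 b0 c0 <-> exists d, 0 < d /\ Cinf (box a0 b0 c0 d) f.
Proof.
split.
- intros [W [hW [h0 h]]]; apply Cinf_smooth3 in h.
  destruct (proj1 (near3_locally _ _ _ _) (hW _ h0)) as [d [hd H]].
  exists d; split; [exact hd|]; intros n.
  apply (Ck_sub n (fun a b c => W (a, b, c))); [|apply h].
  intros a b c [h1 [h2 h3]]; auto.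
- intros [d [hd h]].
  exists (fun q => let '(a, b, c) := q in box a0 b0 c0 d a b c); split; [|split].
  + intros [[a b] c] hw; apply near3_locally; exact (open3_box _ _ _ _ _ _ _ hw).
  + apply box_center; exact hd.
  + apply Cinf_smooth3; exact h.
Qed.

(** Functions of (t, x) enter the three-variable calculus as functions constant in the third
    slot. *)
Lemma Cinf_smooth2 (W : R * R -> Prop) f : smooth2_on W f ->
  Cinf (fun a b _ => W (a, b)) (fun a b _ => f a b).
Proof.
intros h n; revert f h; induction n as [|n IH]; intros f h.
- split; auto; intros a b c hw e he.
  pose proof (proj1 (h nil a b hw)) as hc; simpl in hc.
  destruct (proj1 (filterlim_locally _ _) hc (mkposreal e he)) as [d H].
  exists d; split; [apply cond_pos|]; intros x y z k1 k2 _.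
  apply (H (x, y)); split; assumption.
- assert (hc : forall a b c, W (a, b) -> cont3 (fun a b _ => f a b) a b c).
  { intros a b c hw e he.
    pose proof (proj1 (h nil a b hw)) as hc; simpl in hc.
    destruct (proj1 (filterlim_locally _ _) hc (mkposreal e he)) as [d H].
    exists d; split; [apply cond_pos|]; intros x y z k1 k2 _.
    apply (H (x, y)); split; assumption. }
  split; [exact hc|split].
  + intros a b c hw; destruct (h nil a b hw) as [_ [h1 h2]].
    split; [exact h1|split; [exact h2|exists 0; apply is_derive_Rconst]].
  + assert (hs : forall d, smooth2_on W (pd2 d f)).
    { intros d l a b hw.
      generalize (h (l ++ d :: nil)%list a b hw); rewrite fold_right_app; auto. }
    intros [| |].
    * exact (IH (dt f) (hs Dir_t)).
    * exact (IH (dx f) (hs Dir_x)).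
    (* The third partial derivative is the zero function, which is again a lifted smooth function,
       so the induction hypothesis applies to it. *)
    * assert (h0 : smooth2_on W (fun _ _ => 0)).
      { intros l a b _ g.
        assert (hg : g = fun _ _ => 0).
        { unfold g; clear g; induction l as [|d l IHl]; [reflexivity|].
          simpl; rewrite IHl; destruct d; unfold pd2, dt, dx; 
          apply functional_extensionality; intros t;
          apply functional_extensionality; intros x; apply Derive_const. }
        rewrite hg; split; [apply continuous_const|].
        split; apply ex_derive_const. }
      generalize (IH _ h0); simpl; unfold d3.
      replace (fun a b c : R => Derive (fun _ : R => f a b) c) with (fun _ _ _ : R => 0);
        [auto|].
      apply functional_extensionality; intros a; apply functional_extensionality; intros b;
      apply functional_extensionality; intros c; symmetry; apply Derive_const.
Qed.

Lemma smooth2_near_slice f a0 b0 c0 d : 0 < d -> Cinf (box a0 b0 c0 d) f ->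
  smooth2_near (fun a b => f a b c0) a0 b0.
Proof.
intros hd h.
exists (fun q => Rabs (fst q - a0) < d /\ Rabs (snd q - b0) < d); split; [|split].
- intros [a b] [h1 h2].
  assert (hb : box a0 b0 c0 d a b c0)
    by (repeat split; auto; rewrite Rminus_diag, Rabs_R0; exact hd).
  destruct (open3_box _ _ _ _ _ _ _ hb) as [e [he H]].
  exists (mkposreal e he); intros [x y] [k1 k2].
  destruct (H x y c0 k1 k2) as [l1 [l2 _]]; [rewrite Rminus_diag, Rabs_R0; exact he|].
  split; assumption.
- simpl; rewrite !Rminus_diag, Rabs_R0; auto.
- intros l a b [h1 h2]; simpl in h1, h2; cbv zeta.
  assert (hb : box a0 b0 c0 d a b c0)
    by (repeat split; auto; rewrite Rminus_diag, Rabs_R0; exact hd).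
  (* With the third variable frozen, only derivatives in the first two directions occur. *)
  set (emb := fun e => match e with Dir_t => Dir_1 | Dir_x => Dir_2 end).
  assert (heq : fold_right pd2 (fun a b => f a b c0) l
     = fun a b => fold_right pd3 f (map emb l) a b c0).
  { induction l as [|e l IH]; [reflexivity|]; simpl; rewrite IH; destruct e; reflexivity. }
  rewrite heq; clear heq.
  set (g := fold_right pd3 f (map emb l)).
  assert (hg : Cinf (box a0 b0 c0 d) g).
  { unfold g; clear g; induction (map emb l) as [|e l' IH];
    [exact h|apply Cinf_pd3; exact IH]. }
  split.
  + apply filterlim_locally; intros e.
    destruct (Ck_C0 0 _ g a b c0 (hg O) hb e (cond_pos e)) as [r [hr H]].
    exists (mkposreal r hr); intros [x y] [k1 k2].
    apply (H x y c0); auto; rewrite Rminus_diag, Rabs_R0; exact hr.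
  + destruct (proj1 (proj2 (hg 1%nat)) a b c0 hb) as [k1 [k2 _]]; split; assumption.
Qed.

Lemma cont3_slice12 f a b c : cont3 f a b c -> continuity_2d_pt (fun u v => f u v c) a b.
Proof.
intros h e; destruct (h e (cond_pos e)) as [d [hd H]].
exists (mkposreal d hd); intros u v hu hv; apply H; auto.
rewrite Rminus_diag, Rabs_R0; exact hd.
Qed.
Lemma cont3_slice13 f a b c : cont3 f a b c -> continuity_2d_pt (fun u v => f u b v) a c.
Proof.
intros h e; destruct (h e (cond_pos e)) as [d [hd H]].
exists (mkposreal d hd); intros u v hu hv; apply H; auto.
rewrite Rminus_diag, Rabs_R0; exact hd.
Qed.
Lemma cont3_slice23 f a b c : cont3 f a b c -> continuity_2d_pt (fun u v => f a u v) b c.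
Proof.
intros h e; destruct (h e (cond_pos e)) as [d [hd H]].
exists (mkposreal d hd); intros u v hu hv; apply H; auto.
rewrite Rminus_diag, Rabs_R0; exact hd.
Qed.

Lemma near3_slice12 a b c (P : R -> R -> R -> Prop) :
  near3 a b c P -> locally_2d (fun u v => P u v c) a b.
Proof.
intros [d [hd H]]; exists (mkposreal d hd); intros u v hu hv; apply H; auto.
rewrite Rminus_diag, Rabs_R0; exact hd.
Qed.
Lemma near3_slice13 a b c (P : R -> R -> R -> Prop) :
  near3 a b c P -> locally_2d (fun u v => P u b v) a c.
Proof.
intros [d [hd H]]; exists (mkposreal d hd); intros u v hu hv; apply H; auto.
rewrite Rminus_diag, Rabs_R0; exact hd.
Qed.
Lemma near3_slice23 a b c (P : R -> R -> R -> Prop) :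
  near3 a b c P -> locally_2d (fun u v => P a u v) b c.
Proof.
intros [d [hd H]]; exists (mkposreal d hd); intros u v hu hv; apply H; auto.
rewrite Rminus_diag, Rabs_R0; exact hd.
Qed.

(** Each identity is the two-variable Schwarz theorem on a coordinate plane through the point. *)
Lemma Cinf_schwarz W f a b c : open3 W -> Cinf W f -> W a b c ->
  d1 (d2 f) a b c = d2 (d1 f) a b c /\ d1 (d3 f) a b c = d3 (d1 f) a b c /\
  d2 (d3 f) a b c = d3 (d2 f) a b c.
Proof.
intros hW h hw.
assert (hn : near3 a b c (fun x y z => exd3 f x y z /\
   forall d, exd3 (pd3 d f) x y z)).
{ generalize (hW a b c hw); apply near3_imp; intros x y z hz; split.
  - exact (proj1 (proj2 (h 1%nat)) x y z hz).
  - intros d; exact (proj1 (proj2 (Cinf_pd3 W f d h 1%nat)) x y z hz). }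
assert (hc : forall d d', cont3 (pd3 d (pd3 d' f)) a b c).
{ intros d d'; apply (Ck_C0 0 W); [|exact hw].
  apply (Cinf_pd3 W _ d (Cinf_pd3 W f d' h)). }
split; [|split].
- apply (Schwarz (fun u v => f u v c)).
  + apply (near3_slice12 a b c (fun u v w => ex_derive (fun z => f z v w) u /\
      ex_derive (fun z => f u z w) v /\ ex_derive (fun z => d2 f z v w) u /\
      ex_derive (fun z => d1 f u z w) v)).
    revert hn; apply near3_imp; intros x y z [k0 k]; repeat split;
    [apply k0|apply k0|apply (k Dir_2)|apply (k Dir_1)].
  + exact (cont3_slice12 _ _ _ _ (hc Dir_1 Dir_2)).
  + exact (cont3_slice12 _ _ _ _ (hc Dir_2 Dir_1)).
- apply (Schwarz (fun u v => f u b v)).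
  + apply (near3_slice13 a b c (fun u w v => ex_derive (fun z => f z w v) u /\
      ex_derive (fun z => f u w z) v /\ ex_derive (fun z => d3 f z w v) u /\
      ex_derive (fun z => d1 f u w z) v)).
    revert hn; apply near3_imp; intros x y z [k0 k]; repeat split;
    [apply k0|apply k0|apply (k Dir_3)|apply (k Dir_1)].
  + exact (cont3_slice13 _ _ _ _ (hc Dir_1 Dir_3)).
  + exact (cont3_slice13 _ _ _ _ (hc Dir_3 Dir_1)).
- apply (Schwarz (fun u v => f a u v)).
  + apply (near3_slice23 a b c (fun w u v => ex_derive (fun z => f w z v) u /\
      ex_derive (fun z => f w u z) v /\ ex_derive (fun z => d3 f w z v) u /\
      ex_derive (fun z => d2 f w u z) v)).
    revert hn; apply near3_imp; intros x y z [k0 k]; repeat split;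
    [apply k0|apply k0|apply (k Dir_3)|apply (k Dir_2)].
  + exact (cont3_slice23 _ _ _ _ (hc Dir_2 Dir_3)).
  + exact (cont3_slice23 _ _ _ _ (hc Dir_3 Dir_2)).
Qed.

(** * Primitives depending on parameters *)

(** The segment with unordered ends: integrals and ODE solutions run to both sides of the base
    point. *)
Definition between (a b s : R) : Prop := Rmin a b <= s <= Rmax a b.

Lemma between_dist (a b s : R) : between a b s -> Rabs (s - a) <= Rabs (b - a).
Proof.
unfold between, Rmin, Rmax; destruct (Rle_dec a b); intros h; unfold Rabs;
repeat destruct Rcase_abs; lra.
Qed.

Lemma between_l (a b : R) : between a b a.
Proof. split; [apply Rmin_l|apply Rmax_l]. Qed.
Lemma between_r (a b : R) : between a b b.
Proof. split; [apply Rmin_r|apply Rmax_r]. Qed.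

Lemma between_trans (a b s r : R) : between a b s -> between a s r -> between a b r.
Proof.
unfold between, Rmin, Rmax; repeat destruct Rle_dec; lra.
Qed.

(** The tube lemma: compactness of the segment gives one radius for a property that holds near each
    of its points. *)
Lemma tube (a b x0 z0 : R) (P : R -> R -> R -> Prop) :
  (forall s, between a b s -> near3 x0 s z0 P) ->
  exists d, 0 < d /\ forall x s z,
    Rabs (x - x0) < d -> between a b s -> Rabs (z - z0) < d -> P x s z.
Proof.
intros h.
(* Compactness is applied to a radius function defined on the whole line; off the segment the radius
   1 is a dummy. *)
assert (h' : forall s, exists d : posreal, between a b s ->
  forall x y z, Rabs (x - x0) < d -> Rabs (y - s) < d -> Rabs (z - z0) < d -> P x y z).
{ intros s; destruct (classic (between a b s)) as [hs|hs].
  - destruct (h s hs) as [d [hd H]]; exists (mkposreal d hd); auto.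
  - exists (mkposreal 1 Rlt_0_1); tauto. }
set (delta := fun s => proj1_sig (constructive_indefinite_description _ (h' s))).
destruct (compactness_value_1d (Rmin a b) (Rmax a b) delta) as [d hd].
exists d; split; [apply cond_pos|]; intros x s z hx hs hz.
(* The compactness principle yields the covering point only under a double negation. *)
destruct (NNPP _ (hd s hs)) as [t [ht [hst hdt]]].
refine (proj2_sig (constructive_indefinite_description _ (h' t)) ht x s z _ _ _);
fold (delta t); lra.
Qed.

Lemma RInt_bound (f : R -> R) (a b M : R) : ex_RInt f a b ->
  (forall s, between a b s -> Rabs (f s) <= M) -> Rabs (RInt f a b) <= Rabs (b - a) * M.
Proof.
intros hex h; destruct (Rle_dec a b) as [hab|hab].
- rewrite (Rabs_pos_eq (b - a)) by lra; apply abs_RInt_le_const; auto.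
  intros t ht; apply h; unfold between; rewrite Rmin_left, Rmax_right; lra.
- rewrite <- (opp_RInt_swap f) by (apply ex_RInt_swap; exact hex).
  unfold opp; simpl; rewrite Rabs_Ropp, (Rabs_minus_sym b a), (Rabs_pos_eq (a - b)) by lra.
  apply abs_RInt_le_const; [lra|apply ex_RInt_swap; exact hex|].
  intros t ht; apply h; unfold between; rewrite Rmin_right, Rmax_left; lra.
Qed.

Lemma RInt_Rminus (f g : R -> R) (a b : R) : ex_RInt f a b -> ex_RInt g a b ->
  RInt (fun r => f r - g r) a b = RInt f a b - RInt g a b.
Proof. exact (RInt_minus f g a b). Qed.

(** Integration runs in the middle slot. The outer slots are parameters, for ODEs a genuine
    parameter and the initial value. *)
Definition primitive (s0 : R) (F : R -> R -> R -> R) (p s y : R) : R :=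
  RInt (fun r => F p r y) s0 s.

(** Keeps the whole path of integration, from [s0] to the upper end, inside the domain. *)
Definition fiberwise_star (s0 : R) (W : R -> R -> R -> Prop) : Prop :=
  forall p s y r, W p s y -> between s0 s r -> W p r y.

Lemma fiberwise_star_box (p0 s0 y0 d : R) : fiberwise_star s0 (box p0 s0 y0 d).
Proof.
intros p s y r [h1 [h2 h3]] hr; repeat split; auto.
apply between_dist in hr; lra.
Qed.

Section Primitive.
Variables (W : R -> R -> R -> Prop) (s0 : R).
Hypotheses (hW : open3 W) (hs : fiberwise_star s0 W).

Lemma ex_RInt_fiber F p s y : Ck 0 W F -> W p s y -> ex_RInt (fun r => F p r y) s0 s.
Proof.
intros hF hw; apply (ex_RInt_continuous (V := R_CompleteNormedModule)); intros r hr.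
apply (cont3_curve F (fun _ => p) (fun r => r) (fun _ => y)).
- apply (Ck_C0 0 W); auto; apply (hs p s); auto.
- apply continuous_const.
- apply continuous_id.
- apply continuous_const.
Qed.

(** The change of the integral splits into two parts: the integrand changes on the old interval,
    uniformly small by [tube], and the upper end moves, where a local bound of F suffices. *)
Lemma primitive_cont3 F p s y : Ck 0 W F -> W p s y -> cont3 (primitive s0 F) p s y.
Proof.
intros hF hw e he.
(* [M] bounds F near the old upper end, and [K] below exceeds the length of the old interval. Each
   of the two parts then gets at most half of [e]. *)
set (M := Rabs (F p s y) + 1).
assert (hM : 0 < M) by (unfold M; pose proof (Rabs_pos (F p s y)); lra).
set (K := Rabs (s - s0) + 1).
assert (hK : 0 < K) by (unfold K; pose proof (Rabs_pos (s - s0)); lra).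
set (e1 := e / (2 * K)).
assert (he1 : 0 < e1) by (apply Rdiv_lt_0_compat; lra).
destruct (proj1 (box_near _ _ _ _) (near3_and _ _ _ _ _ (hW p s y hw)
   (Ck_C0 0 W F p s y hF hw 1 Rlt_0_1))) as [r [hr Hr]].
destruct (tube s0 s p y (fun x t z => W x t z /\ Rabs (F x t z - F p t y) < e1))
  as [d [hd H]].
{ intros t ht; assert (hwt : W p t y) by (apply (hs p s); auto).
  apply near3_and; [apply hW; auto|].
  assert (hc : cont3 (fun x t z => F x t z + -1 * F p t y) p t y).
  { apply cont3_plus; [apply (Ck_C0 0 W); auto|].
    apply cont3_mult; [apply cont3_const|].
    apply (cont3_comp F (fun _ _ _ => p) (fun _ t _ => t) (fun _ _ _ => y)).
    - apply (Ck_C0 0 W); auto.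
    - apply cont3_const.
    - apply cont3_snd.
    - apply cont3_const. }
  generalize (hc e1 he1); apply near3_imp; intros x t' z hh.
  replace (F x t' z - F p t' y) with
    (F x t' z + -1 * F p t' y - (F p t y + -1 * F p t y)) by ring; exact hh. }
set (m := Rmin (Rmin d r) (e / (2 * M))).
assert (hm : 0 < m).
{ unfold m; repeat apply Rmin_pos; auto; apply Rdiv_lt_0_compat; lra. }
assert (m <= d /\ m <= r /\ m <= e / (2 * M)) as [m1 [m2 m3]].
{ unfold m; pose proof (Rmin_l (Rmin d r) (e / (2 * M)));
  pose proof (Rmin_r (Rmin d r) (e / (2 * M)));
  pose proof (Rmin_l d r); pose proof (Rmin_r d r); lra. }
exists m; split; [exact hm|]; intros x s' z hx hs' hz.
assert (hwx : W x s z) by (apply (H x s z); try lra; apply between_r).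
assert (hseg : forall t, between s s' t -> W x t z /\ Rabs (F x t z - F p s y) < 1).
{ intros t ht; apply between_dist in ht; apply Hr; repeat split; lra. }
assert (ex1 : ex_RInt (fun r => F x r z) s0 s) by (apply ex_RInt_fiber; auto).
assert (ex2 : ex_RInt (fun r => F p r y) s0 s) by (apply ex_RInt_fiber; auto).
assert (ex3 : ex_RInt (fun r => F x r z) s s').
{ apply (ex_RInt_continuous (V := R_CompleteNormedModule)); intros t ht.
  apply (cont3_curve F (fun _ => x) (fun r => r) (fun _ => z)).
  - apply (Ck_C0 0 W); auto; apply hseg; exact ht.
  - apply continuous_const.
  - apply continuous_id.
  - apply continuous_const. }
unfold primitive; rewrite <- (RInt_Chasles _ s0 s s' ex1 ex3).
change plus with Rplus.
assert (heq : RInt (fun r => F x r z) s0 s - RInt (fun r => F p r y) s0 s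
   = RInt (fun r => F x r z - F p r y) s0 s)
 by (symmetry; apply (RInt_minus (fun r => F x r z) (fun r => F p r y)); auto).
replace (RInt (fun r => F x r z) s0 s + RInt (fun r => F x r z) s s'
  - RInt (fun r => F p r y) s0 s) with
 (RInt (fun r => F x r z - F p r y) s0 s + RInt (fun r => F x r z) s s')
 by (rewrite <- heq; ring).
eapply Rle_lt_trans; [apply Rabs_triang|].
assert (b1 : Rabs (RInt (fun r => F x r z - F p r y) s0 s) <= Rabs (s - s0) * e1).
{ apply RInt_bound.
  - apply (ex_RInt_minus (fun r => F x r z) (fun r => F p r y)); auto.
  - intros t ht; destruct (H x t z) as [_ hh]; auto; lra. }
assert (b2 : Rabs (RInt (fun r => F x r z) s s') <= Rabs (s' - s) * M).
{ apply RInt_bound; auto.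
  intros t ht; destruct (hseg t ht) as [_ hh].
  replace (F x t z) with ((F x t z - F p s y) + F p s y) by ring.
  eapply Rle_trans; [apply Rabs_triang|unfold M; lra]. }
assert (c1 : Rabs (s - s0) * e1 < e / 2).
{ apply Rlt_le_trans with (K * e1); [apply Rmult_lt_compat_r; unfold K; lra|].
  unfold e1; right; field; lra. }
assert (c2 : Rabs (s' - s) * M <= e / 2).
{ apply Rle_trans with (e / (2 * M) * M); [apply Rmult_le_compat_r; lra|].
  right; field; lra. }
lra.
Qed.

Lemma primitive_derive F p s y : Ck 0 W F -> W p s y ->
  is_derive (fun r => primitive s0 F p r y) s (F p s y).
Proof.
intros hF hw; apply (is_derive_RInt (V := R_NormedModule) (fun r => F p r y) _ s0 s).
- generalize (near3_slice2 _ _ _ _ (hW p s y hw)); apply filter_imp; intros r hr.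
  apply (RInt_correct (V := R_CompleteNormedModule) (fun r => F p r y)).
  apply ex_RInt_fiber; auto.
- apply (cont3_curve F (fun _ => p) (fun r => r) (fun _ => y)).
  + apply (Ck_C0 0 W); auto.
  + apply continuous_const.
  + apply continuous_id.
  + apply continuous_const.
Qed.

Lemma primitive_center F p y : primitive s0 F p s0 y = 0.
Proof. apply (RInt_point s0 (fun r => F p r y)). Qed.

Lemma primitive_derive1 F p s y : Ck 1 W F -> W p s y ->
  is_derive (fun r => primitive s0 F r s y) p (primitive s0 (d1 F) p s y).
Proof.
intros hF hw.
destruct (tube s0 s p y W) as [d [hd H]]; [intros t ht; apply hW; apply (hs p s); auto|].
assert (hz : Rabs (y - y) < d) by (rewrite Rminus_diag, Rabs_R0; exact hd).
apply (is_derive_RInt_param (fun u t => F u t y) s0 s p).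
- exists (mkposreal d hd); intros x hx t ht.
  exact (proj1 (proj1 (proj2 hF) x t y (H x t y hx ht hz))).
- intros t ht.
  apply (cont3_slice12 (d1 F)); apply (Ck_C0 0 W); [apply (proj2 (proj2 hF) Dir_1)|].
  apply (hs p s); auto.
- exists (mkposreal d hd); intros x hx.
  apply ex_RInt_fiber; [apply Ck_S; exact hF|]; apply H; auto; apply between_r.
Qed.

Lemma primitive_derive3 F p s y : Ck 1 W F -> W p s y ->
  is_derive (fun r => primitive s0 F p s r) y (primitive s0 (d3 F) p s y).
Proof.
intros hF hw.
destruct (tube s0 s p y W) as [d [hd H]]; [intros t ht; apply hW; apply (hs p s); auto|].
assert (hz : Rabs (p - p) < d) by (rewrite Rminus_diag, Rabs_R0; exact hd).
apply (is_derive_RInt_param (fun u t => F p t u) s0 s y).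
- exists (mkposreal d hd); intros x hx t ht.
  exact (proj2 (proj2 (proj1 (proj2 hF) p t x (H p t x hz ht hx)))).
- intros t ht.
  assert (hc : cont3 (d3 F) p t y).
  { apply (Ck_C0 0 W); [apply (proj2 (proj2 hF) Dir_3)|]; apply (hs p s); auto. }
  (* Differentiation under the integral expects the parameter before the integration variable, so
     the two coordinates are swapped. *)
  intros e; destruct (cont3_slice23 _ _ _ _ hc e) as [r Hr].
  exists r; intros u v hu hv; apply (Hr v u); assumption.
- exists (mkposreal d hd); intros x hx.
  apply ex_RInt_fiber; [apply Ck_S; exact hF|]; apply H; auto; apply between_r.
Qed.

Lemma Ck_primitive n F : Ck n W F -> Ck n W (primitive s0 F).
Proof.
revert F; induction n as [|n IH]; intros F hF.
- split; auto; intros; apply primitive_cont3; auto.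
- apply (Ck_intro n W _ (fun d => match d with
    | Dir_1 => primitive s0 (d1 F) | Dir_2 => F | Dir_3 => primitive s0 (d3 F) end)).
  + exact hW.
  + assert (h1 : Ck 1 W F).
    { split; [|split]; [apply hF|apply hF|].
      intros d; split; auto; intros a b c; apply (Ck_C0 n W); apply hF. }
    assert (h0 : Ck 0 W F) by (apply Ck_S; exact h1).
    intros a b c hw; split; [|split].
    * apply primitive_derive1; auto.
    * apply primitive_derive; auto.
    * apply primitive_derive3; auto.
  + intros [| |]; [apply IH; apply (proj2 (proj2 hF) Dir_1)|apply Ck_S; exact hF|
                   apply IH; apply (proj2 (proj2 hF) Dir_3)].
Qed.

End Primitive.

(* Gronwall's inequality on an interval so short that the maximum of [N] can be
   absorbed: no exponential is needed. *)
Lemma gronwall_short (N N' : R -> R) (s0 s al be : R) :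
  (forall r, between s0 s r -> is_derive N r (N' r)) -> N s0 = 0 ->
  0 <= al -> 0 <= be -> be * Rabs (s - s0) <= / 2 ->
  (forall r, between s0 s r -> Rabs (N' r) <= al + be * Rabs (N r)) ->
  Rabs (N s) <= 2 * al * Rabs (s - s0).
Proof.
intros hd h0 hal hbe hs hN.
destruct (continuity_ab_maj (fun r => Rabs (N r)) (Rmin s0 s) (Rmax s0 s)) as [m [Hm hm]].
- apply Rle_trans with s0; [apply Rmin_l|apply Rmax_l].
- intros c hc; apply continuity_pt_filterlim; apply (continuous_comp N Rabs).
  + apply (ex_derive_continuous N); eexists; apply hd; exact hc.
  + apply continuous_Rabs.
(* At the point [m] where |N| is maximal the mean value theorem gives |N m| <= (al + be |N m|) |s -
   s0|, and be |s - s0| <= 1/2 absorbs half of the left side. *)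
- destruct (mvt_segment N N' s0 m) as [c [hc e]].
  { intros v hv; apply hd; exact (between_trans _ _ _ _ hm hv). }
  assert (hcs : between s0 s c) by exact (between_trans _ _ _ _ hm hc).
  rewrite h0, Rminus_0_r in e.
  pose proof (hN c hcs) as h1; pose proof (Hm c hcs) as h2; simpl in h2.
  pose proof (Hm s (between_r _ _)) as h3; simpl in h3.
  pose proof (between_dist _ _ _ hm) as h4.
  pose proof (Rabs_pos (N m)); pose proof (Rabs_pos (m - s0)).
  assert (h5 : Rabs (N m) <= (al + be * Rabs (N m)) * Rabs (s - s0)).
  { rewrite e at 1; rewrite Rabs_mult; apply Rmult_le_compat; try apply Rabs_pos; auto.
    eapply Rle_trans; [exact h1|]; apply Rplus_le_compat_l;
    apply Rmult_le_compat_l; auto. }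
  assert (h6 : be * Rabs (s - s0) * Rabs (N m) <= / 2 * Rabs (N m))
    by (apply Rmult_le_compat_r; auto).
  lra.
Qed.

(** Differentiability of an ODE solution in its data. The remainder N = Y x - Y q - h V, with h = x
    - q and V a solution of the variational equation, has |N'| <= e1 (1 + Vm) |h| + (L + 1) |N|, so
    Gronwall makes it o(h). The slope [v0] of the initial values covers both uses: 0 for a
    parameter, 1 for the initial value itself. *)
Lemma param_derive (F : R -> R -> R -> R) (Y : R -> R -> R) (V : R -> R)
  (q s0 s v0 L d0 : R) : 0 < d0 ->
  (forall x, Rabs (x - q) < d0 -> Y x s0 = Y q s0 + v0 * (x - q)) ->
  (forall x r, Rabs (x - q) < d0 -> between s0 s r -> is_derive (Y x) r (F x r (Y x r))) ->
  (forall r, between s0 s r -> C1at F q r (Y q r)) ->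
  (forall r, between s0 s r -> cont3 (fun x t _ => Y x t) q r 0) ->
  (forall r, between s0 s r ->
     is_derive V r (d3 F q r (Y q r) * V r + d1 F q r (Y q r))) -> V s0 = v0 ->
  0 <= L -> (forall r, between s0 s r -> Rabs (d3 F q r (Y q r)) <= L) ->
  (L + 1) * Rabs (s - s0) <= / 2 ->
  is_derive (fun x => Y x s) q (V s).
Proof.
intros hd0 hini hY hF hc hV hV0 hL hb hs.
destruct (continuity_ab_maj (fun r => Rabs (V r)) (Rmin s0 s) (Rmax s0 s)) as [m [Hm hm]].
{ apply Rle_trans with s0; [apply Rmin_l|apply Rmax_l]. }
{ intros r hr; apply continuity_pt_filterlim; apply (continuous_comp V Rabs).
  - apply (ex_derive_continuous V); eexists; apply hV; exact hr.
  - apply continuous_Rabs. }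
set (Vm := Rabs (V m)) in *.
assert (hVm : 0 <= Vm) by apply Rabs_pos.
apply is_derive_eps; intros e he.
(* [Vm] is the maximum of |V|. The second bound makes e1 (1 + Vm) at most [e]; the first lets the
   variation of [d3 F] raise the Gronwall constant only from L to L + 1. *)
set (e1 := Rmin 1 (e / (1 + Vm))).
assert (he1 : 0 < e1) by (apply Rmin_pos; [lra|apply Rdiv_lt_0_compat; lra]).
assert (e1 <= 1) by apply Rmin_l.
assert (he1' : e1 * (1 + Vm) <= e).
{ apply Rle_trans with (e / (1 + Vm) * (1 + Vm)); [|right; field; lra].
  apply Rmult_le_compat_r; [lra|apply Rmin_r]. }
assert (hYc : forall r, between s0 s r -> cont3 (fun _ t z => Y q t + z) 0 r 0).
{ intros r hr; apply cont3_plus; [|apply cont3_trd].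
  apply (cont3_comp (fun x t _ => Y x t) (fun _ _ _ => q) (fun _ t _ => t) (fun _ _ _ => 0)).
  - apply hc; auto.
  - apply cont3_const.
  - apply cont3_snd.
  - apply cont3_const. }
assert (hYc0 : forall r, between s0 s r -> cont3 (fun _ t _ => Y q t) 0 r 0).
{ intros r hr.
  apply (cont3_comp (fun x t _ => Y x t) (fun _ _ _ => q) (fun _ t _ => t) (fun _ _ _ => 0)).
  - apply hc; auto.
  - apply cont3_const.
  - apply cont3_snd.
  - apply cont3_const. }
assert (hq : forall r, cont3 (fun h _ _ => q + h) 0 r 0).
{ intros r; apply cont3_plus; [apply cont3_const|apply cont3_fst]. }
assert (near_d : forall (G : R -> R -> R -> R) r, between s0 s r -> cont3 G q r (Y q r) ->
  near3 0 r 0 (fun h t z => Rabs (G (q + h) t (Y q t + z) - G q t (Y q t)) < e1)).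
{ intros G r hr hG.
  assert (hh : cont3 (fun h t z => G (q + h) t (Y q t + z) + -1 * G q t (Y q t)) 0 r 0).
  { apply cont3_plus.
    - apply (cont3_comp G (fun h _ _ => q + h) (fun _ t _ => t) (fun _ t z => Y q t + z)); auto.
      + rewrite !Rplus_0_r; exact hG.
      + apply cont3_snd.
    - apply cont3_mult; [apply cont3_const|].
      apply (cont3_comp G (fun _ _ _ => q) (fun _ t _ => t) (fun _ t _ => Y q t)); auto.
      + apply cont3_const.
      + apply cont3_snd. }
  generalize (hh e1 he1); apply near3_imp; intros x t z k.
  rewrite !Rplus_0_r in k.
  replace (G (q + x) t (Y q t + z) - G q t (Y q t)) with
   (G (q + x) t (Y q t + z) + -1 * G q t (Y q t) - (G q r (Y q r) + -1 * G q r (Y q r)))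
   by ring; exact k. }
(* Coordinates relative to the reference solution: [h] is the change of the parameter and [z] the
   deviation from [Y q t]. One radius then serves along the whole orbit. *)
destruct (tube s0 s 0 0 (fun h t z => exd3 F (q + h) t (Y q t + z) /\
   Rabs (d1 F (q + h) t (Y q t + z) - d1 F q t (Y q t)) < e1 /\
   Rabs (d3 F (q + h) t (Y q t + z) - d3 F q t (Y q t)) < e1)) as [r1 [hr1 H1]].
{ intros r hr; destruct (hF r hr) as [k0 [k1 [_ k3]]].
  apply near3_and; [|apply near3_and; apply near_d; auto].
  apply (near3_comp (exd3 F) (fun h _ _ => q + h) (fun _ t _ => t) (fun _ t z => Y q t + z));
    auto.
  - apply cont3_snd.
  - rewrite !Rplus_0_r; exact k0. }
(* Joint continuity keeps the neighbouring solutions within [r1] of the reference solution along the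
   whole segment. *)
destruct (tube s0 s q 0 (fun x t _ => Rabs (Y x t - Y q t) < r1)) as [r2 [hr2 H2]].
{ intros r hr.
  assert (hh : cont3 (fun x t _ => Y x t + -1 * Y q t) q r 0).
  { apply cont3_plus; [apply hc; auto|]; apply cont3_mult; [apply cont3_const|].
    apply (cont3_comp (fun x t _ => Y x t) (fun _ _ _ => q) (fun _ t _ => t) (fun _ _ _ => 0)).
    - apply hc; auto.
    - apply cont3_const.
    - apply cont3_snd.
    - apply cont3_const. }
  generalize (hh r1 hr1); apply near3_imp; intros x t z k.
  replace (Y x t - Y q t) with (Y x t + -1 * Y q t - (Y q r + -1 * Y q r)) by ring; exact k. }
set (d := Rmin d0 (Rmin r1 r2)).
assert (hd : 0 < d) by (repeat apply Rmin_pos; auto).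
assert (d <= d0 /\ d <= r1 /\ d <= r2) as [l0 [l1 l2]].
{ unfold d; pose proof (Rmin_l d0 (Rmin r1 r2)); pose proof (Rmin_r d0 (Rmin r1 r2));
  pose proof (Rmin_l r1 r2); pose proof (Rmin_r r1 r2); lra. }
exists (mkposreal d hd); intros x hx.
change (Rabs (x - q) < d) in hx.
set (h := x - q) in *.
assert (hz : forall r, 0 < r -> Rabs (0 - 0) < r)
  by (intros; rewrite Rminus_diag, Rabs_R0; assumption).
replace (Y x s - Y q s - V s * h) with ((fun r => Y x r - Y q r - h * V r) s)
  by (simpl; ring).
apply Rle_trans with (2 * (e1 * (1 + Vm) * Rabs h) * Rabs (s - s0)).
- apply (gronwall_short (fun r => Y x r - Y q r - h * V r)
    (fun r => F x r (Y x r) - F q r (Y q r)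
              - h * (d3 F q r (Y q r) * V r + d1 F q r (Y q r))) s0 s _ (L + 1)).
  + intros r hr.
    apply (is_derive_minus (fun r => Y x r - Y q r) (fun r => h * V r)).
    * apply (is_derive_minus (Y x) (Y q)); apply hY; auto; fold h; try lra.
      rewrite Rminus_diag, Rabs_R0; exact hd0.
    * exact (is_derive_scal V r h _ (hV r hr)).
  + rewrite (hini x), hV0 by (fold h; lra); fold h; ring.
  + apply Rmult_le_pos; [apply Rmult_le_pos; lra|apply Rabs_pos].
  + lra.
  + exact hs.
  + intros r hr.
    assert (hD : Rabs (Y x r - Y q r) < r1) by (apply (H2 x r 0); auto; fold h; lra).
    set (u := Y q r) in *; set (D := Y x r - u) in *.
    destruct (mvt_segment (fun v => F v r (Y x r)) (fun v => d1 F v r (Y x r)) q x)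
      as [v1 [k1 eq1]].
    { intros v hv; apply Derive_correct.
      assert (hv' : Rabs (v - q) < r1)
        by (apply (between_dist q x) in hv; fold h in hv; lra).
      destruct (H1 (v - q) r D) as [[kk _] _]; auto; try (rewrite Rminus_0_r; lra).
      fold u in kk; replace (q + (v - q)) with v in kk by ring.
      replace (u + D) with (Y x r) in kk by (unfold D; ring); exact kk. }
    destruct (mvt_segment (fun v => F q r v) (fun v => d3 F q r v) u (Y x r))
      as [v2 [k2 eq2]].
    { intros v hv; apply Derive_correct.
      assert (hv' : Rabs (v - u) < r1)
        by (apply (between_dist u (Y x r)) in hv; fold D in hv; lra).
      destruct (H1 0 r (v - u)) as [[_ [_ kk]] _]; auto; try (rewrite Rminus_0_r; lra).
      fold u in kk; rewrite Rplus_0_r in kk; replace (u + (v - u)) with v in kk by ring.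
      exact kk. }
    assert (b1 : Rabs (d1 F v1 r (Y x r) - d1 F q r u) < e1).
    { assert (hv' : Rabs (v1 - q) < r1)
        by (apply (between_dist q x) in k1; fold h in k1; lra).
      destruct (H1 (v1 - q) r D) as [_ [kk _]]; auto; try (rewrite Rminus_0_r; lra).
      fold u in kk; replace (q + (v1 - q)) with v1 in kk by ring.
      replace (u + D) with (Y x r) in kk by (unfold D; ring); exact kk. }
    assert (b2 : Rabs (d3 F q r v2 - d3 F q r u) < e1).
    { assert (hv' : Rabs (v2 - u) < r1)
        by (apply (between_dist u (Y x r)) in k2; fold D in k2; lra).
      destruct (H1 0 r (v2 - u)) as [_ [_ kk]]; auto; try (rewrite Rminus_0_r; lra).
      fold u in kk; rewrite Rplus_0_r in kk; replace (u + (v2 - u)) with v2 in kk by ring.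
      exact kk. }
    fold D in eq2; fold h in eq1.
    (* The increment of F is split into a change of the parameter and a change of the value.
       Replacing both slopes by those on the reference orbit leaves the terms with [e1] and the
       linear term [d3 F * N]. *)
    set (N := D - h * V r).
    replace (F x r (Y x r) - F q r u - h * (d3 F q r u * V r + d1 F q r u)) with
     ((d1 F v1 r (Y x r) - d1 F q r u) * h + (d3 F q r v2 - d3 F q r u) * (N + h * V r)
      + d3 F q r u * N).
    2:{ replace (F x r (Y x r) - F q r u) with
         ((F x r (Y x r) - F q r (Y x r)) + (F q r (Y x r) - F q r u)) by ring.
        rewrite eq1, eq2; unfold N; ring. }
    pose proof (hb r hr) as b3; fold u in b3.
    assert (b4 : Rabs (N + h * V r) <= Rabs N + Rabs h * Vm).
    { eapply Rle_trans; [apply Rabs_triang|]; apply Rplus_le_compat_l.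
      rewrite Rabs_mult; apply Rmult_le_compat_l; [apply Rabs_pos|apply Hm; exact hr]. }
    pose proof (Rabs_pos h); pose proof (Rabs_pos N).
    eapply Rle_trans; [apply Rabs_triang|].
    apply Rle_trans with ((e1 * Rabs h + e1 * (Rabs N + Rabs h * Vm)) + L * Rabs N).
    * apply Rplus_le_compat.
      -- eapply Rle_trans; [apply Rabs_triang|]; apply Rplus_le_compat; rewrite Rabs_mult.
         ++ apply Rmult_le_compat_r; lra.
         ++ apply Rmult_le_compat; try apply Rabs_pos; lra.
      -- rewrite Rabs_mult; apply Rmult_le_compat_r; lra.
    * assert (e1 * Rabs N <= 1 * Rabs N) by (apply Rmult_le_compat_r; lra). lra.
- pose proof (Rabs_pos h); pose proof (Rabs_pos (s - s0)).
  (* As L + 1 >= 1, the segment has length at most 1/2, which cancels the factor 2 of Gronwall. *)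
  assert (hs' : Rabs (s - s0) <= / 2).
  { apply Rle_trans with ((L + 1) * Rabs (s - s0)); [|exact hs].
    rewrite <- (Rmult_1_l (Rabs (s - s0))) at 1; apply Rmult_le_compat_r; lra. }
  assert (k : e1 * (1 + Vm) * Rabs h <= e * Rabs h) by (apply Rmult_le_compat_r; lra).
  assert (0 <= e1 * (1 + Vm) * Rabs h) by (apply Rmult_le_pos; [apply Rmult_le_pos|]; lra).
  assert (e1 * (1 + Vm) * Rabs h * Rabs (s - s0) <= e1 * (1 + Vm) * Rabs h * / 2)
    by (apply Rmult_le_compat_l; lra).
  lra.
Qed.

(** * Ordinary differential equations *)

Lemma half_pow_small (q e : R) : 0 < e -> exists n, q * (/ 2) ^ n < e.
Proof.
intros he; set (q' := Rmax q 1).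
assert (hq : 0 < q') by (apply Rlt_le_trans with 1; [lra|apply Rmax_r]).
destruct (pow_lt_1_zero (/ 2)) with (y := e / q') as [n Hn].
- rewrite Rabs_pos_eq; lra.
- apply Rdiv_lt_0_compat; lra.
- exists n; specialize (Hn n (Nat.le_refl n)).
  assert (hp : 0 < (/ 2) ^ n) by (apply pow_lt; lra).
  rewrite Rabs_pos_eq in Hn by lra.
  apply Rle_lt_trans with (q' * (/ 2) ^ n).
  + apply Rmult_le_compat_r; [lra|apply Rmax_l].
  + apply Rlt_le_trans with (q' * (e / q')); [apply Rmult_lt_compat_l; auto|].
    right; field; lra.
Qed.

Fixpoint picard_iter (F : R -> R -> R -> R) (s0 : R) (n : nat) : R -> R -> R -> R :=
  match n with
  | O => fun _ _ y => y
  | S m => fun p s y => y + primitive s0 (fun p s y => F p s (picard_iter F s0 m p s y)) p s y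
  end.

(** The bounds on F are global, so the iterates never have to be confined to a ball; [ode_cont]
    reduces to this case by truncation. L dl <= 1/2 makes successive differences decay like 2^(-n),
    uniformly, so the limit is continuous. *)
Lemma picard (F : R -> R -> R -> R) (s0 M L dl : R) :
  (forall p s y, cont3 F p s y) -> (forall p s y, Rabs (F p s y) <= M) ->
  (forall p s y z, Rabs (F p s y - F p s z) <= L * Rabs (y - z)) ->
  0 <= L -> 0 < dl -> L * dl <= / 2 ->
  exists Y, (forall p s y, Rabs (s - s0) < dl -> cont3 Y p s y) /\
    (forall p s y, Rabs (s - s0) < dl ->
       Y p s y = y + primitive s0 (fun p s y => F p s (Y p s y)) p s y).
Proof.
intros hc hM hL hL0 hdl hLd.
set (T := fun _ _ _ : R => True).
assert (hT : open3 T) by (intros a b c _; apply near3_true; intros; exact I).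
assert (hTs : fiberwise_star s0 T) by (intros p s y r _ _; exact I).
set (it := picard_iter F s0).
assert (hit : forall n, Ck 0 T (it n)).
{ induction n as [|n IH]; split; auto; intros p s y _.
  - apply cont3_trd.
  - apply cont3_plus; [apply cont3_trd|].
    apply (primitive_cont3 T); auto.
    + split; auto; intros a b c _.
      apply (cont3_comp F (fun a _ _ => a) (fun _ b _ => b) (it n)); auto.
      * apply cont3_fst.
      * apply cont3_snd.
      * apply (Ck_C0 0 T); [exact IH|exact I].
    + exact I. }
assert (hFit : forall n, Ck 0 T (fun p s y => F p s (it n p s y))).
{ intros n; split; auto; intros a b c _.
  apply (cont3_comp F (fun a _ _ => a) (fun _ b _ => b) (it n)); auto.
  * apply cont3_fst.
  * apply cont3_snd.
  * apply (Ck_C0 0 T); [apply hit|exact I]. }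
assert (hMpos : 0 <= M).
{ eapply Rle_trans; [apply Rabs_pos|apply (hM 0 0 0)]. }
assert (hstep : forall n p s y, Rabs (s - s0) <= dl ->
   Rabs (it (S n) p s y - it n p s y) <= M * dl * (/ 2) ^ n).
{ induction n as [|n IH]; intros p s y hs.
  - assert (heq : it 1%nat p s y - it 0%nat p s y
      = RInt (fun r => F p r (it 0%nat p r y)) s0 s)
      by (unfold it; simpl; unfold primitive; ring).
    rewrite heq; simpl; eapply Rle_trans; [apply RInt_bound with (M := M)|].
    + apply (ex_RInt_fiber T s0 hTs _ p s y (hFit O) I).
    + intros; apply hM.
    + rewrite Rmult_1_r, Rmult_comm; apply Rmult_le_compat_l; auto.
  - assert (heq : it (S (S n)) p s y - it (S n) p s y
      = RInt (fun r => F p r (it (S n) p r y) - F p r (it n p r y)) s0 s).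
    { change (it (S (S n)) p s y) with (y + RInt (fun r => F p r (it (S n) p r y)) s0 s).
      change (it (S n) p s y) with (y + RInt (fun r => F p r (it n p r y)) s0 s).
      rewrite (RInt_Rminus (fun r => F p r (it (S n) p r y)) (fun r => F p r (it n p r y))).
      - ring.
      - apply (ex_RInt_fiber T s0 hTs _ p s y (hFit (S n)) I).
      - apply (ex_RInt_fiber T s0 hTs _ p s y (hFit n) I). }
    rewrite heq; eapply Rle_trans;
      [apply RInt_bound with (M := L * (M * dl * (/ 2) ^ n))|].
    + apply (ex_RInt_minus (fun r => F p r (it (S n) p r y)) (fun r => F p r (it n p r y))).
      * apply (ex_RInt_fiber T s0 hTs _ p s y (hFit (S n)) I).
      * apply (ex_RInt_fiber T s0 hTs _ p s y (hFit n) I).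
    + intros r hr; eapply Rle_trans; [apply hL|]; apply Rmult_le_compat_l; auto.
      apply IH; apply between_dist in hr; lra.
    + assert (hp : 0 <= M * dl * (/ 2) ^ n).
      { apply Rmult_le_pos; [apply Rmult_le_pos; lra|left; apply pow_lt; lra]. }
      apply Rle_trans with (dl * (L * (M * dl * (/ 2) ^ n))).
      * apply Rmult_le_compat_r; auto; apply Rmult_le_pos; auto.
      * replace (dl * (L * (M * dl * (/ 2) ^ n))) with ((L * dl) * (M * dl * (/ 2) ^ n)) by ring.
        replace (M * dl * (/ 2) ^ S n) with (/ 2 * (M * dl * (/ 2) ^ n)) by (simpl; ring).
        apply Rmult_le_compat_r; auto. }
(* The sum of the geometric series of the step bounds M dl 2^(-n). *)
set (q := 2 * M * dl).
assert (hq : forall n, 0 <= q * (/ 2) ^ n).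
{ intros n; apply Rmult_le_pos; [unfold q; apply Rmult_le_pos; lra|left; apply pow_lt; lra]. }
(* Keeping the subtracted term makes the bound telescope, so the induction on k closes exactly. *)
assert (hcauchy : forall n k p s y, Rabs (s - s0) <= dl ->
   Rabs (it (n + k)%nat p s y - it n p s y) <= q * (/ 2) ^ n - q * (/ 2) ^ (n + k)).
{ intros n k p s y hs; induction k as [|k IH].
  - rewrite Nat.add_0_r, !Rminus_diag, Rabs_R0; lra.
  - rewrite Nat.add_succ_r.
    replace (it (S (n + k)) p s y - it n p s y) with
      ((it (S (n + k)) p s y - it (n + k)%nat p s y) + (it (n + k)%nat p s y - it n p s y))
      by ring.
    eapply Rle_trans; [apply Rabs_triang|].
    pose proof (hstep (n + k)%nat p s y hs).
    replace ((/ 2) ^ S (n + k)) with (/ 2 * (/ 2) ^ (n + k)) by (simpl; ring).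
    unfold q in *; lra. }
set (Y := fun p s y => real (Lim_seq (fun n => it n p s y))).
assert (hlim : forall p s y, Rabs (s - s0) <= dl -> is_lim_seq (fun n => it n p s y) (Y p s y)).
{ intros p s y hs; apply Lim_seq_correct'; apply ex_lim_seq_cauchy_corr; intros e.
  destruct (half_pow_small (2 * q) e (cond_pos e)) as [N HN].
  exists N; intros n m hn hm.
  assert (hb : forall n, (N <= n)%nat -> Rabs (it n p s y - it N p s y) <= q * (/ 2) ^ N).
  { intros n' hn'; replace n' with (N + (n' - N))%nat by lia.
    eapply Rle_trans; [apply hcauchy; exact hs|]; pose proof (hq (N + (n' - N))%nat); lra. }
  replace (it n p s y - it m p s y) with
    ((it n p s y - it N p s y) - (it m p s y - it N p s y)) by ring.
  unfold Rminus at 1; eapply Rle_lt_trans; [apply Rabs_triang|].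
  rewrite Rabs_Ropp; pose proof (hb n hn); pose proof (hb m hm); lra. }
assert (hY : forall n p s y, Rabs (s - s0) <= dl ->
   Rabs (Y p s y - it n p s y) <= q * (/ 2) ^ n).
{ intros n p s y hs.
  assert (h1 : is_lim_seq (fun k => Rabs (it (k + n)%nat p s y - it n p s y))
     (Rabs (Y p s y - it n p s y))).
  { apply (is_lim_seq_abs _ (Y p s y - it n p s y)).
    apply (is_lim_seq_minus' _ _ (Y p s y) (it n p s y)); [|apply is_lim_seq_const].
    apply (is_lim_seq_incr_n (fun k => it k p s y) n); apply hlim; exact hs. }
  refine (is_lim_seq_le _ _ (Finite _) (Finite _) _ h1 (is_lim_seq_const (q * (/ 2) ^ n))).
  intros k; rewrite Nat.add_comm; eapply Rle_trans; [apply hcauchy; exact hs|].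
  pose proof (hq (n + k)%nat); lra. }
exists Y.
assert (hYc : forall p s y, Rabs (s - s0) < dl -> cont3 Y p s y).
{ intros p s y hs e he.
  destruct (half_pow_small q (e / 3)) as [n hn]; [lra|].
  assert (hns : near3 p s y (fun _ t _ => Rabs (t - s0) <= dl)).
  { exists (dl - Rabs (s - s0)); split; [lra|]; intros x t z _ ht _.
    replace (t - s0) with ((t - s) + (s - s0)) by ring.
    eapply Rle_trans; [apply Rabs_triang|lra]. }
  assert (he3 : 0 < e / 3) by lra.
  generalize (near3_and _ _ _ _ _ hns (Ck_C0 0 T _ p s y (hit n) I _ he3)).
  apply near3_imp; intros x t z [h1 h2].
  replace (Y x t z - Y p s y) with ((Y x t z - it n x t z)
    + ((it n x t z - it n p s y) - (Y p s y - it n p s y))) by ring.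
  eapply Rle_lt_trans; [apply Rabs_triang|].
  pose proof (hY n x t z h1) as k1.
  assert (k2 := hY n p s y (Rlt_le _ _ hs)).
  assert (Rabs (it n x t z - it n p s y - (Y p s y - it n p s y)) < e / 3 + e / 3).
  { unfold Rminus at 1; eapply Rle_lt_trans; [apply Rabs_triang|].
    rewrite Rabs_Ropp; lra. }
  lra. }
split; [exact hYc|].
set (W := fun _ s _ : R => Rabs (s - s0) < dl).
assert (hWs : fiberwise_star s0 W).
{ intros p s y r hw hr; apply between_dist in hr; unfold W in *; lra. }
assert (hFY : Ck 0 W (fun p s y => F p s (Y p s y))).
{ split; auto; intros a b c hw.
  apply (cont3_comp F (fun a _ _ => a) (fun _ b _ => b) Y); auto.
  - apply cont3_fst.
  - apply cont3_snd. }
intros p s y hs; apply Rminus_diag_uniq.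
(* The integral equation holds because its defect is below 2 q 2^(-n) for every n: pass through the
   iterate n + 1, which is close to Y and whose defining integrand is close to that of Y. *)
apply NNPP; intros hne.
destruct (half_pow_small (2 * q) (Rabs (Y p s y -
   (y + primitive s0 (fun p s y => F p s (Y p s y)) p s y)))) as [n hn].
{ apply Rabs_pos_lt; exact hne. }
assert (heq : it (S n) p s y - (y + primitive s0 (fun p s y => F p s (Y p s y)) p s y)
   = RInt (fun r => F p r (it n p r y) - F p r (Y p r y)) s0 s).
{ change (it (S n) p s y) with (y + RInt (fun r => F p r (it n p r y)) s0 s).
  rewrite (RInt_Rminus (fun r => F p r (it n p r y)) (fun r => F p r (Y p r y))).
  - unfold primitive; ring.
  - apply (ex_RInt_fiber T s0 hTs _ p s y (hFit n) I).
  - apply (ex_RInt_fiber W s0 hWs _ p s y hFY hs). }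
revert hn; apply Rle_not_lt.
replace (Y p s y - (y + primitive s0 (fun p s y => F p s (Y p s y)) p s y)) with
 ((Y p s y - it (S n) p s y) + (it (S n) p s y
   - (y + primitive s0 (fun p s y => F p s (Y p s y)) p s y))) by ring.
rewrite heq; eapply Rle_trans; [apply Rabs_triang|].
pose proof (hY (S n) p s y (Rlt_le _ _ hs)) as k1.
assert (k2 : Rabs (RInt (fun r => F p r (it n p r y) - F p r (Y p r y)) s0 s)
   <= Rabs (s - s0) * (L * (q * (/ 2) ^ n))).
{ apply RInt_bound.
  - apply (ex_RInt_minus (fun r => F p r (it n p r y)) (fun r => F p r (Y p r y))).
    + apply (ex_RInt_fiber T s0 hTs _ p s y (hFit n) I).
    + apply (ex_RInt_fiber W s0 hWs _ p s y hFY hs).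
  - intros r hr; eapply Rle_trans; [apply hL|]; apply Rmult_le_compat_l; auto.
    rewrite Rabs_minus_sym; apply hY; apply between_dist in hr; lra. }
assert (k3 : Rabs (s - s0) * (L * (q * (/ 2) ^ n)) <= / 2 * (q * (/ 2) ^ n)).
{ rewrite <- Rmult_assoc; apply Rmult_le_compat_r; [apply hq|].
  apply Rle_trans with (L * dl); auto; rewrite Rmult_comm; apply Rmult_le_compat_l; lra. }
replace ((/ 2) ^ S n) with (/ 2 * (/ 2) ^ n) in k1 by (simpl; ring).
pose proof (hq n); lra.
Qed.

(** The 1-Lipschitz retraction of the line onto [c - r, c + r]. Composing F with it makes local
    bounds and Lipschitz constants global. *)
Definition clamp (c r x : R) : R := Rmax (c - r) (Rmin (c + r) x).

Lemma clamp_range (c r x : R) : 0 < r -> Rabs (clamp c r x - c) <= r.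
Proof.
intros hr; unfold clamp, Rmax, Rmin; repeat destruct Rle_dec; apply Rabs_le; lra.
Qed.

Lemma clamp_id (c r x : R) : Rabs (x - c) < r -> clamp c r x = x.
Proof.
intros hx; apply Rabs_def2 in hx; unfold clamp, Rmax, Rmin; repeat destruct Rle_dec; lra.
Qed.

Lemma clamp_lip (c r x y : R) : Rabs (clamp c r x - clamp c r y) <= Rabs (x - y).
Proof.
unfold clamp, Rmax, Rmin; repeat destruct Rle_dec; unfold Rabs;
repeat destruct Rcase_abs; lra.
Qed.

Lemma clamp_cont (c r x : R) : continuous (clamp c r) x.
Proof.
apply filterlim_locally; intros e; exists e; intros y hy.
eapply Rle_lt_trans; [apply clamp_lip|exact hy].
Qed.

(** Picard is applied to F with clamped arguments. For short times the solution stays where clamping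
    is the identity, so it solves the original equation. The constant [L] and the condition (L + 1)
    dl <= 1/2 are passed on because [param_derive] requires them. *)
Lemma ode_cont (F : R -> R -> R -> R) (p0 s0 y0 d : R) : 0 < d ->
  Ck 1 (box p0 s0 y0 d) F ->
  exists dl L Y, 0 < dl /\ dl <= d /\ 0 <= L /\ (L + 1) * dl <= / 2 /\
    (forall p s y, box p0 s0 y0 dl p s y ->
       cont3 Y p s y /\ box p0 s0 y0 d p s (Y p s y) /\
       is_derive (fun r => Y p r y) s (F p s (Y p s y)) /\
       Rabs (d3 F p s (Y p s y)) <= L) /\
    (forall p y, box p0 s0 y0 dl p s0 y -> Y p s0 y = y).
Proof.
intros hd hF.
assert (hop := open3_box p0 s0 y0 d).
assert (hb0 := box_center p0 s0 y0 d hd).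
set (M := Rabs (F p0 s0 y0) + 1); set (L := Rabs (d3 F p0 s0 y0) + 1).
assert (hM : 0 < M) by (unfold M; pose proof (Rabs_pos (F p0 s0 y0)); lra).
assert (hL : 0 < L) by (unfold L; pose proof (Rabs_pos (d3 F p0 s0 y0)); lra).
destruct (proj1 (box_near _ _ _ _) (near3_and _ _ _ _ _ (hop _ _ _ hb0)
  (near3_and _ _ _ _ _ (Ck_C0 1 _ F _ _ _ hF hb0 1 Rlt_0_1)
     (Ck_C0 0 _ (d3 F) _ _ _ (proj2 (proj2 hF) Dir_3) hb0 1 Rlt_0_1)))) as [r1 [hr1 H1]].
(* Half of [r1], since clamped values may reach distance [r] and must still lie in the open box of
   radius [r1]. *)
set (r := r1 / 2).
assert (hr : 0 < r) by (unfold r; lra).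
assert (hcl : forall p s y, box p0 s0 y0 r1 (clamp p0 r p) (clamp s0 r s) (clamp y0 r y)).
{ intros p s y; repeat split;
  (eapply Rle_lt_trans; [apply clamp_range; exact hr|unfold r; lra]). }
assert (bF : forall p s y, box p0 s0 y0 r1 p s y -> Rabs (F p s y) <= M).
{ intros p s y hb; destruct (H1 _ _ _ hb) as [_ [k _]].
  replace (F p s y) with ((F p s y - F p0 s0 y0) + F p0 s0 y0) by ring.
  eapply Rle_trans; [apply Rabs_triang|unfold M; lra]. }
assert (bL : forall p s y, box p0 s0 y0 r1 p s y -> Rabs (d3 F p s y) <= L).
{ intros p s y hb; destruct (H1 _ _ _ hb) as [_ [_ k]].
  replace (d3 F p s y) with ((d3 F p s y - d3 F p0 s0 y0) + d3 F p0 s0 y0) by ring.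
  eapply Rle_trans; [apply Rabs_triang|unfold L; lra]. }
set (Fc := fun p s y => F (clamp p0 r p) (clamp s0 r s) (clamp y0 r y)).
(* The initial value may be off by r / 2, the drift dl M by another r / 2, and the last bound is the
   smallness needed for Picard and Gronwall. *)
set (dl := Rmin (r / 2) (Rmin (r / 2 / M) (/ 2 / (L + 1)))).
assert (hdl : 0 < dl).
{ unfold dl; repeat apply Rmin_pos; [lra|apply Rdiv_lt_0_compat; lra|
  apply Rdiv_lt_0_compat; lra]. }
assert (dl <= r / 2 /\ dl <= r / 2 / M /\ dl <= / 2 / (L + 1)) as [l1 [l2 l3]].
{ unfold dl; split; [apply Rmin_l|]; split;
  (eapply Rle_trans; [apply Rmin_r|]); [apply Rmin_l|apply Rmin_r]. }
assert (l3' : (L + 1) * dl <= / 2).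
{ apply Rle_trans with ((L + 1) * (/ 2 / (L + 1))); [apply Rmult_le_compat_l; lra|].
  right; field; lra. }
assert (l2' : dl * M <= r / 2).
{ apply Rle_trans with (r / 2 / M * M); [apply Rmult_le_compat_r; lra|].
  right; field; lra. }
(* Extracted from the inclusion of boxes: otherwise the point p0 + d would belong to the open box of
   radius d. *)
assert (r1 <= d).
{ apply Rnot_lt_le; intros hlt.
  destruct (H1 (p0 + d) s0 y0) as [[k _] _].
  - repeat split; try (rewrite Rminus_diag, Rabs_R0; lra).
    replace (p0 + d - p0) with d by ring; rewrite Rabs_pos_eq; lra.
  - replace (p0 + d - p0) with d in k by ring; rewrite Rabs_pos_eq in k; lra. }
assert (hrd : r <= d) by (unfold r; lra).
destruct (picard Fc s0 M L dl) as [Y [hYc hYe]].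
- intros p s y.
  apply (cont3_comp F (fun p _ _ => clamp p0 r p) (fun _ s _ => clamp s0 r s)
          (fun _ _ y => clamp y0 r y)).
  + apply (Ck_C0 1 _ F _ _ _ hF); apply H1; auto.
  + apply cont3_fun1; [apply clamp_cont|apply cont3_fst].
  + apply cont3_fun1; [apply clamp_cont|apply cont3_snd].
  + apply cont3_fun1; [apply clamp_cont|apply cont3_trd].
- intros p s y; apply bF; auto.
- intros p s y z; unfold Fc.
  destruct (mvt_segment (fun v => F (clamp p0 r p) (clamp s0 r s) v)
    (fun v => d3 F (clamp p0 r p) (clamp s0 r s) v) (clamp y0 r z) (clamp y0 r y))
    as [v [hv e]].
  + intros v hv; apply Derive_correct.
    apply (proj1 (proj2 hF)); apply H1.
    destruct (hcl p s y) as [k1 [k2 k3]]; destruct (hcl p s z) as [_ [_ k4]].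
    repeat split; auto; apply Rabs_def2 in k3; apply Rabs_def2 in k4.
    unfold Rmin, Rmax in hv; destruct Rle_dec in hv; apply Rabs_def1; lra.
  + rewrite e, Rabs_mult; apply Rmult_le_compat; try apply Rabs_pos; [|apply clamp_lip].
    apply bL.
    destruct (hcl p s y) as [k1 [k2 k3]]; destruct (hcl p s z) as [_ [_ k4]].
    repeat split; auto; apply Rabs_def2 in k3; apply Rabs_def2 in k4.
    unfold Rmin, Rmax in hv; destruct Rle_dec in hv; apply Rabs_def1; lra.
- lra.
- exact hdl.
- lra.
- exists dl, L, Y.
  set (W := fun _ s _ : R => Rabs (s - s0) < dl).
  assert (hW : open3 W).
  { intros a b c hw; unfold W in hw.
    exists (dl - Rabs (b - s0)); split; [lra|]; intros x t z _ ht _.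
    unfold W; replace (t - s0) with ((t - b) + (b - s0)) by ring.
    eapply Rle_lt_trans; [apply Rabs_triang|lra]. }
  assert (hWs : fiberwise_star s0 W).
  { intros p s y r' hw hr'; apply between_dist in hr'; unfold W in *; lra. }
  assert (hFcY : Ck 0 W (fun p s y => Fc p s (Y p s y))).
  { split; auto; intros a b c hw.
    apply (cont3_comp Fc (fun a _ _ => a) (fun _ b _ => b) Y); auto.
    - apply (cont3_comp F (fun p _ _ => clamp p0 r p) (fun _ s _ => clamp s0 r s)
          (fun _ _ y => clamp y0 r y)).
      + apply (Ck_C0 1 _ F _ _ _ hF); apply H1; auto.
      + apply cont3_fun1; [apply clamp_cont|apply cont3_fst].
      + apply cont3_fun1; [apply clamp_cont|apply cont3_snd].
      + apply cont3_fun1; [apply clamp_cont|apply cont3_trd].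
    - apply cont3_fst.
    - apply cont3_snd. }
  assert (hrange : forall p s y, box p0 s0 y0 dl p s y -> box p0 s0 y0 r p s (Y p s y)).
  { intros p s y [k1 [k2 k3]]; split; [lra|split; [lra|]].
    rewrite (hYe p s y k2).
    assert (hI : Rabs (primitive s0 (fun p s y => Fc p s (Y p s y)) p s y)
               <= Rabs (s - s0) * M).
    { apply RInt_bound.
      - exact (ex_RInt_fiber W s0 hWs _ p s y hFcY k2).
      - intros t _; apply bF; auto. }
    assert (hI2 : Rabs (s - s0) * M <= dl * M) by (apply Rmult_le_compat_r; lra).
    set (Z := primitive s0 (fun p s y => Fc p s (Y p s y)) p s y) in *.
    replace (y + Z - y0) with ((y - y0) + Z) by ring.
    eapply Rle_lt_trans; [apply Rabs_triang|lra]. }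
  split; [exact hdl|split; [lra|split; [lra|split; [exact l3'|split]]]].
  + intros p s y hb; destruct (hrange p s y hb) as [k1 [k2 k3]].
    destruct hb as [j1 [j2 j3]].
    assert (hb' : box p0 s0 y0 r1 p s (Y p s y)) .
    { apply (box_le p0 s0 y0 r r1); [unfold r; lra|]; apply hrange; repeat split; assumption. }
    split; [apply hYc; exact j2|]; split; [apply (box_le _ _ _ r1); auto|].
    split; [|apply bL; exact hb'].
    apply (is_derive_ext_loc
      (fun t => y + primitive s0 (fun p s y => Fc p s (Y p s y)) p t y)).
    { generalize (near3_slice2 _ _ _ _ (hW p s y j2)); apply filter_imp; intros t ht.
      symmetry; apply hYe; exact ht. }
    replace (F p s (Y p s y)) with (0 + Fc p s (Y p s y))
      by (unfold Fc; rewrite !clamp_id by assumption; ring).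
    apply (is_derive_plus (fun _ => y)
      (fun t => primitive s0 (fun p s y => Fc p s (Y p s y)) p t y)).
    * apply is_derive_Rconst.
    * exact (primitive_derive W s0 hW hWs _ p s y hFcY j2).
  + intros p y [_ [k _]]; rewrite (hYe p s0 y k), primitive_center; ring.
Qed.

Lemma Ck_fst n W : open3 W -> Ck n W (fun a _ _ => a).
Proof. exact (Ck_proj3 n W Dir_1). Qed.
Lemma Ck_snd n W : open3 W -> Ck n W (fun _ b _ => b).
Proof. exact (Ck_proj3 n W Dir_2). Qed.
Lemma Ck_trd n W : open3 W -> Ck n W (fun _ _ c => c).
Proof. exact (Ck_proj3 n W Dir_3). Qed.

(** A bootstrap: the partial derivatives of Y are F, [V] and [E] along Y, and these are built from Y
    by composition, primitives, exponentials and inverses. If Y is C^n, so are they, and Y is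
    C^(n+1). *)
Lemma ode_smooth (F : R -> R -> R -> R) (p0 s0 y0 d : R) : 0 < d ->
  Cinf (box p0 s0 y0 d) F ->
  exists dl Y, 0 < dl /\ dl <= d /\ Cinf (box p0 s0 y0 dl) Y /\
    (forall p s y, box p0 s0 y0 dl p s y -> box p0 s0 y0 d p s (Y p s y) /\
       is_derive (fun r => Y p r y) s (F p s (Y p s y))) /\
    (forall p y, box p0 s0 y0 dl p s0 y -> Y p s0 y = y).
Proof.
intros hd hF.
destruct (ode_cont F p0 s0 y0 d hd (hF 1%nat)) as [dl [L [Y [hdl [hdd [hL [hLd [hY hini]]]]]]]].
exists dl, Y; split; [exact hdl|split; [exact hdd|]].
set (W := box p0 s0 y0 dl).
assert (hW : open3 W) by apply open3_box.
assert (hWs : fiberwise_star s0 W) by apply fiberwise_star_box.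
assert (hB : open3 (box p0 s0 y0 d)) by apply open3_box.
set (b := fun p s y => d3 F p s (Y p s y)).
set (c := fun p s y => d1 F p s (Y p s y)).
(* Explicit solutions of the variational equations: E' = b E with value 1 at s0, and V' = b V + c
   with value 0 by variation of constants. *)
set (E := fun p s y => exp (primitive s0 b p s y)).
set (V := fun p s y => E p s y *
   primitive s0 (fun p s y => c p s y * / E p s y) p s y).
assert (hcomp : forall n G, Ck n W Y -> Cinf (box p0 s0 y0 d) G ->
   Ck n W (fun p s y => G p s (Y p s y))).
{ intros n G hn hG.
  apply (Ck_comp n W (box p0 s0 y0 d) G (fun p _ _ => p) (fun _ s _ => s) Y); auto.
  - apply Ck_fst; auto.
  - apply Ck_snd; auto.
  - intros p s y hw; apply (hY p s y hw). }
assert (hE0 : forall p s y, E p s y <> 0) by (intros; apply Rgt_not_eq, exp_pos).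
assert (hbn : forall n, Ck n W Y -> Ck n W b).
{ intros n hn; apply hcomp; auto; exact (Cinf_pd3 _ _ Dir_3 hF). }
assert (hcn : forall n, Ck n W Y -> Ck n W c).
{ intros n hn; apply hcomp; auto; exact (Cinf_pd3 _ _ Dir_1 hF). }
assert (hEn : forall n, Ck n W Y -> Ck n W E).
{ intros n hn; apply Ck_exp; auto; apply Ck_primitive; auto. }
assert (hce : forall n, Ck n W Y -> Ck n W (fun p s y => c p s y * / E p s y)).
{ intros n hn; apply Ck_mult; auto; apply Ck_inv; auto. }
assert (hVn : forall n, Ck n W Y -> Ck n W V).
{ intros n hn; apply Ck_mult; auto; apply Ck_primitive; auto. }
assert (hY0 : Ck 0 W Y) by (split; auto; intros; apply hY; assumption).
assert (dE : forall p s y, W p s y -> is_derive (fun r => E p r y) s (b p s y * E p s y)).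
{ intros p s y hw.
  exact (is_derive_comp exp (fun r => primitive s0 b p r y) s _ _ (is_derive_exp _)
          (primitive_derive W s0 hW hWs b p s y (hbn _ hY0) hw)). }
assert (dV : forall p s y, W p s y ->
   is_derive (fun r => V p r y) s (b p s y * V p s y + c p s y)).
{ intros p s y hw.
  pose proof (is_derive_Rmult _ _ s _ _ (dE p s y hw)
    (primitive_derive W s0 hW hWs _ p s y (hce _ hY0) hw)) as h.
  replace (b p s y * V p s y + c p s y) with
   (b p s y * E p s y * primitive s0 (fun p s y => c p s y * / E p s y) p s y
    + E p s y * (c p s y * / E p s y)); [exact h|].
  unfold V; field; apply hE0. }
assert (hsmall : forall p s y r, W p s y -> between s0 s r -> (L + 1) * Rabs (s - s0) <= / 2).
{ intros p s y r [_ [hs _]] _; apply Rle_trans with ((L + 1) * dl); auto.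
  apply Rmult_le_compat_l; lra. }
assert (hpart : forall p s y, W p s y -> partials Y
  (fun d => match d with Dir_1 => V | Dir_2 => fun p s y => F p s (Y p s y) | Dir_3 => E end)
  p s y).
{ intros p s y hw; split; [|split; [apply (hY p s y hw)|]].
  - apply (param_derive F (fun x r => Y x r y) (fun r => V p r y) p s0 s 0 L
           (dl - Rabs (p - p0))).
    + destruct hw as [k _]; lra.
    + assert (hw0 : forall x, Rabs (x - p) < dl - Rabs (p - p0) -> W x s0 y).
      { destruct hw as [k1 [k2 k3]]; intros x hx; repeat split; auto.
        - replace (x - p0) with ((x - p) + (p - p0)) by ring.
          eapply Rle_lt_trans; [apply Rabs_triang|lra].
        - rewrite Rminus_diag, Rabs_R0; lra. }
      intros x hx; rewrite (hini x y (hw0 x hx)), (hini p y); [ring|].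
      apply hw0; rewrite Rminus_diag, Rabs_R0; destruct hw as [k _]; lra.
    + intros x r hx hr; apply (hY x r y); apply (hWs x s y r); [|exact hr].
      destruct hw as [k1 [k2 k3]]; repeat split; auto.
      replace (x - p0) with ((x - p) + (p - p0)) by ring.
      eapply Rle_lt_trans; [apply Rabs_triang|lra].
    + intros r hr; apply (Cinf_C1at _ F _ _ _ hB hF); apply (hY p r y).
      apply (hWs p s y r hw hr).
    + intros r hr.
      apply (cont3_comp Y (fun x _ _ => x) (fun _ t _ => t) (fun _ _ _ => y)).
      * apply hY; exact (hWs p s y r hw hr).
      * apply cont3_fst.
      * apply cont3_snd.
      * apply cont3_const.
    + intros r hr; apply dV; exact (hWs p s y r hw hr).
    + unfold V; rewrite primitive_center; ring.
    + exact hL.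
    + intros r hr; apply (hY p r y); exact (hWs p s y r hw hr).
    + exact (hsmall p s y s0 hw (between_l _ _)).
  (* For the derivative in the initial value, p is frozen and y takes the place of the parameter in
     [param_derive], with initial slope 1 and no explicit dependence of F on it. *)
  - set (W2 := fun _ t z : R => box p0 s0 y0 d p t z).
    assert (hW2 : open3 W2).
    { intros a t z hh.
      apply (near3_comp (box p0 s0 y0 d) (fun _ _ _ => p) (fun _ t _ => t) (fun _ _ z => z)).
      - apply cont3_const.
      - apply cont3_snd.
      - apply cont3_trd.
      - apply hB; exact hh. }
    assert (hF2 : Ck 1 W2 (fun _ t z => F p t z)).
    { apply (Ck_comp 1 W2 (box p0 s0 y0 d) F (fun _ _ _ => p) (fun _ t _ => t) (fun _ _ z => z));
      auto.
      - apply Ck_const; auto.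
      - apply Ck_snd; auto.
      - apply Ck_trd; auto. }
    apply (param_derive (fun _ t z => F p t z) (fun x r => Y p r x) (fun r => E p r y)
            y s0 s 1 L (dl - Rabs (y - y0))).
    + destruct hw as [_ [_ k]]; lra.
    + assert (hw0 : forall x, Rabs (x - y) < dl - Rabs (y - y0) -> W p s0 x).
      { destruct hw as [k1 [k2 k3]]; intros x hx; repeat split; auto.
        - rewrite Rminus_diag, Rabs_R0; lra.
        - replace (x - y0) with ((x - y) + (y - y0)) by ring.
          eapply Rle_lt_trans; [apply Rabs_triang|lra]. }
      intros x hx; rewrite (hini p x (hw0 x hx)), (hini p y); [ring|].
      apply hw0; rewrite Rminus_diag, Rabs_R0; destruct hw as [_ [_ k]]; lra.
    + intros x r hx hr; apply (hY p r x); apply (hWs p s x r); [|exact hr].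
      destruct hw as [k1 [k2 k3]]; repeat split; auto.
      replace (x - y0) with ((x - y) + (y - y0)) by ring.
      eapply Rle_lt_trans; [apply Rabs_triang|lra].
    + intros r hr; apply (Ck_C1at 0 W2); auto.
      apply (hY p r y (hWs p s y r hw hr)).
    + intros r hr.
      apply (cont3_comp Y (fun _ _ _ => p) (fun _ t _ => t) (fun x _ _ => x)).
      * apply hY; exact (hWs p s y r hw hr).
      * apply cont3_const.
      * apply cont3_snd.
      * apply cont3_fst.
    + intros r hr.
      replace (d1 (fun _ t z => F p t z) y r (Y p r y)) with 0
        by (unfold d1; rewrite Derive_const; reflexivity).
      rewrite Rplus_0_r; apply dE; exact (hWs p s y r hw hr).
    + unfold E; rewrite primitive_center; apply exp_0.
    + exact hL.
    + intros r hr; apply (hY p r y); exact (hWs p s y r hw hr).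
    + exact (hsmall p s y s0 hw (between_l _ _)). }
split; [|split; auto].
- intros n; induction n as [|n IH]; [exact hY0|].
  apply (Ck_intro n W _ _ hW hpart); intros [| |]; auto.
- intros p s y hw; destruct (hY p s y hw) as [_ [h1 [h2 _]]]; auto.
Qed.

(** * Implicit functions *)

Lemma increment_bound (g : R -> R) (s l e r : R) : e <= 1 ->
  Rabs (g r - g s - l * (r - s)) <= e * Rabs (r - s) ->
  Rabs (g r - g s) <= (Rabs l + 1) * Rabs (r - s).
Proof.
intros he hg.
replace (g r - g s) with ((g r - g s - l * (r - s)) + l * (r - s)) by ring.
eapply Rle_trans; [apply Rabs_triang|]; rewrite (Rabs_mult l).
assert (e * Rabs (r - s) <= 1 * Rabs (r - s))
  by (apply Rmult_le_compat_r; [apply Rabs_pos|exact he]).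
lra.
Qed.

(** Differentiates k along a curve knowing only that k is continuous. The remainder of f contains
    |dk| itself; it is first absorbed to give the a priori bound |dk| <= C |dr|, after which the
    expansion can be solved for dk. *)
Lemma implicit_derive (f : R -> R -> R -> R) (u v w k : R -> R) (s u' v' w' : R) :
  C1at f (u s) (v s) (k s) -> d3 f (u s) (v s) (k s) <> 0 ->
  is_derive u s u' -> is_derive v s v' -> is_derive w s w' -> continuous k s ->
  locally s (fun r => f (u r) (v r) (k r) = w r) ->
  is_derive k s ((w' - d1 f (u s) (v s) (k s) * u' - d2 f (u s) (v s) (k s) * v')
                 / d3 f (u s) (v s) (k s)).
Proof.
intros hf hm hu hv hw ck heq.
assert (cu : continuous u s) by (apply (ex_derive_continuous u s); exists u'; exact hu).
assert (cv : continuous v s) by (apply (ex_derive_continuous v s); exists v'; exact hv).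
set (p := d1 f (u s) (v s) (k s)); set (q := d2 f (u s) (v s) (k s)).
set (m := d3 f (u s) (v s) (k s)) in *.
set (k' := (w' - p * u' - q * v') / m).
assert (hk' : m * k' = w' - p * u' - q * v') by (unfold k'; field; exact hm).
clearbody k'.
assert (hmp : 0 < Rabs m) by (apply Rabs_pos_lt; exact hm).
apply is_derive_eps; intros e he.
pose proof (Rabs_pos p); pose proof (Rabs_pos q); pose proof (Rabs_pos u');
pose proof (Rabs_pos v'); pose proof (Rabs_pos w').
set (B := (Rabs w' + 1) + (Rabs p + 1) * (Rabs u' + 1) + (Rabs q + 1) * (Rabs v' + 1)).
assert (hB : 0 < B).
{ unfold B; assert (0 <= (Rabs p + 1) * (Rabs u' + 1)) by (apply Rmult_le_pos; lra);
  assert (0 <= (Rabs q + 1) * (Rabs v' + 1)) by (apply Rmult_le_pos; lra); lra. }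
(* The factor 2 comes from absorbing (|m| / 2) |dk| into |m| |dk|. *)
set (C := 2 * B / Rabs m).
assert (hC : 0 < C) by (apply Rdiv_lt_0_compat; lra).
assert (hCm : C * Rabs m = 2 * B) by (unfold C; field; lra).
(* The coefficients of h |dr| collected: 1, |p| and |q| from the remainders of w, u and v, the rest
   from the remainder of f with |dk| already bounded by C |dr|. *)
set (S := 1 + Rabs p + Rabs q + Rabs u' + Rabs v' + 2 + C).
assert (hS : 0 < S) by (unfold S; lra).
set (h := Rmin (Rmin 1 (Rabs m / 2)) (Rabs m * e / S)).
assert (hh : 0 < h).
{ unfold h; repeat apply Rmin_pos; try lra; apply Rdiv_lt_0_compat; auto;
  apply Rmult_lt_0_compat; auto. }
assert (h <= 1 /\ h <= Rabs m / 2 /\ h <= Rabs m * e / S) as [h1 [h2 h3]].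
{ pose proof (Rmin_l (Rmin 1 (Rabs m / 2)) (Rabs m * e / S));
  pose proof (Rmin_r (Rmin 1 (Rabs m / 2)) (Rabs m * e / S));
  pose proof (Rmin_l 1 (Rabs m / 2)); pose proof (Rmin_r 1 (Rabs m / 2)); unfold h; lra. }
assert (h3' : h * S <= Rabs m * e).
{ apply Rle_trans with (Rabs m * e / S * S); [apply Rmult_le_compat_r; lra|].
  right; field; lra. }
pose proof (locally_singleton _ _ heq) as heq0; simpl in heq0.
generalize (filter_and _ _ (near3_curve _ u v k s (C1at_diff f _ _ _ hf h hh) cu cv ck)
  (filter_and _ _ (proj1 (is_derive_eps _ _ _) hu h hh)
  (filter_and _ _ (proj1 (is_derive_eps _ _ _) hv h hh)
  (filter_and _ _ (proj1 (is_derive_eps _ _ _) hw h hh) heq)))).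
apply filter_imp; intros r [k0 [k1 [k2 [k3 k4]]]].
fold p q m in k0; rewrite k4, heq0 in k0.
pose proof (increment_bound u s u' h r h1 k1) as b1.
pose proof (increment_bound v s v' h r h1 k2) as b2.
pose proof (increment_bound w s w' h r h1 k3) as b3.
set (D := Rabs (r - s)) in *; assert (hD : 0 <= D) by apply Rabs_pos.
set (du := u r - u s) in *; set (dv := v r - v s) in *; set (dw := w r - w s) in *.
set (dk := k r - k s) in *; set (dr := r - s) in *.
set (Rm := dw - (p * du + q * dv + m * dk)) in *.
assert (a1 : Rabs du <= (Rabs u' + 1) * D) by exact b1.
assert (c1 : Rabs (p * du) <= Rabs p * ((Rabs u' + 1) * D))
  by (rewrite Rabs_mult; apply Rmult_le_compat_l; auto).
assert (c2 : Rabs (q * dv) <= Rabs q * ((Rabs v' + 1) * D))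
  by (rewrite Rabs_mult; apply Rmult_le_compat_l; auto).
assert (c3 : h * Rabs du <= 1 * ((Rabs u' + 1) * D))
  by (apply Rmult_le_compat; auto; try lra; apply Rabs_pos).
assert (c4 : h * Rabs dv <= 1 * ((Rabs v' + 1) * D))
  by (apply Rmult_le_compat; auto; try lra; apply Rabs_pos).
assert (c5 : h * Rabs dk <= Rabs m / 2 * Rabs dk)
  by (apply Rmult_le_compat_r; auto; apply Rabs_pos).
assert (c6 : Rabs m * Rabs dk <= B * D + Rabs m / 2 * Rabs dk).
{ rewrite <- Rabs_mult; replace (m * dk) with ((dw + - (p * du)) + (- (q * dv) + - Rm))
    by (unfold Rm; ring).
  eapply Rle_trans; [apply Rabs_triang|].
  assert (Rabs (dw + - (p * du)) <= Rabs dw + Rabs (p * du))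
    by (eapply Rle_trans; [apply Rabs_triang|rewrite Rabs_Ropp; lra]).
  assert (Rabs (- (q * dv) + - Rm) <= Rabs (q * dv) + Rabs Rm)
    by (eapply Rle_trans; [apply Rabs_triang|rewrite !Rabs_Ropp; lra]).
  unfold B; lra. }
assert (c7 : Rabs dk <= C * D).
{ apply Rmult_le_reg_l with (Rabs m); auto.
  replace (Rabs m * (C * D)) with ((C * Rabs m) * D) by ring; rewrite hCm; lra. }
apply Rmult_le_reg_l with (Rabs m); auto.
rewrite <- Rabs_mult.
replace (m * (dk - k' * dr)) with
 ((dw - w' * dr) + (- (p * (du - u' * dr)) + (- (q * (dv - v' * dr)) + - Rm))).
2:{ replace (m * (dk - k' * dr)) with (m * dk - (m * k') * dr) by ring.
    rewrite hk'; unfold Rm; ring. }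
assert (e1 : Rabs (p * (du - u' * dr)) <= Rabs p * (h * D))
  by (rewrite Rabs_mult; apply Rmult_le_compat_l; auto).
assert (e2 : Rabs (q * (dv - v' * dr)) <= Rabs q * (h * D))
  by (rewrite Rabs_mult; apply Rmult_le_compat_l; auto).
assert (e3 : h * (Rabs du + Rabs dv + Rabs dk) <=
   h * ((Rabs u' + 1) * D + (Rabs v' + 1) * D + C * D)) by (apply Rmult_le_compat_l; lra).
apply Rle_trans with (h * S * D).
- eapply Rle_trans; [apply Rabs_triang|].
  assert (Rabs (- (p * (du - u' * dr)) + (- (q * (dv - v' * dr)) + - Rm)) <=
     Rabs (p * (du - u' * dr)) + (Rabs (q * (dv - v' * dr)) + Rabs Rm)).
  { eapply Rle_trans; [apply Rabs_triang|]; rewrite Rabs_Ropp; apply Rplus_le_compat_l.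
    eapply Rle_trans; [apply Rabs_triang|]; rewrite !Rabs_Ropp; lra. }
  unfold S; lra.
- rewrite <- Rmult_assoc; apply Rmult_le_compat_r; auto.
Qed.

(** Multiplying by [m], later the value of the derivative at the centre, treats increasing and
    decreasing functions at once. *)
Lemma scaled_increasing (g dg : R -> R) (m a b : R) : a < b ->
  (forall v, a <= v <= b -> is_derive g v (dg v) /\ 0 < m * dg v) -> m * g a < m * g b.
Proof.
intros hab h.
destruct (mvt_segment g dg a b) as [c [hc e]].
- intros v; rewrite Rmin_left, Rmax_right by lra; intros hv; apply h; exact hv.
- rewrite Rmin_left, Rmax_right in hc by lra.
  destruct (h c hc) as [_ hp].
  assert (0 < m * dg c * (b - a)) by (apply Rmult_lt_0_compat; lra).
  replace (m * g b) with (m * g a + m * (g b - g a)) by ring; rewrite e; lra.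
Qed.

(** On a small box m f is strictly increasing in the last variable. The intermediate value theorem
    gives solutions, monotonicity makes them unique and continuous, and [implicit_derive] expresses
    the partial derivatives of K through K, so that smoothness is bootstrapped. *)
Lemma implicit_function (f : R -> R -> R -> R) (t0 x0 k0 d : R) : 0 < d ->
  Cinf (box t0 x0 k0 d) f -> d3 f t0 x0 k0 <> 0 ->
  exists d' e K, 0 < d' /\ d' <= d /\ 0 < e /\
    Cinf (box t0 x0 (f t0 x0 k0) e) K /\
    (forall t x u, box t0 x0 (f t0 x0 k0) e t x u ->
       box t0 x0 k0 d' t x (K t x u) /\ f t x (K t x u) = u) /\
    (forall t x k k', box t0 x0 k0 d' t x k -> box t0 x0 k0 d' t x k' ->
       f t x k = f t x k' -> k = k') /\
    (forall t x k, box t0 x0 k0 d' t x k -> d3 f t x k <> 0).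
Proof.
intros hd hf hm; set (m := d3 f t0 x0 k0) in *; set (u0 := f t0 x0 k0).
assert (hop := open3_box t0 x0 k0 d).
pose proof (box_center t0 x0 k0 d hd) as hb0.
assert (hmm : 0 < m * m) by (destruct (Rtotal_order m 0) as [h|[h|h]]; [nra|tauto|nra]).
assert (hcd : cont3 (fun a b c => m * d3 f a b c) t0 x0 k0).
{ apply cont3_mult; [apply cont3_const|].
  apply (Ck_C0 0 _ (d3 f) _ _ _ (Cinf_pd3 _ _ Dir_3 hf 0%nat) hb0). }
destruct (proj1 (box_near _ _ _ _) (near3_and _ _ _ _ _ (hop _ _ _ hb0) (hcd (m * m) hmm)))
  as [d' [hd' H]].
assert (hpos : forall t x k, box t0 x0 k0 d' t x k ->
   is_derive (fun v => f t x v) k (d3 f t x k) /\ 0 < m * d3 f t x k).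
{ intros t x k hb; destruct (H t x k hb) as [h1 h2]; split.
  - apply (Cinf_partials _ f _ _ _ hf h1).
  - apply Rabs_def2 in h2; fold m in h2; lra. }
assert (hmon : forall t x k k', box t0 x0 k0 d' t x k -> box t0 x0 k0 d' t x k' -> k < k' ->
   m * f t x k < m * f t x k').
{ intros t x k k' [h1 [h2 h3]] [_ [_ h4]] hlt.
  apply (scaled_increasing (fun v => f t x v) (fun v => d3 f t x v)); auto.
  intros v hv; apply hpos; repeat split; auto.
  apply Rabs_def2 in h3; apply Rabs_def2 in h4; apply Rabs_def1; lra. }
assert (hfc : forall t x k, box t0 x0 k0 d' t x k -> cont3 f t x k).
{ intros t x k hb; apply (Ck_C0 0 _ f _ _ _ (hf 0%nat)); apply H; exact hb. }
(* The sign s = 1 or -1 lets one statement say that both strict inequalities, above and below u,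
   persist nearby. *)
assert (hsgn : forall t x k u s, box t0 x0 k0 d' t x k -> 0 < s * (m * f t x k - m * u) ->
   near3 t x u (fun t' x' u' => 0 < s * (m * f t' x' k - m * u'))).
{ intros t x k u s hb hp.
  assert (hc : cont3 (fun t' x' u' => s * (m * f t' x' k + (- m) * u')) t x u).
  { apply cont3_mult; [apply cont3_const|]; apply cont3_plus;
    (apply cont3_mult; [apply cont3_const|]); [|apply cont3_trd].
    apply (cont3_comp f (fun t _ _ => t) (fun _ x _ => x) (fun _ _ _ => k)).
    - apply hfc; exact hb.
    - apply cont3_fst.
    - apply cont3_snd.
    - apply cont3_const. }
  generalize (hc _ hp); apply near3_imp; intros t' x' u' h.
  apply Rabs_def2 in h; lra. }
set (r := d' / 2).
assert (hr : 0 < r) by (unfold r; lra).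
assert (hbk : forall k, Rabs (k - k0) < d' -> forall t x, Rabs (t - t0) < d' ->
   Rabs (x - x0) < d' -> box t0 x0 k0 d' t x k) by (intros; repeat split; auto).
assert (z : forall a, Rabs (a - a) < d') by (intros; rewrite Rminus_diag, Rabs_R0; auto).
assert (hrp : Rabs (k0 + r - k0) < d') by
  (replace (k0 + r - k0) with r by ring; rewrite Rabs_pos_eq; unfold r; lra).
assert (hrm : Rabs (k0 - r - k0) < d') by
  (replace (k0 - r - k0) with (- r) by ring; rewrite Rabs_Ropp, Rabs_pos_eq; unfold r; lra).
destruct (proj1 (box_near _ _ _ _) (near3_and _ _ _ _ _ (near3_box t0 x0 u0 d' hd')
  (near3_and _ _ _ _ _
   (hsgn t0 x0 (k0 + r) u0 1 (hbk _ hrp _ _ (z _) (z _))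
     ltac:(pose proof (hmon t0 x0 k0 (k0 + r) (hbk _ (z _) _ _ (z _) (z _))
             (hbk _ hrp _ _ (z _) (z _)) ltac:(lra)); fold u0 in H0; lra))
   (hsgn t0 x0 (k0 - r) u0 (-1) (hbk _ hrm _ _ (z _) (z _))
     ltac:(pose proof (hmon t0 x0 (k0 - r) k0 (hbk _ hrm _ _ (z _) (z _))
             (hbk _ (z _) _ _ (z _) (z _)) ltac:(lra)); fold u0 in H0; lra)))))
  as [e [he He]].
(* A choice of solution; [hinj] below makes it the only one in the box. *)
set (K := fun t x u => epsilon (inhabits k0)
   (fun k => box t0 x0 k0 d' t x k /\ f t x k = u)).
assert (hK : forall t x u, box t0 x0 u0 e t x u ->
   box t0 x0 k0 d' t x (K t x u) /\ f t x (K t x u) = u).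
{ intros t x u hb; apply (epsilon_spec (inhabits k0)
    (fun k => box t0 x0 k0 d' t x k /\ f t x k = u)).
  destruct (He t x u hb) as [[q1 [q2 q3]] [p1 p2]].
  assert (hin : forall v, k0 - r <= v <= k0 + r -> box t0 x0 k0 d' t x v).
  { intros v hv; apply hbk; auto; apply Rabs_def1; unfold r in hv; lra. }
  destruct (IVT_interv (fun v => m * f t x v - m * u) (k0 - r) (k0 + r)) as [v [hv ev]].
  - intros v hv; apply continuity_pt_filterlim.
    apply (continuous_minus (fun v => m * f t x v) (fun _ => m * u)).
    + apply (continuous_scal_r m (fun v => f t x v)).
      apply (ex_derive_continuous (fun v => f t x v)).
      eexists; apply hpos; apply hin; exact hv.
    + apply continuous_const.
  - lra.
  - lra.
  - lra.
  - exists v; split; [apply hin; exact hv|].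
    assert (hne : m <> 0) by exact hm.
    apply (Rmult_eq_reg_l m); lra. }
assert (hinj : forall t x k k', box t0 x0 k0 d' t x k -> box t0 x0 k0 d' t x k' ->
   f t x k = f t x k' -> k = k').
{ intros t x k k' h1 h2 heq; destruct (Rtotal_order k k') as [h|[h|h]]; auto.
  - pose proof (hmon t x k k' h1 h2 h); rewrite heq in *; lra.
  - pose proof (hmon t x k' k h2 h1 h); rewrite heq in *; lra. }
assert (hlt : forall t x k k', box t0 x0 k0 d' t x k -> box t0 x0 k0 d' t x k' ->
   m * f t x k < m * f t x k' -> k < k').
{ intros t x k k' h1 h2 h; destruct (Rtotal_order k k') as [h'|[h'|h']]; auto.
  - subst; lra.
  - pose proof (hmon t x k' k h2 h1 h'); lra. }
assert (hop' := open3_box t0 x0 k0 d').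
assert (hope := open3_box t0 x0 u0 e).
assert (hKc : forall t x u, box t0 x0 u0 e t x u -> cont3 K t x u).
{ intros t x u hb n hn; destruct (hK t x u hb) as [hk1 hk2].
  set (k := K t x u) in *.
  destruct hk1 as [q1 [q2 q3]].
  (* Reduced so that k + n' and k - n' stay in the box, where they enclose the solution at all
     nearby points. *)
  set (n' := Rmin n ((d' - Rabs (k - k0)) / 2)).
  assert (hn' : 0 < n') by (apply Rmin_pos; lra).
  assert (n' <= n /\ n' <= (d' - Rabs (k - k0)) / 2) as [n1 n2]
    by (split; [apply Rmin_l|apply Rmin_r]).
  assert (kp : Rabs (k + n' - k0) < d').
  { replace (k + n' - k0) with ((k - k0) + n') by ring.
    eapply Rle_lt_trans; [apply Rabs_triang|]; rewrite (Rabs_pos_eq n'); lra. }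
  assert (km : Rabs (k - n' - k0) < d').
  { replace (k - n' - k0) with ((k - k0) + - n') by ring.
    eapply Rle_lt_trans; [apply Rabs_triang|]; rewrite Rabs_Ropp, (Rabs_pos_eq n'); lra. }
  assert (s1 : 0 < 1 * (m * f t x (k + n') - m * u)).
  { assert (m * f t x k < m * f t x (k + n')) by (apply hmon; auto; lra).
    rewrite hk2 in H0; lra. }
  assert (s2 : 0 < -1 * (m * f t x (k - n') - m * u)).
  { assert (m * f t x (k - n') < m * f t x k) by (apply hmon; auto; lra).
    rewrite hk2 in H0; lra. }
  generalize (near3_and _ _ _ _ _ (hope t x u hb) (near3_and _ _ _ _ _
    (hsgn t x (k + n') u 1 (hbk _ kp _ _ q1 q2) s1)
    (hsgn t x (k - n') u (-1) (hbk _ km _ _ q1 q2) s2))).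
  apply near3_imp; intros t' x' u' [g1 [g2 g3]].
  destruct (hK t' x' u' g1) as [gk1 gk2].
  destruct gk1 as [w1 [w2 w3]].
  assert (K t' x' u' < k + n') by (apply (hlt t' x'); auto; rewrite gk2; lra).
  assert (k - n' < K t' x' u') by (apply (hlt t' x'); auto; rewrite gk2; lra).
  apply Rabs_def1; lra. }
exists d', e, K; split; [exact hd'|split; [|split; [exact he|split; [|split; [|split]]]]]; auto.
- apply Rnot_lt_le; intros hltd.
  destruct (H (t0 + d) x0 k0) as [[h _] _].
  + repeat split; auto; replace (t0 + d - t0) with d by ring; rewrite Rabs_pos_eq; lra.
  + replace (t0 + d - t0) with d in h by ring; rewrite Rabs_pos_eq in h; lra.
- set (num := fun dr => match dr with
    | Dir_1 => fun a b c => -1 * d1 f a b c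
    | Dir_2 => fun a b c => -1 * d2 f a b c
    | Dir_3 => fun _ _ _ => 1 end).
  assert (hnum : forall n dr, Ck n (box t0 x0 k0 d') (num dr)).
  { intros n dr; assert (hs : forall t x k, box t0 x0 k0 d' t x k -> box t0 x0 k0 d t x k)
      by (intros t x k h; apply H; exact h).
    destruct dr; simpl; try apply Ck_mult; try apply Ck_const; auto;
    apply (Ck_sub n (box t0 x0 k0 d)); auto;
    [apply (Cinf_pd3 _ f Dir_1)|apply (Cinf_pd3 _ f Dir_2)]; auto. }
  assert (hinv : forall n, Ck n (box t0 x0 k0 d') (fun a b c => / d3 f a b c)).
  { intros n; apply Ck_inv; auto.
    - intros a b c hb; destruct (hpos a b c hb) as [_ h]; nra.
    - apply (Ck_sub n (box t0 x0 k0 d)); [intros a b c h; apply H; exact h|].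
      apply (Cinf_pd3 _ f Dir_3); auto. }
  intros n; induction n as [|n IH]; [split; auto|].
  apply (Ck_intro n _ _ (fun dr t x u => num dr t x (K t x u) * / d3 f t x (K t x u))); auto.
  + intros t x u hb; destruct (hK t x u hb) as [hk1 hk2].
    assert (hC : C1at f t x (K t x u)) by (apply (Cinf_C1at _ f _ _ _ hop hf); apply H; auto).
    assert (hne : d3 f t x (K t x u) <> 0) by (destruct (hpos _ _ _ hk1) as [_ h]; nra).
    pose proof (hope t x u hb) as hn.
    split; [|split].
    * replace (num Dir_1 t x (K t x u) * / d3 f t x (K t x u)) with
       ((0 - d1 f t x (K t x u) * 1 - d2 f t x (K t x u) * 0) / d3 f t x (K t x u))
       by (simpl; field; auto).
      apply (implicit_derive f (fun r => r) (fun _ => x) (fun _ => u) (fun r => K r x u) t);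
        auto; try apply is_derive_Rconst; try apply is_derive_Rid.
      -- apply (cont3_curve K (fun r => r) (fun _ => x) (fun _ => u)); auto;
         try apply continuous_const; apply continuous_id.
      -- generalize (near3_slice1 _ _ _ _ hn); apply filter_imp; intros y hy; apply hK; auto.
    * replace (num Dir_2 t x (K t x u) * / d3 f t x (K t x u)) with
       ((0 - d1 f t x (K t x u) * 0 - d2 f t x (K t x u) * 1) / d3 f t x (K t x u))
       by (simpl; field; auto).
      apply (implicit_derive f (fun _ => t) (fun r => r) (fun _ => u) (fun r => K t r u) x);
        auto; try apply is_derive_Rconst; try apply is_derive_Rid.
      -- apply (cont3_curve K (fun _ => t) (fun r => r) (fun _ => u)); auto;
         try apply continuous_const; apply continuous_id.
      -- generalize (near3_slice2 _ _ _ _ hn); apply filter_imp; intros y hy; apply hK; auto.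
    * replace (num Dir_3 t x (K t x u) * / d3 f t x (K t x u)) with
       ((1 - d1 f t x (K t x u) * 0 - d2 f t x (K t x u) * 0) / d3 f t x (K t x u))
       by (simpl; field; auto).
      apply (implicit_derive f (fun _ => t) (fun _ => x) (fun r => r) (fun r => K t x r) u);
        auto; try apply is_derive_Rconst; try apply is_derive_Rid.
      -- apply (cont3_curve K (fun _ => t) (fun _ => x) (fun r => r)); auto;
         try apply continuous_const; apply continuous_id.
      -- generalize (near3_slice3 _ _ _ _ hn); apply filter_imp; intros y hy; apply hK; auto.
  + intros dr.
    apply (Ck_comp n _ (box t0 x0 k0 d') (fun a b c => num dr a b c * / d3 f a b c)
      (fun t _ _ => t) (fun _ x _ => x) K); auto.
    * apply Ck_mult; auto.
    * apply Ck_fst; auto.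
    * apply Ck_snd; auto.
    * intros t x u hb; apply hK; exact hb.
- intros t x k hb; destruct (hpos t x k hb) as [_ h]; nra.
Qed.

(** * Analytic functions are smooth *)

Lemma ex_series_Rle (u M : nat -> R) :
  (forall i, Rabs (u i) <= M i) -> ex_series M -> ex_series u.
Proof. intros h hM; apply (ex_series_le u M); auto. Qed.

Lemma Series_Rabs_le (u M : nat -> R) :
  (forall i, Rabs (u i) <= M i) -> ex_series M -> Rabs (Series u) <= Series M.
Proof.
intros h hM; eapply Rle_trans; [apply Series_Rabs|].
- apply (ex_series_Rle _ M); auto; intros i; rewrite Rabs_Rabsolu; auto.
- apply Series_le; auto; intros i; split; [apply Rabs_pos|auto].
Qed.

(** Tannery's theorem: finite sums converge term by term and both tails are dominated by a tail of
    M. The filter is general since both continuity and difference quotients, with punctured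
    neighbourhoods, are needed. *)
Lemma Series_dominated_convergence {T : Type} (F : (T -> Prop) -> Prop) {FF : Filter F}
  (c : T -> nat -> R) (l M : nat -> R) :
  F (fun h => forall i, Rabs (c h i) <= M i) -> ex_series M ->
  (forall i, Rabs (l i) <= M i) ->
  (forall i, filterlim (fun h => c h i) F (locally (l i))) ->
  filterlim (fun h => Series (c h)) F (locally (Series l)).
Proof.
intros hb hM hl hc; apply filterlim_locally; intros e.
assert (he3 : 0 < e / 3) by (pose proof (cond_pos e); lra).
assert (htail : exists N, Series (fun k => M (S N + k)%nat) < e / 3).
{ assert (hlim : is_lim_seq (sum_n M) (Series M)) by exact (Series_correct M hM).
  apply is_lim_seq_spec in hlim; destruct (hlim (mkposreal _ he3)) as [N HN].
  exists N; specialize (HN N (Nat.le_refl N)); simpl in HN.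
  rewrite sum_n_Reals in HN; rewrite (Series_incr_n M (S N)) in HN by (auto; lia).
  simpl pred in HN; apply Rabs_def2 in HN; lra. }
destruct htail as [N hN].
assert (hfin : forall n, filterlim (fun h => sum_f_R0 (c h) n) F (locally (sum_f_R0 l n))).
{ induction n as [|n IH]; simpl; [apply hc|].
  apply (filterlim_comp_2 (H := locally (l (S n))) _ _ Rplus IH (hc (S n))).
  exact (filterlim_plus (sum_f_R0 l n) (l (S n))). }
pose proof (proj1 (filterlim_locally _ _) (hfin N) (mkposreal _ he3)) as hfN.
generalize (filter_and _ _ hb hfN); apply filter_imp; intros h [h1 h2].
change (Rabs (sum_f_R0 (c h) N - sum_f_R0 l N) < e / 3) in h2.
change (Rabs (Series (c h) - Series l) < e).
rewrite (Series_incr_n (c h) (S N)) by (try lia; apply (ex_series_Rle _ M); auto).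
rewrite (Series_incr_n l (S N)) by (try lia; apply (ex_series_Rle _ M); auto).
simpl pred.
assert (exM : ex_series (fun k => M (S N + k)%nat)) by (apply ex_series_incr_n; auto).
assert (b1 : Rabs (Series (fun k => c h (S N + k)%nat)) <= Series (fun k => M (S N + k)%nat))
  by (apply Series_Rabs_le; auto).
assert (b2 : Rabs (Series (fun k => l (S N + k)%nat)) <= Series (fun k => M (S N + k)%nat))
  by (apply Series_Rabs_le; auto).
set (s1 := Series (fun k => c h (S N + k)%nat)) in *.
set (s2 := Series (fun k => l (S N + k)%nat)) in *.
apply Rabs_def2 in h2; apply Rabs_le_between in b1; apply Rabs_le_between in b2.
apply Rabs_def1; lra.
Qed.

(** Analyticity with a single summable majorant on the closed polydisc, and with each row summed
    into a power series in x. Unlike the pointwise condition of [analytic2_at], this form passes to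
    derivatives after shrinking rho. *)
Definition expansion (f : R -> R -> R) (t0 x0 : R) (a : nat -> nat -> R) (rho : R) : Prop :=
  0 < rho /\
  (forall i, ex_series (fun j => Rabs (a i j) * rho ^ i * rho ^ j)) /\
  ex_series (fun i => Series (fun j => Rabs (a i j) * rho ^ i * rho ^ j)) /\
  forall t x, Rabs (t - t0) < rho -> Rabs (x - x0) < rho ->
    f t x = Series (fun i => (t - t0) ^ i * PSeries (a i) (x - x0)).

Lemma monomial_split (a : nat -> nat -> R) (T X : R) (i : nat) :
  Series (fun j => a i j * T ^ i * X ^ j) = T ^ i * PSeries (a i) X.
Proof.
unfold PSeries; rewrite <- Series_scal_l; apply Series_ext; intros j; ring.
Qed.

Lemma Rabs_pow_le (x r : R) (n : nat) : Rabs x <= r -> Rabs (x ^ n) <= r ^ n.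
Proof.
intros h; rewrite <- RPow_abs; apply pow_incr; split; [apply Rabs_pos|exact h].
Qed.

Lemma analytic2_expansion (f : R -> R -> R) (t0 x0 : R) :
  analytic2_at f t0 x0 <-> exists a rho, expansion f t0 x0 a rho.
Proof.
split.
- intros [a [r [hr H]]]; exists a, (r / 2).
  (* Absolute convergence at the corner (t0 + r/2, x0 + r/2) is a majorant for the whole polydisc of
     radius r/2. *)
  assert (h0 : Rabs (t0 + r / 2 - t0) < r).
  { replace (t0 + r / 2 - t0) with (r / 2) by ring; rewrite Rabs_pos_eq; lra. }
  assert (h1 : Rabs (x0 + r / 2 - x0) < r).
  { replace (x0 + r / 2 - x0) with (r / 2) by ring; rewrite Rabs_pos_eq; lra. }
  destruct (H _ _ h0 h1) as [k1 [k2 _]].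
  assert (heq : forall i j, Rabs (a i j * (t0 + r / 2 - t0) ^ i * (x0 + r / 2 - x0) ^ j)
      = Rabs (a i j) * (r / 2) ^ i * (r / 2) ^ j).
  { intros i j.
    replace (t0 + r / 2 - t0) with (r / 2) by ring.
    replace (x0 + r / 2 - x0) with (r / 2) by ring.
    rewrite !Rabs_mult, <- !RPow_abs, (Rabs_pos_eq (r / 2)) by lra; reflexivity. }
  split; [lra|split; [|split]].
  + intros i; apply (ex_series_ext _ _ (heq i)); apply k1.
  + refine (ex_series_ext _ _ _ k2); intros i; apply Series_ext; apply heq.
  + intros t x ht hx; destruct (H t x) as [_ [_ e]]; [lra|lra|].
    rewrite e; apply Series_ext; intros i; apply monomial_split.
- intros [a [r [hr [h1 [h2 h3]]]]]; exists a, r; split; [exact hr|].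
  intros t x ht hx; cbv zeta.
  assert (hb : forall i j, Rabs (Rabs (a i j * (t - t0) ^ i * (x - x0) ^ j))
      <= Rabs (a i j) * r ^ i * r ^ j).
  { intros i j; rewrite Rabs_Rabsolu, !Rabs_mult.
    apply Rmult_le_compat; [apply Rmult_le_pos; apply Rabs_pos|apply Rabs_pos| |].
    - apply Rmult_le_compat_l; [apply Rabs_pos|apply Rabs_pow_le; lra].
    - apply Rabs_pow_le; lra. }
  split; [|split].
  + intros i; exact (ex_series_Rle _ _ (hb i) (h1 i)).
  + refine (ex_series_Rle _ _ _ h2); intros i; apply Series_Rabs_le; auto.
  + rewrite (h3 t x ht hx); apply Series_ext; intros i; symmetry; apply monomial_split.
Qed.

Lemma INR_le_pow2 (n : nat) : INR (S n) * (/ 2) ^ n <= 1.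
Proof.
induction n as [|n IH]; [simpl; lra|].
rewrite S_INR, <- tech_pow_Rmult.
assert (0 < (/ 2) ^ n) by (apply pow_lt; lra).
pose proof (pos_INR n); rewrite S_INR in *; nra.
Qed.

(** Halving the radius pays for the factor n + 1 of a derivative, because (n + 1) 2^(-n) <= 1. *)
Lemma derived_coeff_le (b rho : R) (n : nat) : 0 < rho ->
  Rabs (INR (S n) * b) * (rho / 2) ^ n <= Rabs b * rho ^ S n / rho.
Proof.
intros hr; rewrite Rabs_mult, (Rabs_pos_eq (INR (S n))) by apply pos_INR.
unfold Rdiv at 1; rewrite Rpow_mult_distr.
replace (Rabs b * rho ^ S n / rho) with (1 * (Rabs b * rho ^ n)) by (simpl; field; lra).
replace (INR (S n) * Rabs b * (rho ^ n * (/ 2) ^ n))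
  with (INR (S n) * (/ 2) ^ n * (Rabs b * rho ^ n)) by ring.
apply Rmult_le_compat_r; [|apply INR_le_pow2].
apply Rmult_le_pos; [apply Rabs_pos|left; apply pow_lt; exact hr].
Qed.

Lemma term_le_Series (u : nat -> R) (i : nat) :
  (forall k, 0 <= u k) -> ex_series u -> u i <= Series u.
Proof.
intros hp hu.
assert (hle : u i <= sum_f_R0 u i).
{ destruct i as [|i]; simpl; [lra|]; pose proof (cond_pos_sum u i hp); lra. }
rewrite (Series_incr_n u (S i)) by (auto; lia); simpl pred.
assert (0 <= Series (fun k => u (S i + k)%nat)).
{ rewrite <- (Rmult_0_l (Series (fun k => u (S i + k)%nat))), <- Series_scal_l.
  apply Series_le; [|apply ex_series_incr_n; auto].
  intros k; split; [lra|rewrite Rmult_0_l; auto]. }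
lra.
Qed.

Lemma CV_radius_gt (c : nat -> R) (rho M x : R) : 0 < rho ->
  (forall n, Rabs (c n) * rho ^ n <= M) -> Rabs x < rho -> Rbar_lt (Rabs x) (CV_radius c).
Proof.
intros hr h hx; apply Rbar_lt_le_trans with (Finite rho); [exact hx|].
apply (proj1 (CV_radius_bounded c)); exists M; intros n.
rewrite Rabs_mult, <- RPow_abs, (Rabs_pos_eq rho) by lra; apply h.
Qed.

Section Expansion.
Variables (f : R -> R -> R) (t0 x0 rho : R) (a : nat -> nat -> R).
Hypothesis hf : expansion f t0 x0 a rho.

Let al i j := Rabs (a i j) * rho ^ i * rho ^ j.
Let A i := Series (al i).

Lemma expansion_term_pos i j : 0 <= al i j.
Proof.
destruct hf as [hr _]; unfold al.
repeat apply Rmult_le_pos; [apply Rabs_pos|left; apply pow_lt; exact hr|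
  left; apply pow_lt; exact hr].
Qed.

Lemma expansion_row_pos i : 0 <= A i.
Proof.
destruct hf as [_ [h1 _]].
apply Rle_trans with (al i 0%nat); [apply expansion_term_pos|].
apply term_le_Series; [apply expansion_term_pos|apply h1].
Qed.

Lemma expansion_row_bound i X : Rabs X <= rho -> Rabs (PSeries (a i) X) * rho ^ i <= A i.
Proof.
destruct hf as [hr [h1 _]]; intros hX.
rewrite <- (Rabs_pos_eq (rho ^ i)) by (left; apply pow_lt; exact hr).
rewrite <- Rabs_mult, Rmult_comm, <- monomial_split.
apply Series_Rabs_le; [|apply h1].
intros j; unfold al; rewrite !Rabs_mult, (Rabs_pos_eq (rho ^ i))
  by (left; apply pow_lt; exact hr).
apply Rmult_le_compat_l; [|apply Rabs_pow_le; exact hX].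
apply Rmult_le_pos; [apply Rabs_pos|left; apply pow_lt; exact hr].
Qed.

Lemma expansion_row_derive i X : Rabs X < rho ->
  is_derive (PSeries (a i)) X (PSeries (PS_derive (a i)) X).
Proof.
destruct hf as [hr [h1 _]]; intros hX; apply is_derive_PSeries.
apply (CV_radius_gt _ rho (A i / rho ^ i)); auto.
intros j; assert (hp : 0 < rho ^ i) by (apply pow_lt; exact hr).
apply Rmult_le_reg_r with (rho ^ i); auto.
replace (A i / rho ^ i * rho ^ i) with (A i) by (field; lra).
replace (Rabs (a i j) * rho ^ j * rho ^ i) with (al i j) by (unfold al; ring).
apply term_le_Series; [apply expansion_term_pos|apply h1].
Qed.

Lemma expansion_row_derive_bound i X : Rabs X <= rho / 2 ->
  Rabs (PSeries (PS_derive (a i)) X) * rho ^ i <= A i / rho.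
Proof.
destruct hf as [hr [h1 _]]; intros hX.
assert (hp : 0 < rho ^ i) by (apply pow_lt; exact hr).
rewrite <- (Rabs_pos_eq (rho ^ i)), <- Rabs_mult by lra; unfold PSeries.
rewrite <- Series_scal_r.
assert (hex : ex_series (fun j => al i (S j))) by (apply (ex_series_incr_1 (al i)); apply h1).
apply Rle_trans with (Series (fun j => al i (S j) * / rho)).
- apply Series_Rabs_le.
  + intros j; rewrite !Rabs_mult, (Rabs_pos_eq (rho ^ i)) by lra; unfold PS_derive, al.
    apply Rle_trans with (Rabs (INR (S j) * a i (S j)) * (rho / 2) ^ j * rho ^ i).
    * apply Rmult_le_compat_r; [lra|].
      rewrite <- Rabs_mult; rewrite Rabs_mult; apply Rmult_le_compat_l; [apply Rabs_pos|].
      apply Rabs_pow_le; exact hX.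
    * replace (Rabs (a i (S j)) * rho ^ i * rho ^ S j * / rho)
        with (Rabs (a i (S j)) * rho ^ S j / rho * rho ^ i) by (unfold Rdiv; ring).
      apply Rmult_le_compat_r; [lra|apply derived_coeff_le; exact hr].
  + apply (ex_series_scal_r (/ rho)); exact hex.
- rewrite Series_scal_r; apply Rmult_le_compat_r; [left; apply Rinv_0_lt_compat; exact hr|].
  unfold A; rewrite (Series_incr_1 (al i)) by apply h1.
  pose proof (expansion_term_pos i 0%nat); lra.
Qed.

(** For fixed x the expansion is an ordinary power series in t - t0 with coefficients depending on
    x, so it may be differentiated termwise. *)
Lemma expansion_dt_formula t x : Rabs (t - t0) < rho -> Rabs (x - x0) < rho ->
  is_derive (fun s => f s x) t
   (PSeries (PS_derive (fun i => PSeries (a i) (x - x0))) (t - t0)).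
Proof.
destruct hf as [hr [h1 [h2 h3]]]; intros ht hx.
apply (is_derive_ext_loc (fun s => PSeries (fun i => PSeries (a i) (x - x0)) (s - t0))).
- assert (hd : 0 < rho - Rabs (t - t0)) by lra.
  exists (mkposreal _ hd); intros s hs.
  change (Rabs (s - t) < rho - Rabs (t - t0)) in hs.
  rewrite (h3 s x); [|replace (s - t0) with ((s - t) + (t - t0)) by ring;
    eapply Rle_lt_trans; [apply Rabs_triang|lra]|exact hx].
  unfold PSeries at 1; apply Series_ext; intros i; apply Rmult_comm.
- replace (PSeries (PS_derive (fun i => PSeries (a i) (x - x0))) (t - t0))
   with (1 * PSeries (PS_derive (fun i => PSeries (a i) (x - x0))) (t - t0)) by ring.
  apply (is_derive_comp (PSeries (fun i => PSeries (a i) (x - x0))) (fun s => s - t0)).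
  + apply is_derive_PSeries.
    apply (CV_radius_gt _ rho (Series A)); auto.
    intros n; eapply Rle_trans; [apply expansion_row_bound; lra|].
    apply term_le_Series; [apply expansion_row_pos|exact h2].
  + auto_derive; auto.
Qed.

Lemma expansion_dt :
  expansion (dt f) t0 x0 (fun i j => INR (S i) * a (S i) j) (rho / 2).
Proof.
destruct hf as [hr [h1 [h2 h3]]].
assert (hb : forall i j, Rabs (INR (S i) * a (S i) j) * (rho / 2) ^ i * (rho / 2) ^ j
   <= al (S i) j * / rho).
{ intros i j; unfold al.
  replace (Rabs (a (S i) j) * rho ^ S i * rho ^ j * / rho)
    with (Rabs (a (S i) j) * rho ^ S i / rho * rho ^ j) by (unfold Rdiv; ring).
  apply Rmult_le_compat; [apply Rmult_le_pos; [apply Rabs_pos|]|..].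
  - left; apply pow_lt; lra.
  - left; apply pow_lt; lra.
  - apply derived_coeff_le; exact hr.
  - apply pow_incr; lra. }
assert (hb' : forall i j, Rabs (Rabs (INR (S i) * a (S i) j) * (rho / 2) ^ i * (rho / 2) ^ j)
   <= al (S i) j * / rho).
{ intros i j; rewrite Rabs_pos_eq; [apply hb|].
  repeat apply Rmult_le_pos; [apply Rabs_pos|left; apply pow_lt; lra|left; apply pow_lt; lra]. }
assert (hs : forall i, ex_series (fun j => al (S i) j * / rho)).
{ intros i; apply (ex_series_scal_r (/ rho)); apply h1. }
split; [lra|split; [|split]].
- intros i; exact (ex_series_Rle _ _ (hb' i) (hs i)).
- apply (ex_series_Rle _ (fun i => A (S i) * / rho)).
  + intros i; unfold A; rewrite <- Series_scal_r; apply Series_Rabs_le; auto.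
  + apply (ex_series_scal_r (/ rho)); apply (ex_series_incr_1 A); exact h2.
- intros t x ht hx.
  assert (e : dt f t x = PSeries (PS_derive (fun i => PSeries (a i) (x - x0))) (t - t0))
    by (apply is_derive_unique; apply expansion_dt_formula; lra).
  rewrite e; unfold PSeries at 1, PS_derive; apply Series_ext; intros i.
  rewrite Rmult_comm; f_equal.
  unfold PSeries; rewrite <- Series_scal_l; apply Series_ext; intros j; ring.
Qed.

(** Here x sits inside every row, and no single power series is differentiated. The difference
    quotients of the rows are dominated through the mean value theorem, and the limit is taken under
    the sum. *)
Lemma expansion_dx_formula t x : Rabs (t - t0) < rho / 2 -> Rabs (x - x0) < rho / 2 ->
  is_derive (fun y => f t y) x
   (Series (fun i => (t - t0) ^ i * PSeries (PS_derive (a i)) (x - x0))).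
Proof.
destruct hf as [hr [h1 [h2 h3]]]; intros ht hx.
set (T := t - t0) in *; set (X := x - x0) in *.
set (u := fun i y => T ^ i * PSeries (a i) (y - x0)).
set (u' := fun i y => T ^ i * PSeries (PS_derive (a i)) (y - x0)).
assert (hT : forall i, Rabs (T ^ i) <= rho ^ i) by (intros; apply Rabs_pow_le; lra).
assert (hu' : forall i y, Rabs (y - x0) < rho / 2 -> Rabs (u' i y) <= A i * / rho).
{ intros i y hy; unfold u'; rewrite Rabs_mult, Rmult_comm.
  eapply Rle_trans; [|apply (expansion_row_derive_bound i (y - x0)); lra].
  apply Rmult_le_compat_l; [apply Rabs_pos|apply hT]. }
assert (hdu : forall i y, Rabs (y - x0) < rho / 2 -> is_derive (u i) y (u' i y)).
{ intros i y hy; apply (is_derive_scal (fun y => PSeries (a i) (y - x0))).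
  replace (PSeries (PS_derive (a i)) (y - x0)) with (1 * PSeries (PS_derive (a i)) (y - x0))
   by ring.
  apply (is_derive_comp (PSeries (a i)) (fun y => y - x0)).
  - apply expansion_row_derive; lra.
  - auto_derive; auto. }
assert (hexu : forall y, Rabs (y - x0) < rho / 2 -> ex_series (fun i => u i y)).
{ intros y hy; apply (ex_series_Rle _ A); [|exact h2].
  intros i; unfold u; rewrite Rabs_mult, Rmult_comm.
  eapply Rle_trans; [|apply (expansion_row_bound i (y - x0)); lra].
  apply Rmult_le_compat_l; [apply Rabs_pos|apply hT]. }
assert (hd : 0 < rho / 2 - Rabs X) by lra.
assert (hnear : forall y, Rabs (y - x) < rho / 2 - Rabs X -> Rabs (y - x0) < rho / 2).
{ intros y hy; replace (y - x0) with ((y - x) + X) by (unfold X; ring).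
  eapply Rle_lt_trans; [apply Rabs_triang|lra]. }
assert (hxh : forall h, x + h - x = h) by (intros; ring).
assert (hquot : forall c h, h <> 0 -> c * (x + h - x) / h = c) by (intros; field; auto).
apply is_derive_Reals; intros e he.
assert (hlim : filterlim (fun h => Series (fun i => (u i (x + h) - u i x) / h)) (locally' 0)
   (locally (Series (fun i => u' i x)))).
{ apply (Series_dominated_convergence (locally' 0) (fun h i => (u i (x + h) - u i x) / h) _
     (fun i => A i * / rho)).
  - exists (mkposreal _ hd); intros h hh hne i; change (Rabs (h - 0) < rho / 2 - Rabs X) in hh.
    rewrite Rminus_0_r in hh.
    destruct (mvt_segment (u i) (u' i) x (x + h)) as [v [hv ev]].
    + intros v hv; apply hdu; apply hnear.
      apply (between_dist x (x + h)) in hv; rewrite hxh in hv; lra.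
    + rewrite ev, hquot by exact hne.
      apply hu'; apply hnear.
      apply (between_dist x (x + h)) in hv; rewrite hxh in hv; lra.
  - apply (ex_series_scal_r (/ rho)); exact h2.
  - intros i; apply hu'; exact hx.
  - intros i; apply filterlim_locally; intros e'.
    pose proof (proj1 (is_derive_Reals _ _ _) (hdu i x hx) e' (cond_pos e')) as [r Hr].
    exists r; intros h hh hne; change (Rabs (h - 0) < r) in hh; rewrite Rminus_0_r in hh.
    exact (Hr h hne hh). }
destruct (proj1 (filterlim_locally _ _) hlim (mkposreal e he)) as [r Hr].
assert (hm : 0 < Rmin r (rho / 2 - Rabs X)) by (apply Rmin_pos; [apply cond_pos|exact hd]).
exists (mkposreal _ hm); intros h hne hh; simpl in hh.
pose proof (Rmin_l r (rho / 2 - Rabs X)); pose proof (Rmin_r r (rho / 2 - Rabs X)).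
assert (hy : Rabs (x + h - x0) < rho / 2)
  by (apply hnear; replace (x + h - x) with h by ring; lra).
assert (hb : ball 0 r h) by (change (Rabs (h - 0) < r); rewrite Rminus_0_r; lra).
pose proof (Hr h hb hne) as hk.
change (Rabs (Series (fun i => (u i (x + h) - u i x) / h) - Series (fun i => u' i x)) < e) in hk.
unfold T in ht.
rewrite (h3 t (x + h)), (h3 t x) by (fold X; lra).
unfold Rdiv in hk; rewrite Series_scal_r, Series_minus in hk by (apply hexu; auto).
exact hk.
Qed.

Lemma expansion_dx :
  expansion (dx f) t0 x0 (fun i j => PS_derive (a i) j) (rho / 2).
Proof.
destruct hf as [hr [h1 [h2 h3]]].
assert (hb : forall i j, Rabs (PS_derive (a i) j) * (rho / 2) ^ i * (rho / 2) ^ j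
   <= al i (S j) * / rho).
{ intros i j; unfold al, PS_derive.
  replace (Rabs (a i (S j)) * rho ^ i * rho ^ S j * / rho)
    with (Rabs (a i (S j)) * rho ^ S j / rho * rho ^ i) by (unfold Rdiv; ring).
  replace (Rabs (INR (S j) * a i (S j)) * (rho / 2) ^ i * (rho / 2) ^ j)
    with (Rabs (INR (S j) * a i (S j)) * (rho / 2) ^ j * (rho / 2) ^ i) by ring.
  apply Rmult_le_compat; [apply Rmult_le_pos; [apply Rabs_pos|]|..].
  - left; apply pow_lt; lra.
  - left; apply pow_lt; lra.
  - apply derived_coeff_le; exact hr.
  - apply pow_incr; lra. }
assert (hb' : forall i j, Rabs (Rabs (PS_derive (a i) j) * (rho / 2) ^ i * (rho / 2) ^ j)
   <= al i (S j) * / rho).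
{ intros i j; rewrite Rabs_pos_eq; [apply hb|].
  repeat apply Rmult_le_pos; [apply Rabs_pos|left; apply pow_lt; lra|left; apply pow_lt; lra]. }
assert (hs0 : forall i, ex_series (fun j => al i (S j)))
  by (intros i; apply (ex_series_incr_1 (al i)); apply h1).
assert (hs : forall i, ex_series (fun j => al i (S j) * / rho)).
{ intros i; apply (ex_series_scal_r (/ rho)); apply hs0. }
split; [lra|split; [|split]].
- intros i; exact (ex_series_Rle _ _ (hb' i) (hs i)).
- apply (ex_series_Rle _ (fun i => A i * / rho)).
  + intros i.
    apply Rle_trans with (Series (fun j => al i (S j) * / rho)); [apply Series_Rabs_le; auto|].
    rewrite Series_scal_r; apply Rmult_le_compat_r; [left; apply Rinv_0_lt_compat; exact hr|].
    unfold A; rewrite (Series_incr_1 (al i)) by apply h1.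
    pose proof (expansion_term_pos i 0%nat); lra.
  + apply (ex_series_scal_r (/ rho)); exact h2.
- intros t x ht hx; exact (is_derive_unique _ _ _ (expansion_dx_formula t x ht hx)).
Qed.

(** Continuity at the centre is enough, since an analytic function has an expansion around each
    point of the open set. *)
Lemma expansion_continuous : continuous (fun q : R * R => f (fst q) (snd q)) (t0, x0).
Proof.
destruct hf as [hr [h1 [h2 h3]]].
assert (hloc : locally ((t0, x0) : R * R)
   (fun q => Rabs (fst q - t0) < rho /\ Rabs (snd q - x0) < rho)).
{ exists (mkposreal rho hr); intros q [k1 k2]; split; assumption. }
assert (z : forall y, Rabs (y - y) < rho) by (intros; rewrite Rminus_diag, Rabs_R0; exact hr).
unfold continuous; simpl; rewrite (h3 t0 x0 (z _) (z _)).
apply (filterlim_ext_loc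
  (fun q : R * R => Series (fun i => (fst q - t0) ^ i * PSeries (a i) (snd q - x0)))).
{ revert hloc; apply filter_imp; intros q [k1 k2]; symmetry; apply h3; assumption. }
assert (hbd : forall i t x, Rabs (t - t0) < rho -> Rabs (x - x0) < rho ->
   Rabs ((t - t0) ^ i * PSeries (a i) (x - x0)) <= A i).
{ intros i t x ht hx; rewrite Rabs_mult, Rmult_comm.
  eapply Rle_trans; [|apply (expansion_row_bound i (x - x0)); lra].
  apply Rmult_le_compat_l; [apply Rabs_pos|apply Rabs_pow_le; lra]. }
apply (Series_dominated_convergence (locally ((t0, x0) : R * R))
  (fun q i => (fst q - t0) ^ i * PSeries (a i) (snd q - x0)) _ A); auto.
- revert hloc; apply filter_imp; intros q [k1 k2] i; apply hbd; assumption.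
- intros i.
  apply (continuous_mult (fun q : R * R => (fst q - t0) ^ i)
           (fun q : R * R => PSeries (a i) (snd q - x0)) (t0, x0)).
  + apply (continuous_comp (fun q : R * R => fst q) (fun t => (t - t0) ^ i)).
    * apply continuous_fst.
    * apply (ex_derive_continuous (fun t => (t - t0) ^ i)); auto_derive; auto.
  + apply (continuous_comp (fun q : R * R => snd q) (fun x => PSeries (a i) (x - x0))).
    * apply continuous_snd.
    * apply (continuous_comp (fun x => x - x0) (PSeries (a i))).
      -- apply (ex_derive_continuous (fun x => x - x0)); auto_derive; auto.
      -- apply (ex_derive_continuous (PSeries (a i))); eexists; apply expansion_row_derive.
         apply z.
Qed.

End Expansion.

(** The radius is halved at every derivative, but at each point only a finite list of derivatives is
    considered. *)
Lemma analytic2_smooth2 (W : R * R -> Prop) (f : R -> R -> R) :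
  (forall t x, W (t, x) -> analytic2_at f t x) -> smooth2_on W f.
Proof.
intros h l t x hw; cbv zeta.
assert (hg : exists a rho, expansion (fold_right pd2 f l) t x a rho).
{ induction l as [|d l [a [r IH]]].
  - apply analytic2_expansion; auto.
  - destruct d.
    + exists (fun i j => INR (S i) * a (S i) j), (r / 2); exact (expansion_dt _ _ _ _ _ IH).
    + exists (fun i j => PS_derive (a i) j), (r / 2); exact (expansion_dx _ _ _ _ _ IH). }
destruct hg as [a [r hg]].
assert (hr : 0 < r) by apply hg.
assert (z : forall y r, 0 < r -> Rabs (y - y) < r)
  by (intros; rewrite Rminus_diag, Rabs_R0; assumption).
split; [exact (expansion_continuous _ _ _ _ _ hg)|split].
- eexists; exact (expansion_dt_formula _ _ _ _ _ hg t x (z _ _ hr) (z _ _ hr)).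
- eexists; apply (expansion_dx_formula _ _ _ _ _ hg t x); apply z; lra.
Qed.

(** * Propagation of zeros and the flow of the base vector field *)

(** Connectedness of the unit interval: g vanishes at the supremum m of the initial segments of
    zeros by continuity, and local propagation would carry the segment past m unless m = 1. *)
Lemma zero_unit_interval (g : R -> R) :
  g 0 = 0 -> (forall v, 0 <= v <= 1 -> continuous g v) ->
  (forall v, 0 <= v <= 1 -> g v = 0 -> locally v (fun r => g r = 0)) -> g 1 = 0.
Proof.
intros h0 hc hl.
set (E := fun u => 0 <= u <= 1 /\ forall v, 0 <= v <= u -> g v = 0).
destruct (completeness E) as [m [hub hlub]].
- exists 1; intros u [hu _]; lra.
- exists 0; split; [lra|]; intros v hv; replace v with 0 by lra; exact h0.
- assert (hm0 : 0 <= m).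
  { apply hub; split; [lra|]; intros v hv; replace v with 0 by lra; exact h0. }
  assert (hm1 : m <= 1) by (apply hlub; intros u [hu _]; lra).
  assert (hlt : forall v, 0 <= v < m -> g v = 0).
  { intros v hv; apply NNPP; intros hne.
    assert (m <= v); [|lra].
    apply hlub; intros u [hu1 hu2]; apply Rnot_lt_le; intros hvu.
    apply hne; apply hu2; lra. }
  assert (hgm : g m = 0).
  { destruct (Req_dec m 0) as [e|hne0]; [rewrite e; exact h0|].
    assert (hmp : 0 < m) by (destruct hm0; [assumption|exfalso; auto]).
    apply NNPP; intros hne.
    assert (hp : 0 < Rabs (g m)) by (apply Rabs_pos_lt; exact hne).
    destruct (proj1 (filterlim_locally _ _) (hc m (conj hm0 hm1)) (mkposreal _ hp)) as [d Hd].
    pose proof (cond_pos d).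
    (* A zero just before m, contradicting that |g| would stay positive near m. *)
    set (v := Rmax 0 (m - d / 2)).
    assert (hv : 0 <= v < m /\ m - d / 2 <= v).
    { unfold v; split; [split; [apply Rmax_l|apply Rmax_lub_lt; lra]|apply Rmax_r]. }
    assert (hb : ball m d v) by (change (Rabs (v - m) < d); apply Rabs_def1; lra).
    pose proof (Hd v hb) as k; change (Rabs (g v - g m) < Rabs (g m)) in k.
    rewrite (hlt v) in k by apply hv.
    unfold Rminus in k; rewrite Rplus_0_l, Rabs_Ropp in k; lra. }
  destruct (hl m (conj hm0 hm1) hgm) as [d Hd]; pose proof (cond_pos d).
  set (u := Rmin 1 (m + d / 2)).
  assert (hE : E u).
  { assert (u <= 1 /\ u <= m + d / 2) as [u1 u2] by (split; [apply Rmin_l|apply Rmin_r]).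
    assert (0 <= u) by (apply Rmin_glb; lra).
    split; [lra|]; intros v hv; destruct (Rlt_le_dec v m) as [h|h]; [apply hlt; lra|].
    apply Hd; change (Rabs (v - m) < d); apply Rabs_def1; lra. }
  destruct (Req_dec m 1) as [e|hne]; [rewrite <- e; exact hgm|].
  pose proof (hub u hE) as k; unfold u, Rmin in k; destruct Rle_dec in k; lra.
Qed.

(* Zeros of [w] propagate, although the differential inequality is only known near
   zeros of [w]: the zero set is closed, and open by Gronwall. *)
Lemma propagate_zero (w w' : R -> R) (dl : R) : w 0 = 0 ->
  (forall s, Rabs s < dl -> is_derive w s (w' s)) ->
  (forall s, Rabs s < dl -> w s = 0 -> exists L, 0 <= L /\
     locally s (fun r => Rabs (w' r) <= L * Rabs (w r))) ->
  forall s, Rabs s < dl -> w s = 0.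
Proof.
intros h0 hd hl s hs.
assert (hin : forall v, 0 <= v <= 1 -> Rabs (v * s) < dl).
{ intros v hv; rewrite Rabs_mult, (Rabs_pos_eq v) by lra.
  apply Rle_lt_trans with (1 * Rabs s); [|lra].
  apply Rmult_le_compat_r; [apply Rabs_pos|lra]. }
assert (hcv : forall v, continuous (fun r => r * s) v).
{ intros v; apply (ex_derive_continuous (fun r => r * s)); auto_derive; auto. }
(* The segment from 0 to s is rescaled to the unit interval, which treats both signs of s
   together. *)
rewrite <- (Rmult_1_l s); apply (zero_unit_interval (fun v => w (v * s))).
- rewrite Rmult_0_l; exact h0.
- intros v hv; apply (continuous_comp (fun r => r * s) w); auto.
  apply (ex_derive_continuous w); eexists; apply hd; auto.
- intros v hv hz; apply (hcv v (fun r => w r = 0)).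
  destruct (hl _ (hin v hv) hz) as [L [hL [d Hd]]].
  set (a := v * s) in *.
  assert (ha : Rabs a < dl) by (apply hin; auto).
  (* The three bounds keep the segment where the inequality holds, where w is differentiable, and
     short enough for Gronwall with constant L. *)
  set (e := Rmin (Rmin d (dl - Rabs a)) (/ (2 * (L + 1)))).
  assert (he : 0 < e).
  { unfold e; repeat apply Rmin_pos; [apply cond_pos|lra|apply Rinv_0_lt_compat; lra]. }
  assert (e <= d /\ e <= dl - Rabs a /\ e <= / (2 * (L + 1))) as [e1 [e2 e3]].
  { pose proof (Rmin_l (Rmin d (dl - Rabs a)) (/ (2 * (L + 1))));
    pose proof (Rmin_r (Rmin d (dl - Rabs a)) (/ (2 * (L + 1))));
    pose proof (Rmin_l d (dl - Rabs a)); pose proof (Rmin_r d (dl - Rabs a));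
    unfold e; lra. }
  exists (mkposreal e he); intros r hr; change (Rabs (r - a) < e) in hr.
  assert (hb : Rabs (w r) <= 2 * 0 * Rabs (r - a)).
  { apply (gronwall_short w w' a r 0 L); auto; try lra.
    - intros q hq; apply hd; apply between_dist in hq.
      replace q with ((q - a) + a) by ring.
      eapply Rle_lt_trans; [apply Rabs_triang|lra].
    - apply Rle_trans with ((L + 1) * e).
      + apply Rmult_le_compat; try lra; apply Rabs_pos.
      + apply Rle_trans with ((L + 1) * (/ (2 * (L + 1)))); [apply Rmult_le_compat_l; lra|].
        right; field; lra.
    - intros q hq; rewrite Rplus_0_l; apply Hd; apply between_dist in hq.
      change (Rabs (q - a) < d); lra. }
  rewrite Rmult_0_r, Rmult_0_l in hb; pose proof (Rabs_pos (w r)).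
  apply Rabs_eq_0; lra.
Qed.

Lemma lipschitz2 (f : R -> R -> R -> R) (a b c : R) : C1at f a b c ->
  exists L d, 0 <= L /\ 0 < d /\ forall x y y', Rabs (x - a) < d -> Rabs (y - b) < d ->
    Rabs (y' - b) < d -> Rabs (f x y c - f x y' c) <= L * Rabs (y - y').
Proof.
intros [hex [_ [hc _]]].
destruct (near3_and _ _ _ _ _ hex (hc 1 Rlt_0_1)) as [d [hd H]].
exists (Rabs (d2 f a b c) + 1), d; split; [pose proof (Rabs_pos (d2 f a b c)); lra|].
split; [exact hd|]; intros x y y' hx hy hy'.
assert (hz : Rabs (c - c) < d) by (rewrite Rminus_diag, Rabs_R0; exact hd).
assert (hv : forall v, between y' y v -> Rabs (v - b) < d).
{ intros v; unfold between, Rmin, Rmax; destruct Rle_dec; intros hv;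
  apply Rabs_def2 in hy; apply Rabs_def2 in hy'; apply Rabs_def1; lra. }
destruct (mvt_segment (fun v => f x v c) (fun v => d2 f x v c) y' y) as [v [k e]].
- intros v k; apply Derive_correct.
  exact (proj1 (proj2 (proj1 (H x v c hx (hv v k) hz)))).
- rewrite e, Rabs_mult; apply Rmult_le_compat_r; [apply Rabs_pos|].
  destruct (H x v c hx (hv v k) hz) as [_ k2].
  replace (d2 f x v c) with ((d2 f x v c - d2 f a b c) + d2 f a b c) by ring.
  eapply Rle_trans; [apply Rabs_triang|lra].
Qed.

(** * Differentiation rules and a tactic applying them *)

Lemma is_derive_eq (f : R -> R) (x l l' : R) : is_derive f x l -> l = l' -> is_derive f x l'.
Proof. intros h <-; exact h. Qed.

Lemma is_derive_Rplus (f g : R -> R) x f' g' :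
  is_derive f x f' -> is_derive g x g' -> is_derive (fun y => f y + g y) x (f' + g').
Proof. exact (is_derive_plus f g x f' g'). Qed.

Lemma is_derive_Rminus (f g : R -> R) x f' g' :
  is_derive f x f' -> is_derive g x g' -> is_derive (fun y => f y - g y) x (f' - g').
Proof. exact (is_derive_minus f g x f' g'). Qed.

Lemma is_derive_continuous (f : R -> R) x l : is_derive f x l -> continuous f x.
Proof. intros h; apply (ex_derive_continuous f); exists l; exact h. Qed.

(** Differentiates sums, differences and products structurally and closes the leaves with
    derivatives found in the context; [derive] leaves the equality of the two values. The derivative
    operators are opaque so that [eassumption] does not unfold them. *)
Ltac derive_step :=
  lazymatch goal with
  | |- is_derive (fun y => Rplus (@?f y) (@?g y)) _ _ => apply (is_derive_Rplus f g)
  | |- is_derive (fun y => Rminus (@?f y) (@?g y)) _ _ => apply (is_derive_Rminus f g)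
  | |- is_derive (fun y => Rmult (@?f y) (@?g y)) _ _ => apply (is_derive_Rmult f g)
  | |- is_derive (fun _ => ?k) _ _ => apply is_derive_Rconst
  | |- is_derive (fun y => y) _ _ => apply is_derive_Rid
  | |- is_derive _ _ _ => with_strategy opaque [Derive d1 d2 d3 dt dx] eassumption
  end.
Ltac derive := eapply is_derive_eq; [repeat derive_step|].

(** Translates to the one-variable derivatives of all orders in which [reparameterization] is
    phrased; the n-th derivative is realized by an iterate of [d3]. *)
Lemma Cinf_ex_derive_n W f a b c n : open3 W -> Cinf W f -> W a b c ->
  ex_derive_n (fun s => f a b s) n c.
Proof.
intros hW hf hw.
assert (hD : forall n, exists g, Cinf W g /\
   forall a b c, W a b c -> Derive_n (fun s => f a b s) n c = g a b c).
{ clear n a b c hw; induction n as [|n [g [hg IH]]]; [exists f; split; auto|].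
  exists (d3 g); split; [exact (Cinf_pd3 W g Dir_3 hg)|].
  intros a b c hw; simpl; apply Derive_ext_loc.
  generalize (near3_slice3 _ _ _ _ (hW a b c hw)); apply filter_imp; auto. }
destruct n as [|n]; [exact I|]; simpl.
destruct (hD n) as [g [hg he]].
apply (ex_derive_ext_loc (fun s => g a b s)).
- generalize (near3_slice3 _ _ _ _ (hW a b c hw)); apply filter_imp.
  intros s hs; symmetry; auto.
- apply (proj1 (proj2 (hg 1%nat)) a b c hw).
Qed.

Lemma box_const (q : R -> R -> R) (t0 x0 d : R) :
  (forall t x, Rabs (t - t0) < d -> Rabs (x - x0) < d ->
     is_derive (fun s => q s x) t 0 /\ is_derive (fun s => q t s) x 0) ->
  forall t x, Rabs (t - t0) < d -> Rabs (x - x0) < d -> q t x = q t0 x0.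
Proof.
intros h t x ht hx.
assert (hd : 0 < d) by (pose proof (Rabs_pos (t - t0)); lra).
assert (z : Rabs (x0 - x0) < d) by (rewrite Rminus_diag, Rabs_R0; exact hd).
destruct (mvt_segment (fun s => q t s) (fun _ => 0) x0 x) as [v [_ e1]].
- intros v hv; exact (proj2 (h t v ht (segment_dist _ _ _ _ hv hx))).
- destruct (mvt_segment (fun s => q s x0) (fun _ => 0) t0 t) as [v' [_ e2]].
  + intros v' hv; exact (proj1 (h v' x0 (segment_dist _ _ _ _ hv ht) z)).
  + lra.
Qed.

(** * Product neighbourhoods and cylinders over the base *)

Lemma locally_4 (P : R * (R * R * R) -> Prop) (e0 t0 x0 u0 : R) :
  locally ((e0, (t0, x0, u0)) : R * (R * R * R)) P <->
  exists d, 0 < d /\ forall e t x u, Rabs (e - e0) < d -> box t0 x0 u0 d t x u ->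
    P (e, (t, x, u)).
Proof.
split.
- intros [d H]; exists d; split; [apply cond_pos|].
  intros e t x u h1 [h2 [h3 h4]]; apply H; repeat split; assumption.
- intros [d [hd H]]; exists (mkposreal d hd).
  intros [e [[t x] u]] [h1 [[h2 h3] h4]]; apply H; [assumption|repeat split; assumption].
Qed.

Lemma locally_3' (P : R * (R * R) -> Prop) (e0 t0 x0 : R) :
  locally ((e0, (t0, x0)) : R * (R * R)) P <->
  exists d, 0 < d /\ forall e t x, Rabs (e - e0) < d -> Rabs (t - t0) < d ->
    Rabs (x - x0) < d -> P (e, (t, x)).
Proof.
split.
- intros [d H]; exists d; split; [apply cond_pos|].
  intros e t x h1 h2 h3; apply H; repeat split; assumption.
- intros [d [hd H]]; exists (mkposreal d hd).
  intros [e [t x]] [h1 [h2 h3]]; apply H; assumption.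
Qed.

Lemma locally_2 (P : R * R -> Prop) (t0 x0 : R) :
  locally ((t0, x0) : R * R) P <->
  exists d, 0 < d /\ forall t x, Rabs (t - t0) < d -> Rabs (x - x0) < d -> P (t, x).
Proof.
split.
- intros [d H]; exists d; split; [apply cond_pos|].
  intros t x h2 h3; apply H; repeat split; assumption.
- intros [d [hd H]]; exists (mkposreal d hd).
  intros [t x] [h2 h3]; apply H; assumption.
Qed.

Lemma locally_3 (P : R * R * R -> Prop) (t0 x0 u0 : R) :
  locally ((t0, x0, u0) : R * R * R) P <->
  exists d, 0 < d /\ forall t x u, box t0 x0 u0 d t x u -> P (t, x, u).
Proof. rewrite near3_locally; apply box_near. Qed.

(** The cylinder over the base domain, on which coefficients depending on (t, x) become functions of
    three variables. *)
Definition over (Om : R * R -> Prop) (a b _ : R) : Prop := Om (a, b).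

Lemma open3_over Om : open Om -> open3 (over Om).
Proof.
intros h a b c hw; destruct (h _ hw) as [d H].
exists d; split; [apply cond_pos|]; intros x y z h1 h2 _; apply (H (x, y)); split; assumption.
Qed.

Lemma over_box Om t0 x0 u0 : open Om -> Om (t0, x0) ->
  exists d, 0 < d /\ forall t x u, box t0 x0 u0 d t x u -> Om (t, x).
Proof.
intros h hp; exact (proj1 (box_near t0 x0 u0 _) (open3_over Om h t0 x0 u0 hp)).
Qed.

(** The base field is triangular: first the scalar equation for T, then, with T inserted, the scalar
    equation for X with t as parameter. Slots are ordered (t, e, x), so that e is the time of
    [ode_smooth]. *)
Lemma flow_exists (Om : R * R -> Prop) (Q : operator) (t0 x0 : R) :
  open Om -> Om (t0, x0) ->
  Cinf (over Om) (fun a _ _ => tau Q a) -> Cinf (over Om) (fun a b _ => xi Q a b) ->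
  exists dl T X, 0 < dl /\
    Cinf (box t0 0 x0 dl) (fun t e _ => T e t) /\ Cinf (box t0 0 x0 dl) (fun t e x => X e t x) /\
    (forall t e x, box t0 0 x0 dl t e x -> Om (T e t, X e t x) /\
       is_derive (fun s => T s t) e (tau Q (T e t)) /\
       is_derive (fun s => X s t x) e (xi Q (T e t) (X e t x))) /\
    (forall t x, box t0 0 x0 dl t 0 x -> T 0 t = t /\ X 0 t x = x).
Proof.
intros hOm hp htau hxi.
destruct (over_box Om t0 x0 0 hOm hp) as [d [hd Hd]].
assert (z : forall a r, 0 < r -> Rabs (a - a) < r)
  by (intros; rewrite Rminus_diag, Rabs_R0; assumption).
assert (hOd : forall a b, Rabs (a - t0) < d -> Rabs (b - x0) < d -> Om (a, b)).
{ intros a b h1 h2; apply (Hd a b 0); repeat split; auto. }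
assert (hWo := open3_over Om hOm).
(* The equation for T has no parameter; the first slot is a dummy, always evaluated at 0. *)
destruct (ode_smooth (fun _ _ y => tau Q y) 0 0 t0 d hd) as [r1 [Y1 [hr1 [_ [hY1 [dY1 iY1]]]]]].
{ intros n; apply (Ck_comp n _ (over Om) (fun a _ _ => tau Q a) (fun _ _ y => y)
    (fun _ _ _ => x0) (fun _ _ _ => 0)); auto using open3_box.
  - apply Ck_trd; apply open3_box.
  - apply Ck_const; apply open3_box.
  - apply Ck_const; apply open3_box.
  - intros a b c [_ [_ h3]]; apply hOd; auto. }
assert (hT0 : Y1 0 0 t0 = t0) by (apply iY1; apply box_center; exact hr1).
assert (hT : forall n, Ck n (box t0 0 x0 r1) (fun t e _ => Y1 0 e t)).
{ intros n; apply (Ck_comp n _ (box 0 0 t0 r1) Y1 (fun _ _ _ => 0) (fun _ e _ => e)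
    (fun t _ _ => t)); auto using open3_box.
  - apply Ck_const; apply open3_box.
  - apply Ck_snd; apply open3_box.
  - apply Ck_fst; apply open3_box.
  - intros t e x [h1 [h2 h3]]; repeat split; auto. }
assert (hc : cont3 (fun t e _ => Y1 0 e t) t0 0 x0)
  by (apply (Ck_C0 0 _ _ _ _ _ (hT 0%nat)); apply box_center; exact hr1).
destruct (proj1 (box_near _ _ _ _) (near3_and _ _ _ _ _ (hc d hd)
   (near3_box t0 0 x0 (Rmin d r1) (Rmin_pos _ _ hd hr1)))) as [r2 [hr2 H2]].
assert (H2' : forall t e x, box t0 0 x0 r2 t e x ->
   Rabs (Y1 0 e t - t0) < d /\ box t0 0 x0 r1 t e x /\ Rabs (x - x0) < d).
{ intros t e x hb; destruct (H2 t e x hb) as [k1 [k2 [k3 k4]]].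
  rewrite hT0 in k1; pose proof (Rmin_l d r1); pose proof (Rmin_r d r1).
  split; [exact k1|split; [repeat split; lra|lra]]. }
destruct (ode_smooth (fun t e y => xi Q (Y1 0 e t) y) t0 0 x0 r2 hr2)
  as [r3 [Y2 [hr3 [hr32 [hY2 [dY2 iY2]]]]]].
{ intros n; apply (Ck_comp n _ (over Om) (fun a b _ => xi Q a b) (fun t e _ => Y1 0 e t)
    (fun _ _ y => y) (fun _ _ _ => 0)); auto using open3_box.
  - apply (Ck_sub n (box t0 0 x0 r1)); auto; intros a b c h; apply (H2' a b c h).
  - apply Ck_trd; apply open3_box.
  - apply Ck_const; apply open3_box.
  - intros a b c h; destruct (H2' a b c h) as [k1 [_ k2]]; apply hOd; auto. }
exists r3, (fun e t => Y1 0 e t), (fun e t x => Y2 t e x).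
assert (hsub : forall t e x, box t0 0 x0 r3 t e x -> box t0 0 x0 r2 t e x)
  by (intros; apply (box_le _ _ _ r3); auto).
split; [exact hr3|split; [|split; [exact hY2|split]]].
- intros n; apply (Ck_sub n (box t0 0 x0 r1)); auto.
  intros a b c h; apply (H2' a b c); auto.
- intros t e x hb; destruct (dY2 t e x hb) as [h1 h2].
  destruct (H2' t e x (hsub _ _ _ hb)) as [k1 [k2 k3]].
  destruct (H2' _ _ _ h1) as [_ [_ k4]].
  split; [apply hOd; auto|split; [|exact h2]].
  destruct k2 as [q1 [q2 q3]].
  apply (dY1 0 e t); repeat split; auto.
- intros t x hb; split; [|apply iY2; exact hb].
  destruct (H2' t 0 x (hsub _ _ _ hb)) as [_ [[q1 [q2 q3]] _]].
  apply iY1; repeat split; auto.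
Qed.

(** * Families of solutions and the characteristic of a symmetry *)

Definition smooth_coef (Om : R * R -> Prop) (c : R -> R -> R) : Prop :=
  Cinf (over Om) (fun t x _ => c t x).

Lemma smooth_coef_dx Om c : smooth_coef Om c -> smooth_coef Om (dx c).
Proof. exact (Cinf_pd3 _ _ Dir_2). Qed.

Lemma smooth_coef_t Om c t x : smooth_coef Om c -> Om (t, x) ->
  is_derive (fun s => c s x) t (dt c t x).
Proof. intros h hw; exact (proj1 (Cinf_partials _ _ t x 0 h hw)). Qed.

Lemma smooth_coef_x Om c t x : smooth_coef Om c -> Om (t, x) ->
  is_derive (fun s => c t s) x (dx c t x).
Proof. intros h hw; exact (proj1 (proj2 (Cinf_partials _ _ t x 0 h hw))). Qed.

Lemma Cinf_coef Om c W : (forall t x u, W t x u -> Om (t, x)) -> smooth_coef Om c ->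
  Cinf W (fun t x _ => c t x).
Proof. intros hs h n; apply (Ck_sub n (over Om)); [exact hs|apply h]. Qed.

Lemma Cinf_plus W f g : open3 W -> Cinf W f -> Cinf W g ->
  Cinf W (fun a b c => f a b c + g a b c).
Proof. intros hW hf hg n; apply Ck_plus; auto. Qed.

Lemma Cinf_mult W f g : open3 W -> Cinf W f -> Cinf W g ->
  Cinf W (fun a b c => f a b c * g a b c).
Proof. intros hW hf hg n; apply Ck_mult; auto. Qed.

Lemma Cinf_minus W f g : open3 W -> Cinf W f -> Cinf W g ->
  Cinf W (fun a b c => f a b c - g a b c).
Proof.
intros hW hf hg n.
apply (Ck_ext n W (fun a b c => f a b c + (-1) * g a b c)); [exact hW|intros; ring|].
apply Ck_plus; auto; apply Ck_mult; auto; apply Ck_const; auto.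
Qed.

Lemma Cinf_trd W : open3 W -> Cinf W (fun _ _ c => c).
Proof. intros hW n; apply Ck_trd; exact hW. Qed.

Lemma Cinf_graph W W' F f : open3 W -> open3 W' -> Cinf W' F -> Cinf W f ->
  (forall a b c, W a b c -> W' a b (f a b c)) -> Cinf W (fun a b c => F a b (f a b c)).
Proof.
intros hW hW' hF hf hm n.
apply (Ck_comp n W W' F (fun a _ _ => a) (fun _ b _ => b) f); auto.
- apply Ck_fst; auto.
- apply Ck_snd; auto.
Qed.

Lemma Cinf_sub (W W' : R -> R -> R -> Prop) f :
  (forall a b c, W' a b c -> W a b c) -> Cinf W f -> Cinf W' f.
Proof. intros hs h n; apply (Ck_sub n W); auto. Qed.

(* [u_t] on a solution of [L] with [u_x = eta], as in [characteristic] *)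
Definition evolution (L : equation) (eta : R -> R -> R -> R) (t x u : R) : R :=
  cA L t x * (d2 eta t x u + eta t x u * d3 eta t x u) + cB L t x * eta t x u
  + cC L t x * u.

Lemma characteristic_evolution L Q eta t x u :
  characteristic L Q eta t x u
  = zeta Q t x u - tau Q t * evolution L eta t x u - xi Q t x * eta t x u.
Proof. reflexivity. Qed.

Section Equation.
Variables (Om : R * R -> Prop) (L : equation).
Hypotheses (hOm : open Om) (hA : smooth_coef Om (cA L)) (hB : smooth_coef Om (cB L))
  (hC : smooth_coef Om (cC L)).

Lemma evolution_Cinf W eta : open3 W -> (forall t x u, W t x u -> Om (t, x)) ->
  Cinf W eta -> Cinf W (evolution L eta).
Proof.
intros hW hs h; unfold evolution.
repeat apply Cinf_plus; auto; apply Cinf_mult; auto;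
  try (apply (Cinf_coef Om); auto; fail).
- apply Cinf_plus; auto; [exact (Cinf_pd3 W eta Dir_2 h)|].
  apply Cinf_mult; auto; exact (Cinf_pd3 W eta Dir_3 h).
- apply Cinf_trd; auto.
Qed.

Lemma evolution_derive W eta t x u : open3 W -> (forall t x u, W t x u -> Om (t, x)) ->
  Cinf W eta -> W t x u ->
  d2 (evolution L eta) t x u =
    dx (cA L) t x * (d2 eta t x u + eta t x u * d3 eta t x u)
    + cA L t x * (d2 (d2 eta) t x u
       + (d2 eta t x u * d3 eta t x u + eta t x u * d3 (d2 eta) t x u))
    + (dx (cB L) t x * eta t x u + cB L t x * d2 eta t x u) + dx (cC L) t x * u /\
  d3 (evolution L eta) t x u =
    cA L t x * (d3 (d2 eta) t x u
       + (d3 eta t x u * d3 eta t x u + eta t x u * d3 (d3 eta) t x u))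
    + cB L t x * d3 eta t x u + cC L t x.
Proof.
intros hW hs h hw; pose proof (hs t x u hw) as hom.
destruct (Cinf_partials W eta t x u h hw) as [_ [e2 e3]].
destruct (Cinf_partials W _ t x u (Cinf_pd3 W eta Dir_2 h) hw) as [_ [e22 e23]].
destruct (Cinf_partials W _ t x u (Cinf_pd3 W eta Dir_3 h) hw) as [_ [e32 e33]].
destruct (Cinf_schwarz W eta t x u hW h hw) as [_ [_ hsch]].
simpl pd3 in *.
pose proof (smooth_coef_x Om _ t x hA hom) as a2.
pose proof (smooth_coef_x Om _ t x hB hom) as b2.
pose proof (smooth_coef_x Om _ t x hC hom) as c2.
split; apply is_derive_unique; unfold evolution; derive; try rewrite hsch; ring.
Qed.

(** Equality of cross derivatives for the system u_x = eta, u_t = [evolution]: the left side is D_t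
    eta and the right side is D_x of [evolution] along solutions. *)
Lemma DE0_compatibility W eta t x u : open3 W -> (forall t x u, W t x u -> Om (t, x)) ->
  Cinf W eta -> W t x u ->
  DE0_at L eta t x u <->
  d1 eta t x u + d3 eta t x u * evolution L eta t x u
  = d2 (evolution L eta) t x u + eta t x u * d3 (evolution L eta) t x u.
Proof.
intros hW hs h hw.
destruct (evolution_derive W eta t x u hW hs h hw) as [e2 e3].
assert (eB : d2 (fun t x u => cB L t x * eta t x u) t x u
   = dx (cB L) t x * eta t x u + cB L t x * d2 eta t x u).
{ destruct (Cinf_partials W eta t x u h hw) as [_ [k2 _]]; simpl pd3 in *.
  pose proof (smooth_coef_x Om _ t x hB (hs t x u hw)) as b2.
  apply is_derive_unique; derive; ring. }
unfold DE0_at; rewrite e2, e3, eB; unfold evolution; split; intros k; lra.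
Qed.

(** The identity f_x = eta (t, x, f) holds on an open set, so it may be differentiated in all three
    directions by the chain rule. *)
Lemma second_derivative W W' eta f t x k : open3 W -> open3 W' -> Cinf W' eta ->
  (forall t x k, W t x k -> W' t x (f t x k)) ->
  (forall t x k, W t x k -> d2 f t x k = eta t x (f t x k)) ->
  Cinf W f -> W t x k ->
  d2 (d2 f) t x k = d2 eta t x (f t x k) + d3 eta t x (f t x k) * eta t x (f t x k) /\
  d1 (d2 f) t x k = d1 eta t x (f t x k) + d3 eta t x (f t x k) * d1 f t x k /\
  d3 (d2 f) t x k = d3 eta t x (f t x k) * d3 f t x k.
Proof.
intros hW hW' he hm hx hf hw.
assert (hn : near3 t x k (fun t x k => d2 f t x k = (fun t x k => eta t x (f t x k)) t x k)).
{ generalize (hW t x k hw); apply near3_imp; intros; apply hx; auto. }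
destruct (Cinf_partials W f t x k hf hw) as [k1 [k2 k3]]; simpl pd3 in *.
pose proof (Cinf_C1at W' eta _ _ _ hW' he (hm t x k hw)) as hc.
split; [|split].
- change (pd3 Dir_2 (d2 f) t x k = d2 eta t x (f t x k) + d3 eta t x (f t x k) * eta t x (f t x k)).
  rewrite (pd3_ext _ _ Dir_2 _ _ _ hn); apply is_derive_unique.
  eapply is_derive_eq.
  + apply (chain_rule eta (fun _ => t) (fun s => s) (fun s => f t s k) x 0 1 (d2 f t x k) hc);
    [apply is_derive_Rconst|apply is_derive_Rid|exact k2].
  + rewrite (hx t x k hw); ring.
- change (pd3 Dir_1 (d2 f) t x k = d1 eta t x (f t x k) + d3 eta t x (f t x k) * d1 f t x k).
  rewrite (pd3_ext _ _ Dir_1 _ _ _ hn); apply is_derive_unique.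
  eapply is_derive_eq.
  + apply (chain_rule eta (fun s => s) (fun _ => x) (fun s => f s x k) t 1 0 (d1 f t x k) hc);
    [apply is_derive_Rid|apply is_derive_Rconst|exact k1].
  + ring.
- change (pd3 Dir_3 (d2 f) t x k = d3 eta t x (f t x k) * d3 f t x k).
  rewrite (pd3_ext _ _ Dir_3 _ _ _ hn); apply is_derive_unique.
  eapply is_derive_eq.
  + apply (chain_rule eta (fun _ => t) (fun _ => x) (fun s => f t x s) k 0 0 (d3 f t x k) hc);
    [apply is_derive_Rconst|apply is_derive_Rconst|exact k3].
  + ring.
Qed.

(** Once f_x = eta, the second derivative in L is a function of (t, x, f), so L becomes a
    first-order equation in t. *)
Lemma solves_evolution W W' eta f t x k : open3 W -> open3 W' -> Cinf W' eta ->
  (forall t x k, W t x k -> W' t x (f t x k)) ->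
  (forall t x k, W t x k -> d2 f t x k = eta t x (f t x k)) ->
  Cinf W f -> W t x k ->
  solves_at L (fun t x => f t x k) t x <-> d1 f t x k = evolution L eta t x (f t x k).
Proof.
intros hW hW' he hm hx hf hw.
destruct (second_derivative W W' eta f t x k hW hW' he hm hx hf hw) as [e _].
change (d1 f t x k = cA L t x * d2 (d2 f) t x k + cB L t x * d2 f t x k + cC L t x * f t x k
  <-> d1 f t x k = evolution L eta t x (f t x k)).
rewrite e, (hx t x k hw); unfold evolution; split; intros h; rewrite h; ring.
Qed.

(** Puts f and [eta] on fixed boxes, of radius d around k0 and r around u0, with f mapping one into
    the other. Germs are handled once in [eta_family_intro]; later arguments are pointwise on these
    boxes. *)
Record eta_family (f eta : R -> R -> R -> R) (t0 x0 k0 u0 d r : R) : Prop := {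
  ef_d : 0 < d;
  ef_r : 0 < r;
  ef_center : f t0 x0 k0 = u0;
  ef_f : Cinf (box t0 x0 k0 d) f;
  ef_eta : Cinf (box t0 x0 u0 r) eta;
  ef_Om : forall t x u, box t0 x0 u0 r t x u -> Om (t, x);
  ef_map : forall t x k, box t0 x0 k0 d t x k -> box t0 x0 u0 r t x (f t x k);
  ef_k : forall t x k, box t0 x0 k0 d t x k -> d3 f t x k <> 0;
  ef_x : forall t x k, box t0 x0 k0 d t x k -> d2 f t x k = eta t x (f t x k);
  ef_t : forall t x k, box t0 x0 k0 d t x k -> d1 f t x k = evolution L eta t x (f t x k);
  ef_sol : forall t x k, box t0 x0 k0 d t x k -> solves_at L (fun t x => f t x k) t x
}.

Lemma eta_family_shrink f eta t0 x0 k0 u0 d r d' : 0 < d' -> d' <= d ->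
  eta_family f eta t0 x0 k0 u0 d r -> eta_family f eta t0 x0 k0 u0 d' r.
Proof.
intros hd' hle [h1 h2 h3 h4 h5 h6 h7 h8 h9 h10 h11].
assert (hs : forall a b c, box t0 x0 k0 d' a b c -> box t0 x0 k0 d a b c)
  by (intros; apply (box_le _ _ _ d'); auto).
split; auto; exact (Cinf_sub _ _ _ hs h4).
Qed.

Lemma eta_family_intro f eta t0 x0 k0 u0 : Om (t0, x0) ->
  solution_family L f k0 t0 x0 u0 -> smooth3_near eta t0 x0 u0 ->
  near3 t0 x0 k0 (fun t x k => d2 f t x k = eta t x (f t x k)) ->
  exists d r, eta_family f eta t0 x0 k0 u0 d r.
Proof.
intros hp [hf [hu hs]] he hx.
apply smooth3_near_box in hf; destruct hf as [df [hdf hf]].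
apply smooth3_near_box in he; destruct he as [de [hde he]].
destruct (over_box Om t0 x0 u0 hOm hp) as [dO [hdO HO]].
set (r := Rmin de dO).
assert (hr : 0 < r) by (apply Rmin_pos; auto).
assert (r <= de /\ r <= dO) as [r1 r2] by (split; [apply Rmin_l|apply Rmin_r]).
apply near3_locally in hs.
assert (hfc : cont3 f t0 x0 k0).
{ apply (Ck_C0 0 _ _ _ _ _ (hf 0%nat)); apply box_center; exact hdf. }
assert (hmap : near3 t0 x0 k0 (fun t x k => box t0 x0 u0 r t x (f t x k))).
{ apply (near3_comp (box t0 x0 u0 r) (fun t _ _ => t) (fun _ x _ => x) f); auto.
  - apply cont3_fst.
  - apply cont3_snd.
  - rewrite hu; apply open3_box; apply box_center; exact hr. }
destruct (proj1 (box_near _ _ _ _) (near3_and _ _ _ _ _ hx (near3_and _ _ _ _ _ hs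
  (near3_and _ _ _ _ _ hmap (open3_box _ _ _ _ _ _ _ (box_center t0 x0 k0 df hdf))))))
  as [d [hd H]].
exists d, r.
assert (hf' : Cinf (box t0 x0 k0 d) f).
{ apply (Cinf_sub (box t0 x0 k0 df)); auto; intros a b c hb; apply H; exact hb. }
assert (he' : Cinf (box t0 x0 u0 r) eta).
{ apply (Cinf_sub (box t0 x0 u0 de)); auto; intros a b c hb; apply (box_le _ _ _ r); auto. }
split; auto.
- intros t x u hb; apply (HO t x u); apply (box_le _ _ _ r); auto.
- intros t x k hb; apply H; exact hb.
- intros t x k hb; apply H; exact hb.
- intros t x k hb; apply H; exact hb.
- intros t x k hb.
  apply (solves_evolution (box t0 x0 k0 d) (box t0 x0 u0 r)); auto using open3_box;
  intros; apply H; assumption.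
- intros t x k hb; apply H; exact hb.
Qed.

(** The symmetry of f_tx is exactly the compatibility condition at the point (t, x, f). *)
Lemma eta_family_DE0 f eta t0 x0 k0 u0 d r t x k :
  eta_family f eta t0 x0 k0 u0 d r -> box t0 x0 k0 d t x k ->
  DE0_at L eta t x (f t x k).
Proof.
intros [h1 h2 h3 h4 h5 h6 h7 h8 h9 h10 h11] hb.
assert (oD := open3_box t0 x0 k0 d); assert (oR := open3_box t0 x0 u0 r).
apply (DE0_compatibility (box t0 x0 u0 r)); auto.
destruct (second_derivative _ _ eta f t x k oD oR h5 h7 h9 h4 hb) as [_ [e12 _]].
destruct (Cinf_schwarz _ f t x k oD h4 hb) as [sch _].
rewrite <- (h10 t x k hb), <- e12, sch.
assert (hn : near3 t x k (fun t x k =>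
   d1 f t x k = (fun t x k => evolution L eta t x (f t x k)) t x k)).
{ generalize (oD t x k hb); apply near3_imp; intros; apply h10; auto. }
change (pd3 Dir_2 (d1 f) t x k = d2 (evolution L eta) t x (f t x k)
   + eta t x (f t x k) * d3 (evolution L eta) t x (f t x k)).
rewrite (pd3_ext _ _ Dir_2 _ _ _ hn); apply is_derive_unique.
destruct (Cinf_partials _ f t x k h4 hb) as [_ [k2 _]]; simpl pd3 in *.
eapply is_derive_eq.
- apply (chain_rule (evolution L eta) (fun _ => t) (fun s => s) (fun s => f t s k) x 0 1 (d2 f t x k));
  [|apply is_derive_Rconst|apply is_derive_Rid|exact k2].
  apply (Cinf_C1at (box t0 x0 u0 r)); auto; apply evolution_Cinf; auto.
- rewrite (h9 t x k hb); ring.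
Qed.

Section Symmetry.
Variable Q : operator.
Hypotheses (htau : smooth_coef Om (fun t _ => tau Q t)) (hxi : smooth_coef Om (xi Q))
  (hz1 : smooth_coef Om (zeta1 Q)) (hz0 : smooth_coef Om (zeta0 Q)).

(** The function w of the overview. *)
Definition family_char (f : R -> R -> R -> R) (t x k : R) : R :=
  zeta1 Q t x * f t x k + zeta0 Q t x - tau Q t * d1 f t x k - xi Q t x * d2 f t x k.

Lemma family_char_Cinf W f : open3 W -> (forall t x u, W t x u -> Om (t, x)) ->
  Cinf W f -> Cinf W (family_char f).
Proof.
intros hW hs hf; unfold family_char.
assert (hc : forall c, smooth_coef Om c -> Cinf W (fun t x _ => c t x))
  by (intros; apply (Cinf_coef Om); auto).
repeat first [apply Cinf_minus | apply Cinf_plus | apply Cinf_mult]; auto;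
first [exact (Cinf_pd3 W f Dir_1 hf) | exact (Cinf_pd3 W f Dir_2 hf)].
Qed.

Lemma characteristic_family f eta t0 x0 k0 u0 d r t x k :
  eta_family f eta t0 x0 k0 u0 d r -> box t0 x0 k0 d t x k ->
  characteristic L Q eta t x (f t x k) = family_char f t x k.
Proof.
intros [h1 h2 h3 h4 h5 h6 h7 h8 h9 h10 h11] hb.
rewrite characteristic_evolution, <- h10, <- h9 by exact hb; reflexivity.
Qed.

(** The terms after [d3 eta * family_char] are the right side minus the left side of
    [Q0_invariant_at]; their vanishing is therefore equivalent to w_x = eta_u w. *)
Lemma family_char_dx f eta t0 x0 k0 u0 d r t x k :
  eta_family f eta t0 x0 k0 u0 d r -> box t0 x0 k0 d t x k ->
  let u := f t x k in
  d2 (family_char f) t x k = d3 eta t x u * family_char f t x k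
   + ((zeta1 Q t x - dx (xi Q) t x) * eta t x u + dx (zeta1 Q) t x * u + dx (zeta0 Q) t x)
   - (tau Q t * d1 eta t x u + xi Q t x * d2 eta t x u + zeta Q t x u * d3 eta t x u).
Proof.
intros [h1 h2 h3 h4 h5 h6 h7 h8 h9 h10 h11] hb u.
assert (oD := open3_box t0 x0 k0 d); assert (oR := open3_box t0 x0 u0 r).
assert (hom : Om (t, x)) by (apply (h6 t x u); apply h7; exact hb).
destruct (second_derivative _ _ eta f t x k oD oR h5 h7 h9 h4 hb) as [e22 [e12 _]].
destruct (Cinf_schwarz _ f t x k oD h4 hb) as [sch _].
destruct (Cinf_partials _ f t x k h4 hb) as [_ [k2 _]].
destruct (Cinf_partials _ _ t x k (Cinf_pd3 _ f Dir_1 h4) hb) as [_ [k12 _]].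
destruct (Cinf_partials _ _ t x k (Cinf_pd3 _ f Dir_2 h4) hb) as [_ [k22 _]].
simpl pd3 in *.
pose proof (smooth_coef_x Om _ t x hxi hom) as a1.
pose proof (smooth_coef_x Om _ t x hz1 hom) as a2.
pose proof (smooth_coef_x Om _ t x hz0 hom) as a3.
apply is_derive_unique; unfold family_char; derive.
rewrite <- sch, e12, e22, (h9 t x k hb); unfold zeta, u; ring.
Qed.

Lemma dk_dx f eta t0 x0 k0 u0 d r t x k :
  eta_family f eta t0 x0 k0 u0 d r -> box t0 x0 k0 d t x k ->
  d2 (d3 f) t x k = d3 eta t x (f t x k) * d3 f t x k.
Proof.
intros [h1 h2 h3 h4 h5 h6 h7 h8 h9 h10 h11] hb.
assert (oD := open3_box t0 x0 k0 d); assert (oR := open3_box t0 x0 u0 r).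
destruct (Cinf_schwarz _ f t x k oD h4 hb) as [_ [_ sch]]; rewrite sch.
exact (proj2 (proj2 (second_derivative _ _ eta f t x k oD oR h5 h7 h9 h4 hb))).
Qed.

(** Only x-derivatives are compared, so the multiplier may be an arbitrary function of k. *)
Lemma Q0_invariant_of_multiple f eta h t0 x0 k0 u0 d r t x k :
  eta_family f eta t0 x0 k0 u0 d r -> box t0 x0 k0 d t x k ->
  (forall t x k, box t0 x0 k0 d t x k -> family_char f t x k = h k * d3 f t x k) ->
  Q0_invariant_at Q eta t x (f t x k).
Proof.
intros hE hb hh.
pose proof (family_char_dx f eta t0 x0 k0 u0 d r t x k hE hb) as e; cbv zeta in e.
assert (e' : d2 (family_char f) t x k = d3 eta t x (f t x k) * family_char f t x k).
{ assert (hn : near3 t x k (fun t x k =>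
    family_char f t x k = (fun t x k => h k * d3 f t x k) t x k)).
  { generalize (open3_box _ _ _ _ t x k hb); apply near3_imp; intros; apply hh; auto. }
  change (pd3 Dir_2 (family_char f) t x k = d3 eta t x (f t x k) * family_char f t x k).
  rewrite (pd3_ext _ _ Dir_2 _ _ _ hn); apply is_derive_unique.
  destruct (Cinf_partials _ _ t x k (Cinf_pd3 _ f Dir_3 (ef_f _ _ _ _ _ _ _ _ hE)) hb)
    as [_ [k2 _]]; simpl pd3 in *.
  derive; rewrite (dk_dx f eta t0 x0 k0 u0 d r t x k hE hb), (hh t x k hb); ring. }
unfold Q0_invariant_at; rewrite e' in e; lra.
Qed.

Hypothesis hsym : forall t x u ut ux uxx : R, Om (t, x) ->
    ut = cA L t x * uxx + cB L t x * ux + cC L t x * u ->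
    zeta_t Q t x u ut ux
    - cA L t x * zeta_xx Q t x u ux uxx
    - cB L t x * zeta_x Q t x u ux
    - cC L t x * zeta Q t x u
    - (tau Q t * dt (cA L) t x + xi Q t x * dx (cA L) t x) * uxx
    - (tau Q t * dt (cB L) t x + xi Q t x * dx (cB L) t x) * ux
    - (tau Q t * dt (cC L) t x + xi Q t x * dx (cC L) t x) * u = 0.

(* The characteristic of a symmetry maps solutions of the linear equation [L] to
   solutions: apply the invariance criterion to the jet of [f] and subtract
   [tau D_t + xi D_x] of the equation. *)
Lemma family_char_solves W f t x k : open3 W -> (forall t x u, W t x u -> Om (t, x)) ->
  Cinf W f -> (forall t x k, W t x k -> solves_at L (fun t x => f t x k) t x) -> W t x k ->
  d1 (family_char f) t x k = cA L t x * d2 (d2 (family_char f)) t x k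
   + cB L t x * d2 (family_char f) t x k + cC L t x * family_char f t x k.
Proof.
intros hW hs hf hsol hw; pose proof (hs t x k hw) as hom.
assert (f1 := Cinf_pd3 W f Dir_1 hf); assert (f2 := Cinf_pd3 W f Dir_2 hf).
assert (f12 := Cinf_pd3 W _ Dir_2 f1); assert (f22 := Cinf_pd3 W _ Dir_2 f2).
simpl pd3 in *.
set (wx := fun t x k => dx (zeta1 Q) t x * f t x k + zeta1 Q t x * d2 f t x k
   + dx (zeta0 Q) t x - tau Q t * d2 (d1 f) t x k
   - (dx (xi Q) t x * d2 f t x k + xi Q t x * d2 (d2 f) t x k)).
assert (hwx : forall t x k, W t x k -> d2 (family_char f) t x k = wx t x k).
{ clear t x k hw hom; intros t x k hw; pose proof (hs t x k hw) as hom.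
  destruct (Cinf_partials _ _ t x k hf hw) as [_ [p2 _]].
  destruct (Cinf_partials _ _ t x k f1 hw) as [_ [p12 _]].
  destruct (Cinf_partials _ _ t x k f2 hw) as [_ [p22 _]].
  simpl pd3 in *.
  pose proof (smooth_coef_x Om _ t x hxi hom) as a1.
  pose proof (smooth_coef_x Om _ t x hz1 hom) as a2.
  pose proof (smooth_coef_x Om _ t x hz0 hom) as a3.
  apply is_derive_unique; unfold family_char, wx; derive; ring. }
destruct (Cinf_partials _ _ t x k hf hw) as [p1 [p2 _]].
destruct (Cinf_partials _ _ t x k f1 hw) as [p11 [p12 _]].
destruct (Cinf_partials _ _ t x k f2 hw) as [p21 [p22 _]].
destruct (Cinf_partials _ _ t x k f12 hw) as [p121 [p122 _]].
destruct (Cinf_partials _ _ t x k f22 hw) as [p221 [p222 _]].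
simpl pd3 in *.
pose proof (smooth_coef_x Om _ t x hxi hom) as ax1.
pose proof (smooth_coef_x Om _ t x hz1 hom) as ax2.
pose proof (smooth_coef_x Om _ t x hz0 hom) as ax3.
pose proof (smooth_coef_x Om _ t x (smooth_coef_dx _ _ hxi) hom) as ay1.
pose proof (smooth_coef_x Om _ t x (smooth_coef_dx _ _ hz1) hom) as ay2.
pose proof (smooth_coef_x Om _ t x (smooth_coef_dx _ _ hz0) hom) as ay3.
pose proof (smooth_coef_t Om _ t x hxi hom) as at1.
pose proof (smooth_coef_t Om _ t x hz1 hom) as at2.
pose proof (smooth_coef_t Om _ t x hz0 hom) as at3.
assert (at4 : is_derive (tau Q) t (Derive (tau Q) t))
  by exact (smooth_coef_t Om _ t x htau hom).
pose proof (smooth_coef_x Om _ t x hA hom) as cAx.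
pose proof (smooth_coef_x Om _ t x hB hom) as cBx.
pose proof (smooth_coef_x Om _ t x hC hom) as cCx.
pose proof (smooth_coef_t Om _ t x hA hom) as cAt.
pose proof (smooth_coef_t Om _ t x hB hom) as cBt.
pose proof (smooth_coef_t Om _ t x hC hom) as cCt.
destruct (Cinf_schwarz W f t x k hW hf hw) as [s12 _].
destruct (Cinf_schwarz W (d2 f) t x k hW f2 hw) as [s122 _].
(* Third-order derivatives are interchanged by differentiating the second-order Schwarz identity,
   which holds nearby. *)
assert (s122' : d2 (d1 (d2 f)) t x k = d2 (d2 (d1 f)) t x k).
{ apply (pd3_ext _ _ Dir_2); generalize (hW t x k hw); apply near3_imp.
  intros a b c hh; exact (proj1 (Cinf_schwarz W f a b c hW hf hh)). }
set (rhs := fun t x k => cA L t x * d2 (d2 f) t x k + cB L t x * d2 f t x k + cC L t x * f t x k).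
assert (hn : near3 t x k (fun t x k => d1 f t x k = rhs t x k)).
{ generalize (hW t x k hw); apply near3_imp; intros a b c hh; exact (hsol a b c hh). }
assert (eqt : d1 (d1 f) t x k =
   dt (cA L) t x * d2 (d2 f) t x k + cA L t x * d1 (d2 (d2 f)) t x k
   + (dt (cB L) t x * d2 f t x k + cB L t x * d1 (d2 f) t x k)
   + (dt (cC L) t x * f t x k + cC L t x * d1 f t x k)).
{ change (pd3 Dir_1 (d1 f) t x k =
   dt (cA L) t x * d2 (d2 f) t x k + cA L t x * d1 (d2 (d2 f)) t x k
   + (dt (cB L) t x * d2 f t x k + cB L t x * d1 (d2 f) t x k)
   + (dt (cC L) t x * f t x k + cC L t x * d1 f t x k)).
  rewrite (pd3_ext _ _ Dir_1 _ _ _ hn); apply is_derive_unique; unfold rhs; derive; ring. }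
assert (eqx : d2 (d1 f) t x k =
   dx (cA L) t x * d2 (d2 f) t x k + cA L t x * d2 (d2 (d2 f)) t x k
   + (dx (cB L) t x * d2 f t x k + cB L t x * d2 (d2 f) t x k)
   + (dx (cC L) t x * f t x k + cC L t x * d2 f t x k)).
{ change (pd3 Dir_2 (d1 f) t x k =
   dx (cA L) t x * d2 (d2 f) t x k + cA L t x * d2 (d2 (d2 f)) t x k
   + (dx (cB L) t x * d2 f t x k + cB L t x * d2 (d2 f) t x k)
   + (dx (cC L) t x * f t x k + cC L t x * d2 f t x k)).
  rewrite (pd3_ext _ _ Dir_2 _ _ _ hn); apply is_derive_unique; unfold rhs; derive; ring. }
assert (ewxx : d2 (d2 (family_char f)) t x k =
   dx (dx (zeta1 Q)) t x * f t x k + 2 * dx (zeta1 Q) t x * d2 f t x k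
   + zeta1 Q t x * d2 (d2 f) t x k + dx (dx (zeta0 Q)) t x - tau Q t * d2 (d2 (d1 f)) t x k
   - dx (dx (xi Q)) t x * d2 f t x k - 2 * dx (xi Q) t x * d2 (d2 f) t x k
   - xi Q t x * d2 (d2 (d2 f)) t x k).
{ assert (hn' : near3 t x k (fun t x k => d2 (family_char f) t x k = wx t x k)).
  { generalize (hW t x k hw); apply near3_imp; intros; apply hwx; auto. }
  assert (e0 : d2 (d2 (family_char f)) t x k = d2 wx t x k)
    by exact (pd3_ext _ _ Dir_2 _ _ _ hn').
  rewrite e0; apply is_derive_unique; unfold wx; derive; ring. }
assert (ewt : d1 (family_char f) t x k =
   dt (zeta1 Q) t x * f t x k + zeta1 Q t x * d1 f t x k + dt (zeta0 Q) t x
   - Derive (tau Q) t * d1 f t x k - tau Q t * d1 (d1 f) t x k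
   - dt (xi Q) t x * d2 f t x k - xi Q t x * d1 (d2 f) t x k).
{ apply is_derive_unique; unfold family_char; derive; ring. }
pose proof (hsym t x (f t x k) (d1 f t x k) (d2 f t x k) (d2 (d2 f) t x k) hom (hsol t x k hw))
  as sym.
rewrite ewt, ewxx, (hwx t x k hw); unfold wx, family_char.
unfold zeta_t, zeta_xx, zeta_x, zeta in sym.
rewrite s122, s122' in eqt; rewrite s12 in eqt |- *.
(* The total derivatives of the equation, multiplied by [tau] and [xi], are the terms to subtract;
   after this the goal is a linear combination of [sym], [eqt] and [eqx]. *)
apply (f_equal (fun z => tau Q t * z)) in eqt; apply (f_equal (fun z => xi Q t x * z)) in eqx.
lra.
Qed.

(** L is linear and homogeneous with coefficients free of k, so the derivative of a family in its
    parameter is again a solution. *)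
Lemma dk_solves W f t x k : open3 W -> (forall t x u, W t x u -> Om (t, x)) ->
  Cinf W f -> (forall t x k, W t x k -> solves_at L (fun t x => f t x k) t x) -> W t x k ->
  d1 (d3 f) t x k = cA L t x * d2 (d2 (d3 f)) t x k
   + cB L t x * d2 (d3 f) t x k + cC L t x * d3 f t x k.
Proof.
intros hW hs hf hsol hw.
assert (f2 := Cinf_pd3 W f Dir_2 hf); assert (f22 := Cinf_pd3 W _ Dir_2 f2).
destruct (Cinf_partials _ _ t x k hf hw) as [_ [_ p3]].
destruct (Cinf_partials _ _ t x k f2 hw) as [_ [_ p23]].
destruct (Cinf_partials _ _ t x k f22 hw) as [_ [_ p223]].
simpl pd3 in *.
destruct (Cinf_schwarz W f t x k hW hf hw) as [_ [s13 s23]].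
destruct (Cinf_schwarz W (d2 f) t x k hW f2 hw) as [_ [_ s223]].
assert (s223' : d2 (d3 (d2 f)) t x k = d2 (d2 (d3 f)) t x k).
{ apply (pd3_ext _ _ Dir_2); generalize (hW t x k hw); apply near3_imp.
  intros a b c hh; symmetry; exact (proj2 (proj2 (Cinf_schwarz W f a b c hW hf hh))). }
set (rhs := fun t x k => cA L t x * d2 (d2 f) t x k + cB L t x * d2 f t x k + cC L t x * f t x k).
assert (hn : near3 t x k (fun t x k => d1 f t x k = rhs t x k)).
{ generalize (hW t x k hw); apply near3_imp; intros a b c hh; exact (hsol a b c hh). }
assert (e0 : d3 (d1 f) t x k = d3 rhs t x k) by exact (pd3_ext _ _ Dir_3 _ _ _ hn).
rewrite s13, e0, <- s223', s223, s23.
apply is_derive_unique; unfold rhs; derive; ring.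
Qed.

(* Both sides solve [L] and have logarithmic [x]-derivative [eta_u], hence their
   quotient depends on neither [x] nor [t]. *)
Lemma family_char_multiple f eta t0 x0 k0 u0 d r :
  eta_family f eta t0 x0 k0 u0 d r ->
  (forall t x k, box t0 x0 k0 d t x k -> Q0_invariant_at Q eta t x (f t x k)) ->
  forall t x k, box t0 x0 k0 d t x k ->
    family_char f t x k = family_char f t0 x0 k / d3 f t0 x0 k * d3 f t x k.
Proof.
intros hE hQ t x k hb0.
pose proof hE as [h1 h2 h3 h4 h5 h6 h7 h8 h9 h10 h11].
assert (oD := open3_box t0 x0 k0 d); assert (oR := open3_box t0 x0 u0 r).
set (w := family_char f).
assert (hsO : forall t x k, box t0 x0 k0 d t x k -> Om (t, x))
  by (intros; eapply h6; apply h7; eassumption).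
assert (hw : Cinf (box t0 x0 k0 d) w) by (apply family_char_Cinf; auto).
assert (f3 := Cinf_pd3 _ f Dir_3 h4); simpl pd3 in f3.
assert (ee : Cinf (box t0 x0 u0 r) (d3 eta)) by exact (Cinf_pd3 _ eta Dir_3 h5).
set (c := fun t x k => d3 eta t x (f t x k)).
assert (hc : Cinf (box t0 x0 k0 d) c)
  by (apply (Cinf_graph _ (box t0 x0 u0 r) (d3 eta) f); auto).
assert (wx : forall t x k, box t0 x0 k0 d t x k -> d2 w t x k = c t x k * w t x k).
{ intros a b q hb; pose proof (family_char_dx f eta t0 x0 k0 u0 d r a b q hE hb) as e.
  cbv zeta in e; pose proof (hQ _ _ _ hb) as e'; unfold Q0_invariant_at in e'.
  fold w in e; unfold c; lra. }
assert (fx : forall t x k, box t0 x0 k0 d t x k -> d2 (d3 f) t x k = c t x k * d3 f t x k).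
{ intros a b q hb; exact (dk_dx f eta t0 x0 k0 u0 d r a b q hE hb). }
(* From g_x = c g follows g_xx = (c_x + c^2) g, and L turns this into g_t = (A (c_x + c^2) + B c +
   C) g. The factor is the same for w and f_k, so their quotient has zero t-derivative as well. *)
assert (xx : forall g, Cinf (box t0 x0 k0 d) g ->
   (forall t x k, box t0 x0 k0 d t x k -> d2 g t x k = c t x k * g t x k) ->
   forall t x k, box t0 x0 k0 d t x k ->
     d2 (d2 g) t x k = (d2 c t x k + c t x k * c t x k) * g t x k).
{ intros g hg hgx a b q hb.
  assert (hn : near3 a b q (fun t x k => d2 g t x k = (fun t x k => c t x k * g t x k) t x k)).
  { generalize (oD a b q hb); apply near3_imp; intros; apply hgx; auto. }
  assert (e0 := pd3_ext _ _ Dir_2 _ _ _ hn).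
  change (d2 (d2 g) a b q = d2 (fun t x k => c t x k * g t x k) a b q) in e0.
  rewrite e0; apply is_derive_unique.
  destruct (Cinf_partials _ _ a b q hg hb) as [_ [p2 _]].
  destruct (Cinf_partials _ _ a b q hc hb) as [_ [q2 _]]; simpl pd3 in *.
  derive; rewrite (hgx a b q hb); ring. }
assert (hq : w t x k / d3 f t x k = w t0 x0 k / d3 f t0 x0 k).
{ destruct hb0 as [b1 [b2 b3]].
  apply (box_const (fun t x => w t x k / d3 f t x k) t0 x0 d); auto.
  intros a b ha hb.
  assert (hbx : box t0 x0 k0 d a b k) by (repeat split; auto).
  pose proof (h8 a b k hbx) as hne.
  assert (hinv : forall z, z <> 0 -> is_derive Rinv z (- (/ z * / z))).
  { intros z hz; auto_derive; auto; field; auto. }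
  destruct (Cinf_partials _ _ a b k hw hbx) as [w1 [w2 _]].
  destruct (Cinf_partials _ _ a b k f3 hbx) as [q1 [q2 _]]; simpl pd3 in *.
  split; unfold Rdiv; eapply is_derive_eq.
  - apply is_derive_Rmult; [exact w1|].
    exact (is_derive_comp Rinv (fun s => d3 f s b k) a _ _ (hinv _ hne) q1).
  - change scal with Rmult; simpl.
    pose proof (family_char_solves _ f a b k oD hsO h4 h11 hbx) as ew; fold w in ew.
    pose proof (dk_solves _ f a b k oD hsO h4 h11 hbx) as ef.
    rewrite (xx w hw wx a b k hbx), (wx a b k hbx) in ew.
    rewrite (xx (d3 f) f3 fx a b k hbx), (fx a b k hbx) in ef.
    rewrite ew, ef; field; exact hne.
  - apply is_derive_Rmult; [exact w2|].
    exact (is_derive_comp Rinv (fun s => d3 f a s k) b _ _ (hinv _ hne) q2).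
  - change scal with Rmult; simpl.
    rewrite (wx a b k hbx), (fx a b k hbx); field; exact hne. }
fold w; rewrite <- hq; field; apply h8; exact hb0.
Qed.

End Symmetry.
End Equation.

(** * Integration of the compatible system *)

Lemma cont3_neq0 f a b c : cont3 f a b c -> f a b c <> 0 ->
  near3 a b c (fun x y z => f x y z <> 0).
Proof.
intros hf h0; generalize (hf _ (Rabs_pos_lt _ h0)); apply near3_imp; intros x y z h e.
rewrite e in h; unfold Rminus in h; rewrite Rplus_0_l, Rabs_Ropp in h; lra.
Qed.

Section Reduction.
Variables (Om : R * R -> Prop) (L : equation).
Hypotheses (hOm : open Om) (hA : smooth_coef Om (cA L)) (hB : smooth_coef Om (cB L))
  (hC : smooth_coef Om (cC L)).

(** K assigns to a point the parameter of the member through it; it is the first integral of the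
    system u_x = eta, u_t = [evolution]. *)
Lemma family_inverse f eta t0 x0 k0 u0 d r : eta_family Om L f eta t0 x0 k0 u0 d r ->
  exists e K, 0 < e /\ Cinf (box t0 x0 u0 e) K /\ K t0 x0 u0 = k0 /\
    forall t x u, box t0 x0 u0 e t x u ->
      box t0 x0 k0 d t x (K t x u) /\ f t x (K t x u) = u.
Proof.
intros [h1 h2 h3 h4 h5 h6 h7 h8 h9 h10 h11].
destruct (implicit_function f t0 x0 k0 d h1 h4 (h8 _ _ _ (box_center t0 x0 k0 d h1)))
  as [d' [e [K [hd' [hle [he [hK [hb [hinj _]]]]]]]]].
rewrite h3 in *; exists e, K; split; [exact he|split; [exact hK|split]].
- destruct (hb t0 x0 u0 (box_center _ _ _ _ he)) as [k1 k2].
  apply (hinj t0 x0); auto; [apply box_center; exact hd'|rewrite k2; auto].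
- intros t x u hu; destruct (hb t x u hu) as [k1 k2]; split; auto.
  apply (box_le _ _ _ d'); auto.
Qed.

(* [K (t, x, v (t, x))] has zero gradient, by implicit differentiation of
   [f (t, x, K) = v]. *)
Lemma first_integral f eta t0 x0 k0 u0 d r e K (v : R -> R -> R) t1 x1 rho :
  eta_family Om L f eta t0 x0 k0 u0 d r -> Cinf (box t0 x0 u0 e) K ->
  (forall t x u, box t0 x0 u0 e t x u ->
     box t0 x0 k0 d t x (K t x u) /\ f t x (K t x u) = u) ->
  (forall t x, Rabs (t - t1) < rho -> Rabs (x - x1) < rho ->
     box t0 x0 u0 e t x (v t x) /\
     is_derive (fun s => v s x) t (evolution L eta t x (v t x)) /\
     is_derive (fun s => v t s) x (eta t x (v t x))) ->
  forall t x, Rabs (t - t1) < rho -> Rabs (x - x1) < rho ->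
    v t x = f t x (K t1 x1 (v t1 x1)).
Proof.
intros [h1 h2 h3 h4 h5 h6 h7 h8 h9 h10 h11] hK hb hv.
assert (hq : forall t x, Rabs (t - t1) < rho -> Rabs (x - x1) < rho ->
   K t x (v t x) = K t1 x1 (v t1 x1)).
{ apply (box_const (fun t x => K t x (v t x))); intros t x ht hx.
  destruct (hv t x ht hx) as [hbx [v1 v2]]; destruct (hb _ _ _ hbx) as [kb ke].
  assert (hC1 : C1at f t x (K t x (v t x)))
    by (apply (Cinf_C1at _ f _ _ _ (open3_box _ _ _ _) h4); exact kb).
  assert (hKc : cont3 K t x (v t x)) by (apply (Ck_C0 0 _ _ _ _ _ (hK 0%nat)); exact hbx).
  split; eapply is_derive_eq.
  - apply (implicit_derive f (fun s => s) (fun _ => x) (fun s => v s x) (fun s => K s x (v s x))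
      t 1 0 (evolution L eta t x (v t x))); auto.
    + apply is_derive_Rid.
    + apply is_derive_Rconst.
    + apply (cont3_curve K (fun s => s) (fun _ => x) (fun s => v s x)); auto.
      * apply continuous_id.
      * apply continuous_const.
      * exact (is_derive_continuous _ _ _ v1).
    + assert (hd : 0 < rho - Rabs (t - t1)) by lra.
      exists (mkposreal _ hd); intros s hs; change (Rabs (s - t) < rho - Rabs (t - t1)) in hs.
      apply hb; apply hv; auto; replace (s - t1) with ((s - t) + (t - t1)) by ring.
      eapply Rle_lt_trans; [apply Rabs_triang|lra].
  - simpl; rewrite (h10 _ _ _ kb), ke; field; apply h8; exact kb.
  - apply (implicit_derive f (fun _ => t) (fun s => s) (fun s => v t s) (fun s => K t s (v t s))
      x 0 1 (eta t x (v t x))); auto.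
    + apply is_derive_Rconst.
    + apply is_derive_Rid.
    + apply (cont3_curve K (fun _ => t) (fun s => s) (fun s => v t s)); auto.
      * apply continuous_const.
      * apply continuous_id.
      * exact (is_derive_continuous _ _ _ v2).
    + assert (hd : 0 < rho - Rabs (x - x1)) by lra.
      exists (mkposreal _ hd); intros s hs; change (Rabs (s - x) < rho - Rabs (x - x1)) in hs.
      apply hb; apply hv; auto; replace (s - x1) with ((s - x) + (x - x1)) by ring.
      eapply Rle_lt_trans; [apply Rabs_triang|lra].
  - simpl; rewrite (h9 _ _ _ kb), ke; field; apply h8; exact kb. }
intros t x ht hx; rewrite <- (hq t x ht hx).
symmetry; apply hb; apply hv; auto.
Qed.

(** A solution v of L with v_x = eta also has v_t = [evolution], so K is constant along its graph
    and v is the member with that parameter. The parameter is close to k0 by continuity of K. *)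
Lemma reduction_intro f eta t0 x0 k0 u0 d r : eta_family Om L f eta t0 x0 k0 u0 d r ->
  solution_family L f k0 t0 x0 u0 -> reduction L eta f k0 t0 x0 u0.
Proof.
intros hE hf; pose proof hE as [h1 h2 h3 h4 h5 h6 h7 h8 h9 h10 h11].
split; [exact hf|split].
- apply locally_3; exists d; auto.
- intros S hS.
  destruct (family_inverse _ _ _ _ _ _ _ _ hE) as [e [K [he [hK [hK0 hb]]]]].
  assert (hKS : near3 t0 x0 u0 (fun t x u => S (K t x u))).
  { destruct hS as [s hs].
    generalize (Ck_C0 0 _ _ _ _ _ (hK 0%nat) (box_center _ _ _ _ he) s (cond_pos s)).
    apply near3_imp; intros x y z h; apply hs; rewrite hK0 in h; exact h. }
  apply near3_locally.
  generalize (near3_and _ _ _ _ _ hKS (near3_and _ _ _ _ _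
    (open3_box _ _ _ _ _ _ _ (box_center t0 x0 u0 e he))
    (open3_box _ _ _ _ _ _ _ (box_center t0 x0 u0 r h2)))).
  apply near3_imp; intros t1 x1 u1 [k1 [k2 k3]] v [[Wv [hWo [hW1 hv]]] hvs] hv1 hvx.
  exists (K t1 x1 u1); split; [exact k1|].
  apply Cinf_smooth2 in hv.
  assert (hWv : open3 (fun a b _ : R => Wv (a, b))) by exact (open3_over Wv hWo).
  (* The single solution v is viewed as a family constant in its parameter, to which
     [solves_evolution] applies. *)
  set (F := fun t x _ : R => v t x).
  assert (hFc : cont3 F t1 x1 0) by (apply (Ck_C0 0 _ F _ _ _ (hv 0%nat)); exact hW1).
  assert (hmap : forall rr, 0 < rr -> box t0 x0 u0 rr t1 x1 u1 ->
     near3 t1 x1 0 (fun t x c => box t0 x0 u0 rr t x (F t x c))).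
  { intros rr hrr hbr; apply (near3_comp (box t0 x0 u0 rr) (fun t _ _ => t) (fun _ x _ => x) F); auto.
    - apply cont3_fst.
    - apply cont3_snd.
    - unfold F; rewrite hv1; apply open3_box; exact hbr. }
  apply locally_2 in hvs; destruct hvs as [d1' [hd1 hvs]].
  apply locally_2 in hvx; destruct hvx as [d2' [hd2 hvx]].
  destruct (proj1 (box_near _ _ _ _) (near3_and _ _ _ _ _ (hWv t1 x1 0 hW1)
    (near3_and _ _ _ _ _ (hmap e he k2) (near3_and _ _ _ _ _ (hmap r h2 k3)
    (near3_box t1 x1 0 (Rmin d1' d2') (Rmin_pos _ _ hd1 hd2)))))) as [rho [hrho H]].
  pose proof (Rmin_l d1' d2'); pose proof (Rmin_r d1' d2').
  assert (hFW : Cinf (box t1 x1 0 rho) F)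
    by (apply (Cinf_sub (fun a b _ => Wv (a, b))); auto; intros a b c hh; exact (proj1 (H a b c hh))).
  assert (hFx : forall t x c, box t1 x1 0 rho t x c -> d2 F t x c = eta t x (F t x c)).
  { intros t x c hh; destruct (H t x c hh) as [_ [_ [_ [q1 [q2 _]]]]].
    exact (hvx t x ltac:(lra) ltac:(lra)). }
  apply locally_2; exists rho; split; [exact hrho|]; simpl.
  rewrite <- hv1.
  apply (first_integral f eta t0 x0 k0 u0 d r e K v t1 x1 rho); auto.
  intros t x ht hx.
  assert (hbx : box t1 x1 0 rho t x 0)
    by (repeat split; auto; rewrite Rminus_diag, Rabs_R0; exact hrho).
  destruct (Cinf_partials _ F t x 0 hFW hbx) as [p1 [p2 _]]; simpl pd3 in *.
  split; [apply (H t x 0 hbx)|split].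
  + assert (e1 : d1 F t x 0 = evolution L eta t x (F t x 0)).
    { apply (solves_evolution L (box t1 x1 0 rho) (box t0 x0 u0 r)); auto using open3_box.
      - intros a b c hh; apply (H a b c hh).
      - destruct (H t x 0 hbx) as [_ [_ [_ [q1 [q2 _]]]]].
        exact (hvs t x ltac:(lra) ltac:(lra)). }
    rewrite e1 in p1; exact p1.
  + rewrite (hFx t x 0 hbx) in p2; exact p2.
Qed.

(* Frobenius for the compatible system [u_t = evolution, u_x = eta]: integrate in
   [t] along [x = x0], then in [x].  The defect [f_t - evolution] satisfies the
   linear equation [z_x = eta_u z] and vanishes at [x = x0]. *)
Lemma frobenius eta t0 x0 u0 : Om (t0, x0) -> smooth3_near eta t0 x0 u0 ->
  near3 t0 x0 u0 (DE0_at L eta) ->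
  exists f, solution_family L f u0 t0 x0 u0 /\
    near3 t0 x0 u0 (fun t x k => d2 f t x k = eta t x (f t x k)).
Proof.
intros hp he hDE.
apply smooth3_near_box in he; destruct he as [de [hde he]].
assert (hOn : near3 t0 x0 u0 (fun t x _ => Om (t, x))) by exact (open3_over Om hOm t0 x0 u0 hp).
destruct (proj1 (box_near _ _ _ _) (near3_and _ _ _ _ _ hOn (near3_and _ _ _ _ _ hDE
  (open3_box _ _ _ _ _ _ _ (box_center t0 x0 u0 de hde))))) as [r [hr Hr]].
assert (oR := open3_box t0 x0 u0 r).
assert (hs : forall t x u, box t0 x0 u0 r t x u -> Om (t, x))
  by (intros t x u hb; apply (Hr t x u hb)).
assert (heta : Cinf (box t0 x0 u0 r) eta)
  by (apply (Cinf_sub (box t0 x0 u0 de)); auto; intros a b c hb; apply Hr; exact hb).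
set (G := evolution L eta).
assert (hG : Cinf (box t0 x0 u0 r) G) by (apply (evolution_Cinf Om); auto).
assert (z0 : forall a s, 0 < s -> Rabs (a - a) < s)
  by (intros; rewrite Rminus_diag, Rabs_R0; assumption).
(* Initial data along x = x0, obtained from u_t = [evolution] with the value k at t0. *)
destruct (ode_smooth (fun _ s y => G s x0 y) 0 t0 u0 r hr)
  as [r1 [Y1 [hr1 [hr1r [hY1 [dY1 iY1]]]]]].
{ intros n; apply (Ck_comp n _ (box t0 x0 u0 r) G (fun _ s _ => s) (fun _ _ _ => x0)
    (fun _ _ y => y)); auto using open3_box.
  - apply Ck_snd; apply open3_box.
  - apply Ck_const; apply open3_box.
  - apply Ck_trd; apply open3_box.
  - intros a b c [q1 [q2 q3]]; repeat split; auto. }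
destruct (ode_smooth eta t0 x0 u0 r hr heta) as [r2 [Y2 [hr2 [hr2r [hY2 [dY2 iY2]]]]]].
set (Z := fun t _ k : R => Y1 0 t k).
assert (hZ : Cinf (box t0 x0 u0 r1) Z).
{ intros n; apply (Ck_comp n _ (box 0 t0 u0 r1) Y1 (fun _ _ _ => 0) (fun t _ _ => t)
    (fun _ _ k => k)); auto using open3_box.
  - apply Ck_const; apply open3_box.
  - apply Ck_fst; apply open3_box.
  - apply Ck_trd; apply open3_box.
  - intros a b c [q1 [q2 q3]]; repeat split; auto. }
assert (hZ0 : Z t0 x0 u0 = u0) by (apply iY1; apply box_center; exact hr1).
assert (hZn : near3 t0 x0 u0 (fun t x k => box t0 x0 u0 r2 t x (Z t x k))).
{ apply (near3_comp (box t0 x0 u0 r2) (fun t _ _ => t) (fun _ x _ => x) Z).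
  - apply cont3_fst.
  - apply cont3_snd.
  - apply (Ck_C0 0 _ _ _ _ _ (hZ 0%nat)); apply box_center; exact hr1.
  - rewrite hZ0; apply open3_box; apply box_center; exact hr2. }
destruct (proj1 (box_near _ _ _ _) (near3_and _ _ _ _ _ hZn
  (open3_box _ _ _ _ _ _ _ (box_center t0 x0 u0 r1 hr1)))) as [r3 [hr3 H3]].
set (f := fun t x k => Y2 t x (Z t x k)).
assert (hf3 : Cinf (box t0 x0 u0 r3) f).
{ apply (Cinf_graph _ (box t0 x0 u0 r2) Y2 Z); auto using open3_box.
  - apply (Cinf_sub (box t0 x0 u0 r1)); auto; intros a b c hb; apply (H3 a b c hb).
  - intros a b c hb; apply (H3 a b c hb). }
assert (hfini : forall t k, box t0 x0 u0 r3 t x0 k -> f t x0 k = Z t x0 k).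
{ intros t k hb; apply iY2; apply (H3 _ _ _ hb). }
assert (hf0 : f t0 x0 u0 = u0) by (rewrite hfini; [exact hZ0|apply box_center; exact hr3]).
(* A bound for eta_u near the centre; with |x - x0| below 1 / (2 Lb) the defect equation is within
   reach of [gronwall_short]. *)
set (Lb := Rabs (d3 eta t0 x0 u0) + 1).
assert (hLb : 0 < Lb) by (unfold Lb; pose proof (Rabs_pos (d3 eta t0 x0 u0)); lra).
assert (hfn : near3 t0 x0 u0 (fun t x k => box t0 x0 u0 r t x (f t x k) /\
   Rabs (d3 eta t x (f t x k) - d3 eta t0 x0 u0) < 1)).
{ apply (near3_comp (fun t x u => box t0 x0 u0 r t x u /\
     Rabs (d3 eta t x u - d3 eta t0 x0 u0) < 1) (fun t _ _ => t) (fun _ x _ => x) f).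
  - apply cont3_fst.
  - apply cont3_snd.
  - apply (Ck_C0 0 _ _ _ _ _ (hf3 0%nat)); apply box_center; exact hr3.
  - rewrite hf0; apply near3_and; [apply oR; apply box_center; exact hr|].
    apply (Ck_C0 0 _ _ _ _ _ (Cinf_pd3 _ _ Dir_3 heta 0%nat)); [apply box_center; exact hr|lra]. }
assert (hsm : 0 < / (2 * Lb)) by (apply Rinv_0_lt_compat; lra).
(* Member k takes the value k at (t0, x0), so f_k is 1 there and stays nonzero nearby. *)
assert (hk1 : d3 f t0 x0 u0 = 1).
{ apply is_derive_unique.
  apply (is_derive_ext_loc (fun k => k)); [|apply is_derive_Rid].
  exists (mkposreal r3 hr3); intros k hk.
  rewrite hfini; [symmetry; apply iY1|]; repeat split; auto.
  assert (r3 <= r1); [|change (Rabs (k - u0) < r3) in hk; lra].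
  apply Rnot_lt_le; intros hlt.
  destruct (H3 t0 x0 (u0 + r1)) as [_ [_ [_ q]]].
  - repeat split; auto; replace (u0 + r1 - u0) with r1 by ring; rewrite Rabs_pos_eq; lra.
  - replace (u0 + r1 - u0) with r1 in q by ring; rewrite Rabs_pos_eq in q; lra. }
assert (hkn : near3 t0 x0 u0 (fun t x k => d3 f t x k <> 0)).
{ apply (cont3_neq0 (d3 f)); [|rewrite hk1; lra].
  apply (Ck_C0 0 _ _ _ _ _ (Cinf_pd3 _ _ Dir_3 hf3 0%nat)); apply box_center; exact hr3. }
destruct (proj1 (box_near _ _ _ _) (near3_and _ _ _ _ _ hfn (near3_and _ _ _ _ _ hkn
  (near3_and _ _ _ _ _ (near3_box t0 x0 u0 (/ (2 * Lb)) hsm)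
  (open3_box _ _ _ _ _ _ _ (box_center t0 x0 u0 r3 hr3)))))) as [d [hd H]].
assert (oD := open3_box t0 x0 u0 d).
assert (hf : Cinf (box t0 x0 u0 d) f)
  by (apply (Cinf_sub (box t0 x0 u0 r3)); auto; intros a b c hb; apply (H a b c hb)).
assert (hm : forall t x k, box t0 x0 u0 d t x k -> box t0 x0 u0 r t x (f t x k))
  by (intros a b c hb; apply (H a b c hb)).
assert (hx : forall t x k, box t0 x0 u0 d t x k -> d2 f t x k = eta t x (f t x k)).
{ intros t x k hb; destruct (H t x k hb) as [_ [_ [_ hb3]]].
  apply is_derive_unique; apply (dY2 t x (Z t x k)); apply (H3 t x k hb3). }
assert (ht : forall t x k, box t0 x0 u0 d t x k -> d1 f t x k = G t x (f t x k)).
{ intros t x k hb.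
  assert (hst : forall s, between x0 x s -> box t0 x0 u0 d t s k)
    by (intros s hs'; apply (fiberwise_star_box t0 x0 u0 d t x k); auto).
  apply Rminus_diag_uniq.
  assert (hz : Rabs ((fun s => d1 f t s k - G t s (f t s k)) x) <= 2 * 0 * Rabs (x - x0)).
  { apply (gronwall_short (fun s => d1 f t s k - G t s (f t s k))
     (fun s => d3 eta t s (f t s k) * (d1 f t s k - G t s (f t s k))) x0 x 0 Lb); try lra.
    - intros s hs'; pose proof (hst s hs') as hbs.
      destruct (second_derivative _ _ eta f t s k oD oR heta hm hx hf hbs) as [_ [e12 _]].
      destruct (Cinf_schwarz _ f t s k oD hf hbs) as [sch _].
      destruct (Cinf_partials _ _ t s k hf hbs) as [_ [p2 _]].
      destruct (Cinf_partials _ _ t s k (Cinf_pd3 _ f Dir_1 hf) hbs) as [_ [p12 _]].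
      simpl pd3 in *.
      assert (hcG : C1at G t s (f t s k)) by (apply (Cinf_C1at (box t0 x0 u0 r)); auto).
      pose proof (hm t s k hbs) as hbr.
      assert (hcomp := proj1 (DE0_compatibility Om L hA hB hC (box t0 x0 u0 r) eta t s (f t s k)
        oR hs heta hbr) (proj1 (proj2 (Hr _ _ _ hbr)))).
      fold G in hcomp.
      eapply is_derive_eq.
      + apply is_derive_Rminus; [exact p12|].
        apply (chain_rule G (fun _ => t) (fun s => s) (fun s => f t s k) s 0 1 (d2 f t s k) hcG);
        [apply is_derive_Rconst|apply is_derive_Rid|exact p2].
      + rewrite <- sch, e12, (hx t s k hbs); lra.
    - apply Rminus_diag_eq.
      pose proof (hst x0 (between_l _ _)) as hb0.
      destruct (H t x0 k hb0) as [_ [_ [_ hb3]]].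
      rewrite (hfini t k hb3); apply is_derive_unique.
      apply (is_derive_ext_loc (fun s => Z s x0 k)).
      + generalize (near3_slice1 _ _ _ _ (oD t x0 k hb0)); apply filter_imp; intros s hs'.
        symmetry; apply hfini; apply (H s x0 k hs').
      + destruct (H3 t x0 k hb3) as [_ [q1 [q2 q3]]].
        apply (dY1 0 t k); repeat split; auto.
    - destruct (H t x k hb) as [_ [_ [[_ [q _]] _]]].
      apply Rle_trans with (Lb * / (2 * Lb)); [apply Rmult_le_compat_l; lra|].
      right; field; lra.
    - intros s hs'; rewrite Rplus_0_l, Rabs_mult; apply Rmult_le_compat_r; [apply Rabs_pos|].
      destruct (H t s k (hst s hs')) as [[_ q] _].
      replace (d3 eta t s (f t s k)) with
        ((d3 eta t s (f t s k) - d3 eta t0 x0 u0) + d3 eta t0 x0 u0) by ring.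
      eapply Rle_trans; [apply Rabs_triang|unfold Lb; lra]. }
  rewrite Rmult_0_r, Rmult_0_l in hz; simpl in hz.
  apply Rabs_eq_0; pose proof (Rabs_pos (d1 f t x k - G t x (f t x k))); lra. }
exists f; split; [split; [|split]|].
- apply smooth3_near_box; exists d; auto.
- exact hf0.
- apply locally_3; exists d; split; [exact hd|]; intros t x k hb; split; [apply (H t x k hb)|].
  apply (solves_evolution L _ _ eta f t x k oD oR heta hm hx hf hb); apply ht; exact hb.
- apply box_near; exists d; auto.
Qed.

End Reduction.

(** * Orbits of a solution *)

(** With l the derivative at a, the first-order expansion with error |l| / 2 puts the values at a +
    m and a - m on opposite sides of b, at distance at least |l| m / 2. The intermediate value
    theorem for l (phi - k) then reaches every k closer than that. *)
Lemma reparameterization_surjective (phi : R -> R) (a b e : R) :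
  reparameterization phi a b -> 0 < e ->
  exists d, 0 < d /\ forall k, Rabs (k - b) < d -> exists s, Rabs (s - a) < e /\ phi s = k.
Proof.
intros [h0 [h1 h2]] he; set (l := Derive phi a) in *.
assert (hl : 0 < Rabs l) by (apply Rabs_pos_lt; exact h1).
assert (hex : locally a (fun s => ex_derive phi s))
  by (revert h2; apply filter_imp; intros s hs; exact (hs 1%nat)).
pose proof (Derive_correct _ _ (locally_singleton _ _ hex)) as hd; fold l in hd.
destruct (filter_and _ _ hex (proj1 (is_derive_eps _ _ _) hd (Rabs l / 2) ltac:(lra)))
  as [r Hr].
set (m := Rmin r e / 2).
assert (hm : 0 < m) by (unfold m; pose proof (Rmin_pos r e (cond_pos r) he); lra).
assert (m < r /\ m < e) as [m1 m2].
{ pose proof (Rmin_l r e); pose proof (Rmin_r r e); unfold m in *; split; lra. }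
assert (hin : forall s, a - m <= s <= a + m -> ball a r s)
  by (intros s hs; change (Rabs (s - a) < r); apply Rabs_def1; lra).
destruct (Hr (a + m) (hin (a + m) ltac:(lra))) as [_ up].
destruct (Hr (a - m) (hin (a - m) ltac:(lra))) as [_ lo].
rewrite h0 in up, lo.
replace (a + m - a) with m in up by ring; replace (a - m - a) with (- m) in lo by ring.
rewrite Rabs_Ropp in lo; rewrite (Rabs_pos_eq m) in up, lo by lra.
assert (hll : l * l = Rabs l * Rabs l) by (rewrite <- Rabs_mult, Rabs_pos_eq; nra).
assert (hmul : forall z, Rabs z <= Rabs l / 2 * m -> - (l * l * m / 2) <= l * z <= l * l * m / 2).
{ intros z hz; assert (hz' : Rabs (l * z) <= l * l * m / 2).
  { rewrite Rabs_mult, hll; apply Rle_trans with (Rabs l * (Rabs l / 2 * m));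
    [apply Rmult_le_compat_l; lra|right; field]. }
  apply Rabs_le_between; exact hz'. }
pose proof (hmul _ up) as up'; pose proof (hmul _ lo) as lo'.
exists (Rabs l * m / 2); split.
{ assert (0 < Rabs l * m) by (apply Rmult_lt_0_compat; lra). lra. }
intros k hk.
assert (hk' : Rabs (l * (k - b)) < l * l * m / 2).
{ rewrite Rabs_mult, hll; apply Rlt_le_trans with (Rabs l * (Rabs l * m / 2));
  [apply Rmult_lt_compat_l; lra|right; field]. }
apply Rabs_def2 in hk'.
destruct (IVT_interv (fun s => l * (phi s - k)) (a - m) (a + m)) as [s [hs es]].
- intros s hs; apply continuity_pt_filterlim.
  destruct (Hr s (hin s hs)) as [hc _].
  apply (continuous_scal_r l (fun s => phi s - k)).
  apply (continuous_minus phi (fun _ => k)); [apply ex_derive_continuous; exact hc|].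
  apply continuous_const.
- lra.
- lra.
- lra.
- exists s; split; [apply Rabs_def1; lra|].
  apply Rmult_integral in es; destruct es as [es|es]; [tauto|lra].
Qed.

Section Regular.
Variables (Om : R * R -> Prop) (L : equation) (Q : operator).
Hypotheses (hOm : open Om) (hA : smooth_coef Om (cA L)) (hB : smooth_coef Om (cB L))
  (hC : smooth_coef Om (cC L))
  (htau : smooth_coef Om (fun t _ => tau Q t)) (hxi : smooth_coef Om (xi Q))
  (hz1 : smooth_coef Om (zeta1 Q)) (hz0 : smooth_coef Om (zeta0 Q)).

(* Along the flow both [U] and [f (T, X, phi)] satisfy [u' = zeta (T, X, u)], which
   is linear in [u]. *)
Lemma regular_of_multiple f eta h t0 x0 k0 u0 d r : Om (t0, x0) ->
  eta_family Om L f eta t0 x0 k0 u0 d r -> solution_family L f k0 t0 x0 u0 ->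
  Cinf (box 0 0 k0 d) (fun _ _ k => h k) ->
  (forall t x k, box t0 x0 k0 d t x k -> family_char Q f t x k = h k * d3 f t x k) ->
  h k0 <> 0 -> regular_family L Q f k0 t0 x0 u0.
Proof.
intros hp hE hfam hh hm hne; split; [exact hfam|].
pose proof hE as [h1 h2 h3 h4 h5 h6 h7 h8 h9 h10 h11].
assert (z0 : forall a s, 0 < s -> Rabs (a - a) < s)
  by (intros; rewrite Rminus_diag, Rabs_R0; assumption).
destruct (ode_smooth (fun _ _ k => h k) 0 0 k0 d h1 hh) as [r1 [Y [hr1 [_ [hY [dY iY]]]]]].
(* The flow of Q moves members along k' = h (k); this orbit of k0 is the reparameterization, with
   derivative h (k0) at 0. *)
set (phi := fun e => Y 0 e k0).
assert (dphi : forall e, Rabs e < r1 -> is_derive phi e (h (phi e))).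
{ intros e he; apply (dY 0 e k0); repeat split; auto; rewrite Rminus_0_r; exact he. }
assert (phi0 : phi 0 = k0) by (apply iY; apply box_center; exact hr1).
destruct (flow_exists Om Q t0 x0 hOm hp htau hxi) as [dl [T [X [hdl [hT [hX [dTX iTX]]]]]]].
assert (oL := open3_box t0 0 x0 dl).
assert (sL := fiberwise_star_box t0 0 x0 dl).
assert (hTX : forall c, smooth_coef Om c ->
   Cinf (box t0 0 x0 dl) (fun t e x => c (T e t) (X e t x))).
{ intros c hc n.
  apply (Ck_comp n _ (over Om) (fun t x _ => c t x) (fun t e _ => T e t) (fun t e x => X e t x)
    (fun _ _ _ => 0)); auto.
  - apply open3_over; exact hOm.
  - apply Ck_const; exact oL.
  - intros t e x hb; apply (dTX t e x hb). }
set (a := fun t e x => zeta1 Q (T e t) (X e t x)).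
set (b := fun t e x => zeta0 Q (T e t) (X e t x)).
assert (ha : Cinf (box t0 0 x0 dl) a) by (apply hTX; exact hz1).
assert (hb : Cinf (box t0 0 x0 dl) b) by (apply hTX; exact hz0).
(* Over a base orbit the equation for U is linear, U' = a U + b, and is solved by this integrating
   factor. *)
set (E := fun t e x => exp (primitive 0 a t e x)).
assert (hE0 : forall t e x, E t e x <> 0) by (intros; apply Rgt_not_eq, exp_pos).
assert (hEc : forall n, Ck n (box t0 0 x0 dl) E)
  by (intros n; apply Ck_exp; auto; apply Ck_primitive; auto).
set (J := primitive 0 (fun t e x => b t e x * / E t e x)).
assert (hbE : forall n, Ck n (box t0 0 x0 dl) (fun t e x => b t e x * / E t e x))
  by (intros n; apply Ck_mult; auto; apply Ck_inv; auto).
set (U := fun e t x u => E t e x * (u + J t e x)).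
assert (dU : forall t e x u, box t0 0 x0 dl t e x ->
   is_derive (fun s => U s t x u) e (a t e x * U e t x u + b t e x)).
{ intros t e x u hbx; unfold U.
  pose proof (is_derive_comp exp (fun s => primitive 0 a t s x) e _ _ (is_derive_exp _)
    (primitive_derive _ 0 oL sL a t e x (ha 0%nat) hbx)) as dE.
  pose proof (primitive_derive _ 0 oL sL _ t e x (hbE 0%nat) hbx) as dJ.
  eapply is_derive_eq.
  - apply is_derive_Rmult; [exact dE|].
    apply is_derive_Rplus; [apply is_derive_Rconst|exact dJ].
  - change scal with Rmult; cbv beta; fold (E t e x) J; field; apply hE0. }
assert (U0 : forall t x u, U 0 t x u = u).
{ intros t x u; unfold U, E, J; rewrite !primitive_center, exp_0; ring. }
set (g := fun t x => f t x k0).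
exists g, (fun e t _ _ => T e t), (fun e t x _ => X e t x), U, phi.
split; [|split; [exact h3|split; [|split; [|split]]]].
- split; [apply (smooth2_near_slice f t0 x0 k0 d); auto|].
  apply locally_2; exists d; split; [exact h1|]; intros t x ht hx; simpl.
  apply h11; repeat split; auto.
(* Invariance of the member k0 would force w = h (k0) f_k to vanish at the base point, but both
   factors are nonzero. *)
- intros hc; apply locally_singleton in hc; simpl in hc.
  pose proof (hm t0 x0 k0 (box_center _ _ _ _ h1)) as e.
  assert (e' : family_char Q f t0 x0 k0 = 0).
  { unfold family_char, Q_invariant_at, zeta, g in *.
    change (dt (fun t x => f t x k0) t0 x0) with (d1 f t0 x0 k0) in hc.
    change (dx (fun t x => f t x k0) t0 x0) with (d2 f t0 x0 k0) in hc; lra. }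
  rewrite e' in e; symmetry in e; apply Rmult_integral in e; destruct e as [e|e]; [auto|].
  exact (h8 t0 x0 k0 (box_center _ _ _ _ h1) e).
- apply locally_4; exists dl; split; [exact hdl|].
  intros e t x u he [q1 [q2 q3]].
  assert (hb0 : box t0 0 x0 dl t 0 x) by (repeat split; auto).
  assert (hbe : box t0 0 x0 dl t e x) by (repeat split; auto).
  destruct (iTX t x hb0) as [i1 i2]; destruct (dTX t e x hbe) as [_ [j1 j2]].
  split; [exact i1|split; [exact i2|split; [apply U0|split; [exact j1|split; [exact j2|]]]]].
  exact (dU t e x u hbe).
- split; [exact phi0|split].
  + rewrite (is_derive_unique _ _ _ (dphi 0 ltac:(rewrite Rabs_R0; exact hr1))), phi0.
    exact hne.
  + exists (mkposreal r1 hr1); intros e he n.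
    change (Rabs (e - 0) < r1) in he.
    apply (Cinf_ex_derive_n (box 0 0 0 r1) (fun _ _ e => Y 0 e k0) 0 0 e n).
    * apply open3_box.
    * intros m; apply (Ck_comp m _ (box 0 0 k0 r1) Y (fun _ _ _ => 0) (fun _ _ e => e)
        (fun _ _ _ => k0)); auto using open3_box.
      -- apply Ck_const; apply open3_box.
      -- apply Ck_trd; apply open3_box.
      -- apply Ck_const; apply open3_box.
      -- intros a' b' c' [q1 [q2 q3]]; repeat split; auto.
    * repeat split; auto.
(* A bound for [zeta1] along the flow near the base point. The difference of the two sides satisfies
   z' = [a] z and starts at 0, so Gronwall with this constant applies. *)
- set (Lz := Rabs (zeta1 Q (T 0 t0) (X 0 t0 x0)) + 1).
  assert (hLz : 0 < Lz)
    by (unfold Lz; pose proof (Rabs_pos (zeta1 Q (T 0 t0) (X 0 t0 x0))); lra).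
  assert (hb00 := box_center t0 0 x0 dl hdl).
  destruct (iTX t0 x0 hb00) as [iT0 iX0].
  assert (cphi : cont3 (fun _ e _ => phi e) t0 0 x0).
  { apply (cont3_fun1 phi (fun _ e _ => e)); [|apply cont3_snd].
    apply (is_derive_continuous phi 0 _ (dphi 0 ltac:(rewrite Rabs_R0; exact hr1))). }
  assert (n1 : near3 t0 0 x0 (fun t e x => box t0 x0 k0 d (T e t) (X e t x) (phi e))).
  { apply (near3_comp (box t0 x0 k0 d) (fun t e _ => T e t) (fun t e x => X e t x)
      (fun _ e _ => phi e)).
    - apply (Ck_C0 0 _ _ _ _ _ (hT 0%nat)); exact hb00.
    - apply (Ck_C0 0 _ _ _ _ _ (hX 0%nat)); exact hb00.
    - exact cphi.
    - rewrite iT0, iX0, phi0; apply open3_box; apply box_center; exact h1. }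
  assert (hsm : 0 < Rmin (/ (2 * Lz)) (Rmin r1 d))
    by (repeat apply Rmin_pos; auto; apply Rinv_0_lt_compat; lra).
  destruct (proj1 (box_near _ _ _ _) (near3_and _ _ _ _ _ n1 (near3_and _ _ _ _ _
    (oL _ _ _ hb00) (near3_and _ _ _ _ _
      (Ck_C0 0 _ _ _ _ _ (ha 0%nat) hb00 1 Rlt_0_1) (near3_box t0 0 x0 _ hsm)))))
    as [rho [hrho H]].
  apply locally_3'; exists rho; split; [exact hrho|]; intros e t x he ht hx.
  rewrite Rminus_0_r in he.
  set (m := Rmin (/ (2 * Lz)) (Rmin r1 d)) in *.
  assert (m <= / (2 * Lz) /\ m <= r1 /\ m <= d) as [m1 [m2 m3]].
  { pose proof (Rmin_l (/ (2 * Lz)) (Rmin r1 d)); pose proof (Rmin_r (/ (2 * Lz)) (Rmin r1 d));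
    pose proof (Rmin_l r1 d); pose proof (Rmin_r r1 d); unfold m; lra. }
  assert (hbs : forall s, between 0 e s -> box t0 0 x0 rho t s x).
  { intros s hs; apply between_dist in hs; rewrite !Rminus_0_r in hs.
    repeat split; auto; rewrite Rminus_0_r; lra. }
  apply Rminus_diag_uniq.
  assert (hz : Rabs ((fun s => U s t x (g t x) - f (T s t) (X s t x) (phi s)) e)
    <= 2 * 0 * Rabs (e - 0)).
  { apply (gronwall_short (fun s => U s t x (g t x) - f (T s t) (X s t x) (phi s))
     (fun s => a t s x * (U s t x (g t x) - f (T s t) (X s t x) (phi s))) 0 e 0 Lz); try lra.
    - intros s hs.
      destruct (H t s x (hbs s hs)) as [k1 [k2 [_ [_ [k3 _]]]]].
      destruct (dTX t s x k2) as [_ [dT' dX']].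
      rewrite Rminus_0_r in k3.
      eapply is_derive_eq.
      + apply is_derive_Rminus; [exact (dU t s x (g t x) k2)|].
        apply (chain_rule f (fun s => T s t) (fun s => X s t x) phi s _ _ _
          (Cinf_C1at _ f _ _ _ (open3_box _ _ _ _) h4 k1) dT' dX' (dphi s ltac:(lra))).
      + pose proof (hm _ _ _ k1) as e1; unfold family_char in e1; unfold a, b; lra.
    - assert (hb0 : box t0 0 x0 dl t 0 x) by (apply (H t 0 x); apply hbs; apply between_l).
      destruct (iTX t x hb0) as [i1 i2]; rewrite U0, i1, i2, phi0; unfold g; ring.
    - rewrite Rminus_0_r.
      destruct (H t e x (hbs e (between_r _ _))) as [_ [_ [_ [_ [k3 _]]]]].
      rewrite Rminus_0_r in k3.
      apply Rle_trans with (Lz * / (2 * Lz)); [apply Rmult_le_compat_l; lra|].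
      right; field; lra.
    - intros s hs; rewrite Rplus_0_l, Rabs_mult; apply Rmult_le_compat_r; [apply Rabs_pos|].
      destruct (H t s x (hbs s hs)) as [_ [_ [k _]]].
      replace (a t s x) with ((a t s x - a t0 0 x0) + a t0 0 x0) by ring.
      eapply Rle_trans; [apply Rabs_triang|unfold Lz, a in *; lra]. }
  rewrite Rmult_0_r, Rmult_0_l in hz; simpl in hz.
  apply Rabs_eq_0.
  pose proof (Rabs_pos (U e t x (g t x) - f (T e t) (X e t x) (phi e))); lra.
Qed.

Lemma locally_lipschitz_tau t x : Om (t, x) ->
  exists K d, 0 <= K /\ 0 < d /\ forall y y', Rabs (y - t) < d -> Rabs (y' - t) < d ->
    Rabs (tau Q y - tau Q y') <= K * Rabs (y - y').
Proof.
intros hw; assert (oO := open3_over Om hOm).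
assert (oW : open3 (fun _ b _ : R => Om (b, x))).
{ intros a b c hb; apply (near3_comp (over Om) (fun _ b _ => b) (fun _ _ _ => x) (fun _ _ _ => 0)).
  - apply cont3_snd.
  - apply cont3_const.
  - apply cont3_const.
  - apply oO; exact hb. }
destruct (lipschitz2 (fun _ b _ => tau Q b) 0 t 0) as [K [d [hK [hd H]]]].
- apply (Cinf_C1at (fun _ b _ => Om (b, x))); auto.
  intros n; apply (Ck_comp n _ (over Om) (fun a _ _ => tau Q a) (fun _ b _ => b)
    (fun _ _ _ => x) (fun _ _ _ => 0)); auto.
  + apply Ck_snd; exact oW.
  + apply Ck_const; exact oW.
  + apply Ck_const; exact oW.
- exists K, d; split; [exact hK|split; [exact hd|]]; intros y y' h1 h2.
  apply (H 0); auto; rewrite Rminus_diag, Rabs_R0; exact hd.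
Qed.

(* A point [(t, x, f (t, x, phi e))] of the member [phi e] is the image under
   [exp (e Q)] of the point of the graph of [g] over [(t', x') = exp (- e Q) (t, x)];
   differentiating the orbit of the latter in [e] gives [zeta - tau f_t - xi f_x
   = phi' (e) f_k]. *)
Lemma multiple_of_regular f t0 x0 k0 u0 : Om (t0, x0) ->
  regular_family L Q f k0 t0 x0 u0 ->
  exists h, h k0 <> 0 /\
    near3 t0 x0 k0 (fun t x k => family_char Q f t x k = h k * d3 f t x k).
Proof.
intros hp [[hf [hf0 hsol]] [g [T [X [U [phi [[hg _] [hg0 [_ [hgrp [hphi hrel]]]]]]]]]]].
assert (z0 : forall a s, 0 < s -> Rabs (a - a) < s)
  by (intros; rewrite Rminus_diag, Rabs_R0; assumption).
apply smooth3_near_box in hf; destruct hf as [df [hdf hf]].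
apply near3_locally in hsol.
apply locally_4 in hgrp; destruct hgrp as [dg [hdg hgrp]].
apply locally_3' in hrel; destruct hrel as [dr [hdr hrel]].
(* A smooth flow of the base field, needed to go back along the orbits; T, X and U from the
   hypothesis are only known to be differentiable in e. *)
destruct (flow_exists Om Q t0 x0 hOm hp htau hxi) as [dl [YT [YX [hdl [hT [hX [dTX iTX]]]]]]].
assert (hb00 := box_center t0 0 x0 dl hdl).
destruct (iTX t0 x0 hb00) as [iT0 iX0].
(* Half of [dl], because the time difference s - e of two parameters below [dd] must stay below
   [dl]. *)
set (dd := Rmin (dl / 2) (Rmin dg dr)).
assert (hdd : 0 < dd) by (unfold dd; repeat apply Rmin_pos; lra).
assert (dd <= dl / 2 /\ dd <= dg /\ dd <= dr) as [dd1 [dd2 dd3]].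
{ pose proof (Rmin_l (dl / 2) (Rmin dg dr)); pose proof (Rmin_r (dl / 2) (Rmin dg dr));
  pose proof (Rmin_l dg dr); pose proof (Rmin_r dg dr); unfold dd; lra. }
assert (hgn : near3 t0 x0 0 (fun t x _ => box t0 x0 u0 dd t x (g t x))).
{ destruct hg as [Wg [hWo [hW1 hg]]]; apply Cinf_smooth2 in hg.
  apply (near3_comp (box t0 x0 u0 dd) (fun t _ _ => t) (fun _ x _ => x) (fun t x _ => g t x)).
  - apply cont3_fst.
  - apply cont3_snd.
  - apply (Ck_C0 0 _ _ _ _ _ (hg 0%nat)); exact hW1.
  - rewrite hg0; apply open3_box; apply box_center; exact hdd. }
assert (cneg : cont3 (fun _ e _ : R => -1 * e) t0 0 x0)
  by (apply cont3_mult; [apply cont3_const|apply cont3_snd]).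
assert (hneg : -1 * 0 = 0) by ring.
assert (hback : near3 t0 0 x0 (fun t e x =>
   box t0 x0 u0 dd (YT (-1 * e) t) (YX (-1 * e) t x) (g (YT (-1 * e) t) (YX (-1 * e) t x)))).
{ apply (near3_comp (fun t x _ => box t0 x0 u0 dd t x (g t x))
    (fun t e _ => YT (-1 * e) t) (fun t e x => YX (-1 * e) t x) (fun _ _ _ => 0)).
  - apply (cont3_comp (fun t e _ => YT e t) (fun t _ _ => t) (fun _ e _ => -1 * e)
      (fun _ _ x => x)); auto; try apply cont3_fst; try apply cont3_trd.
    rewrite hneg; apply (Ck_C0 0 _ _ _ _ _ (hT 0%nat)); exact hb00.
  - apply (cont3_comp (fun t e x => YX e t x) (fun t _ _ => t) (fun _ e _ => -1 * e)
      (fun _ _ x => x)); auto; try apply cont3_fst; try apply cont3_trd.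
    rewrite hneg; apply (Ck_C0 0 _ _ _ _ _ (hX 0%nat)); exact hb00.
  - apply cont3_const.
  - rewrite hneg, iT0, iX0; exact hgn. }
assert (dphi : locally 0 (fun e => ex_derive phi e)).
{ destruct hphi as [_ [_ hh]]; revert hh; apply filter_imp; intros e he; exact (he 1%nat). }
assert (phi0 : phi 0 = k0) by apply hphi.
assert (hphin : near3 t0 0 x0 (fun t e x => box t0 x0 k0 df t x (phi e))).
{ apply (near3_comp (box t0 x0 k0 df) (fun t _ _ => t) (fun _ _ x => x) (fun _ e _ => phi e)).
  - apply cont3_fst.
  - apply cont3_trd.
  - apply (cont3_fun1 phi (fun _ e _ => e)); [|apply cont3_snd].
    apply (ex_derive_continuous phi); exact (locally_singleton _ _ dphi).
  - rewrite phi0; apply open3_box; apply box_center; exact hdf. }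
destruct dphi as [dp Hdp].
assert (hm0 : 0 < Rmin dd dp) by (apply Rmin_pos; auto; apply cond_pos).
destruct (proj1 (box_near _ _ _ _) (near3_and _ _ _ _ _ hback (near3_and _ _ _ _ _ hphin
  (near3_box t0 0 x0 _ hm0)))) as [rho [hrho H]].
assert (key : forall t e x, box t0 0 x0 rho t e x ->
   family_char Q f t x (phi e) = Derive phi e * d3 f t x (phi e)).
{ intros t e x hb; destruct (H t e x hb) as [hk1 [hk2 [q1 [q2 q3]]]].
  rewrite Rminus_0_r in q2.
  pose proof (Rmin_l dd dp); pose proof (Rmin_r dd dp).
  (* The preimage of (t, x) under the flow at time e, lying below the graph of g. *)
  set (t' := YT (-1 * e) t) in *; set (x' := YX (-1 * e) t x) in *.
  set (u' := g t' x') in *.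
  assert (hbe : forall s, Rabs s < dd -> box t0 0 x0 dl t (s - e) x).
  { intros s hs; repeat split; try lra.
    rewrite Rminus_0_r; unfold Rminus; eapply Rle_lt_trans; [apply Rabs_triang|].
    rewrite Rabs_Ropp; lra. }
  assert (hgs : forall s, Rabs s < dd -> _) by
    exact (fun s hs => hgrp s t' x' u' ltac:(rewrite Rminus_0_r; lra) (box_le _ _ _ _ _ _ _ _ dd2 hk1)).
  assert (dTg : forall s, Rabs s < dd ->
    is_derive (fun s => T s t' x' u') s (tau Q (T s t' x' u')))
    by (intros s hs; exact (proj1 (proj2 (proj2 (proj2 (hgs s hs)))))).
  assert (dXg : forall s, Rabs s < dd ->
    is_derive (fun s => X s t' x' u') s (xi Q (T s t' x' u') (X s t' x' u')))
    by (intros s hs; exact (proj1 (proj2 (proj2 (proj2 (proj2 (hgs s hs))))))).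
  assert (dshift : forall s, is_derive (fun s => s - e) s 1).
  { intros s; auto_derive; auto. }
  assert (dYT : forall s, Rabs s < dd ->
    is_derive (fun s => YT (s - e) t) s (tau Q (YT (s - e) t))).
  { intros s hs; destruct (dTX _ _ _ (hbe s hs)) as [_ [dd' _]].
    replace (tau Q (YT (s - e) t)) with (1 * tau Q (YT (s - e) t)) by ring.
    exact (is_derive_comp (fun s => YT s t) (fun s => s - e) s _ _ dd' (dshift s)). }
  assert (dYX : forall s, Rabs s < dd ->
    is_derive (fun s => YX (s - e) t x) s (xi Q (YT (s - e) t) (YX (s - e) t x))).
  { intros s hs; destruct (dTX _ _ _ (hbe s hs)) as [_ [_ dd']].
    replace (xi Q (YT (s - e) t) (YX (s - e) t x))
      with (1 * xi Q (YT (s - e) t) (YX (s - e) t x)) by ring.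
    exact (is_derive_comp (fun s => YX s t x) (fun s => s - e) s _ _ dd' (dshift s)). }
  assert (hz0' : Rabs 0 < dd) by (rewrite Rabs_R0; exact hdd).
  (* Uniqueness of orbits: both sides solve the same equation and agree at s = 0. The Lipschitz
     bound is known only near a common value, which is what [propagate_zero] asks for. *)
  assert (eT : forall s, Rabs s < dd -> T s t' x' u' = YT (s - e) t).
  { intros s hs; apply Rminus_diag_uniq.
    apply (propagate_zero (fun s => T s t' x' u' - YT (s - e) t)
      (fun s => tau Q (T s t' x' u') - tau Q (YT (s - e) t)) dd); auto.
    - destruct (hgs 0 hz0') as [i1 _]; rewrite i1; unfold t'.
      replace (0 - e) with (-1 * e) by ring; ring.
    - intros s' hs'; exact (is_derive_Rminus _ _ _ _ _ (dTg s' hs') (dYT s' hs')).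
    - intros s' hs' hz; apply Rminus_diag_uniq in hz.
      destruct (dTX _ _ _ (hbe s' hs')) as [hom _].
      destruct (locally_lipschitz_tau _ _ hom) as [K [dK [hK [hdK hlip]]]].
      exists K; split; [exact hK|].
      pose proof (is_derive_continuous _ _ _ (dTg s' hs')) as c1.
      pose proof (is_derive_continuous _ _ _ (dYT s' hs')) as c2.
      generalize (filter_and _ _
        (proj1 (filterlim_locally _ _) c1 (mkposreal dK hdK))
        (proj1 (filterlim_locally _ _) c2 (mkposreal dK hdK))).
      apply filter_imp; intros s'' [b1 b2].
      apply hlip; [rewrite <- hz; exact b1|exact b2]. }
  assert (eX : forall s, Rabs s < dd -> X s t' x' u' = YX (s - e) t x).
  { intros s hs; apply Rminus_diag_uniq.
    apply (propagate_zero (fun s => X s t' x' u' - YX (s - e) t x)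
      (fun s => xi Q (T s t' x' u') (X s t' x' u') - xi Q (YT (s - e) t) (YX (s - e) t x)) dd);
      auto.
    - destruct (hgs 0 hz0') as [_ [i1 _]]; rewrite i1; unfold x'.
      replace (0 - e) with (-1 * e) by ring; ring.
    - intros s' hs'; exact (is_derive_Rminus _ _ _ _ _ (dXg s' hs') (dYX s' hs')).
    - intros s' hs' hz; apply Rminus_diag_uniq in hz.
      destruct (dTX _ _ _ (hbe s' hs')) as [hom _].
      destruct (lipschitz2 (fun a b _ => xi Q a b) _ _ 0
        (Cinf_C1at _ _ _ _ 0 (open3_over Om hOm) hxi hom)) as [K [dK [hK [hdK hlip]]]].
      exists K; split; [exact hK|].
      pose proof (is_derive_continuous _ _ _ (dTg s' hs')) as c0.
      pose proof (is_derive_continuous _ _ _ (dXg s' hs')) as c1.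
      pose proof (is_derive_continuous _ _ _ (dYX s' hs')) as c2.
      assert (hin : 0 < dd - Rabs s') by lra.
      generalize (filter_and _ _ (locally_ball s' (mkposreal _ hin)) (filter_and _ _
        (proj1 (filterlim_locally _ _) c0 (mkposreal dK hdK)) (filter_and _ _
        (proj1 (filterlim_locally _ _) c1 (mkposreal dK hdK))
        (proj1 (filterlim_locally _ _) c2 (mkposreal dK hdK))))).
      apply filter_imp; intros s'' [b3 [b0 [b1 b2]]].
      change (Rabs (s'' - s') < dd - Rabs s') in b3.
      assert (hs'' : Rabs s'' < dd).
      { pose proof (Rabs_triang_inv s'' s'); lra. }
      (* The first components agree already, so [xi] is compared at equal first arguments and only
         Lipschitz continuity in x is used. *)
      rewrite <- (eT s'' hs'').
      apply hlip; [rewrite <- (eT s' hs'); exact b0|rewrite <- hz; exact b1|exact b2]. }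
  assert (he : Rabs e < dd) by lra.
  assert (hb0 : box t0 0 x0 dl t 0 x) by (repeat split; auto; lra).
  destruct (iTX t x hb0) as [j1 j2].
  assert (eTe : T e t' x' u' = t) by (rewrite (eT e he); replace (e - e) with 0 by ring; exact j1).
  assert (eXe : X e t' x' u' = x) by (rewrite (eX e he); replace (e - e) with 0 by ring; exact j2).
  assert (hrel' : locally e (fun s =>
    U s t' x' u' = f (T s t' x' u') (X s t' x' u') (phi s))).
  { assert (hin : 0 < dd - Rabs e) by lra.
    exists (mkposreal _ hin); intros s hs; change (Rabs (s - e) < dd - Rabs e) in hs.
    pose proof (Rabs_triang_inv s e).
    destruct hk1 as [w1 [w2 w3]].
    apply (hrel s t' x'); try lra; rewrite Rminus_0_r; lra. }
  destruct (hgs e he) as [_ [_ [_ [dT [dX dU]]]]].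
  assert (dp' : is_derive phi e (Derive phi e)).
  { apply Derive_correct; apply Hdp; change (Rabs (e - 0) < dp); rewrite Rminus_0_r; lra. }
  assert (hC1 : C1at f (T e t' x' u') (X e t' x' u') (phi e)).
  { rewrite eTe, eXe; apply (Cinf_C1at _ f _ _ _ (open3_box _ _ _ _) hf); exact hk2. }
  pose proof (chain_rule f (fun s => T s t' x' u') (fun s => X s t' x' u') phi e _ _ _
    hC1 dT dX dp') as dR.
  pose proof (is_derive_ext_loc _ _ _ _ hrel' dU) as dU'.
  pose proof (eq_trans (eq_sym (is_derive_unique _ _ _ dU')) (is_derive_unique _ _ _ dR)) as e1.
  pose proof (locally_singleton _ _ hrel') as e2; simpl in e2.
  rewrite e2, eTe, eXe in e1; unfold zeta in e1; unfold family_char; lra. }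
destruct (reparameterization_surjective phi 0 k0 rho hphi hrho) as [dk [hdk hsurj]].
assert (hx : forall e, Rabs (e - 0) < rho -> box t0 0 x0 rho t0 e x0)
  by (intros; repeat split; auto).
(* For k = phi e the quotient w / f_k equals phi' (e) at every base point, so reading it off at (t0,
   x0) needs no inverse of phi. *)
exists (fun k => family_char Q f t0 x0 k / d3 f t0 x0 k); split.
- pose proof (key t0 0 x0 (hx 0 (z0 _ _ hrho))) as e; rewrite phi0 in e.
  pose proof (proj1 (near3_pt _ _ _ _ hsol)) as hne.
  rewrite e; replace (Derive phi 0 * d3 f t0 x0 k0 / d3 f t0 x0 k0) with (Derive phi 0)
    by (field; exact hne).
  apply hphi.
- generalize (near3_and _ _ _ _ _ (near3_and _ _ _ _ _ (near3_box t0 x0 k0 rho hrho)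
    (near3_box t0 x0 k0 dk hdk)) hsol).
  destruct hsol as [ds [hds Hds]].
  intros hnn.
  generalize (near3_and _ _ _ _ _ hnn (near3_box t0 x0 k0 ds hds)); clear hnn.
  apply near3_imp; intros t x k [[[[k1 [k2 _]] [_ [_ k3]]] _] [_ [_ k4]]].
  destruct (hsurj k k3) as [e [he <-]].
  assert (hne : d3 f t0 x0 (phi e) <> 0)
    by (apply (Hds t0 x0 (phi e)); [apply z0; exact hds|apply z0; exact hds|exact k4]).
  rewrite (key t e x) by (repeat split; auto).
  rewrite (key t0 e x0 (hx e he)); field; exact hne.
Qed.

End Regular.

(** * The correspondence *)

Lemma smooth3_near_near f t0 x0 u0 : smooth3_near f t0 x0 u0 ->
  near3 t0 x0 u0 (smooth3_near f).
Proof.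
intros [W [hW [h0 h]]].
generalize (proj1 (near3_locally _ _ _ _) (hW _ h0)); apply near3_imp.
intros t x u hw; exists W; auto.
Qed.

Section Correspondence.
Variables (Om : R * R -> Prop) (L : equation) (Q : operator).
Hypotheses (hOm : open Om)
  (hA : smooth_coef Om (cA L)) (hB : smooth_coef Om (cB L)) (hC : smooth_coef Om (cC L))
  (htau : smooth_coef Om (fun t _ => tau Q t)) (hxi : smooth_coef Om (xi Q))
  (hz1 : smooth_coef Om (zeta1 Q)) (hz0 : smooth_coef Om (zeta0 Q)).

Lemma near3_family f eta t0 x0 k0 u0 d r P : eta_family Om L f eta t0 x0 k0 u0 d r ->
  near3 t0 x0 u0 P -> near3 t0 x0 k0 (fun t x k => P t x (f t x k)).
Proof.
intros hE hP; apply (near3_comp P (fun t _ _ => t) (fun _ x _ => x) f).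
- apply cont3_fst.
- apply cont3_snd.
- apply (Ck_C0 0 _ _ _ _ _ (ef_f _ _ _ _ _ _ _ _ _ _ hE 0%nat)).
  apply box_center; apply hE.
- rewrite (ef_center _ _ _ _ _ _ _ _ _ _ hE); exact hP.
Qed.

(** The members through points near (t0, x0, u0) have parameters near k0, by continuity of the
    inverse K; so properties on graphs fill a neighbourhood in (t, x, u). *)
Lemma near3_member f eta t0 x0 k0 u0 d r (P : R -> R -> R -> Prop) :
  eta_family Om L f eta t0 x0 k0 u0 d r ->
  near3 t0 x0 k0 (fun t x k => P t x (f t x k)) -> near3 t0 x0 u0 P.
Proof.
intros hE hP.
destruct (family_inverse Om L _ _ _ _ _ _ _ _ hE) as [e [K [he [hK [hK0 hb]]]]].
assert (h : near3 t0 x0 u0 (fun t x u => P t x (f t x (K t x u)))).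
{ apply (near3_comp (fun t x k => P t x (f t x k)) (fun t _ _ => t) (fun _ x _ => x) K).
  - apply cont3_fst.
  - apply cont3_snd.
  - apply (Ck_C0 0 _ _ _ _ _ (hK 0%nat)); apply box_center; exact he.
  - rewrite hK0; exact hP. }
generalize (near3_and _ _ _ _ _ h (open3_box _ _ _ _ _ _ _ (box_center t0 x0 u0 e he))).
apply near3_imp; intros t x u [h1 h2].
rewrite (proj2 (hb t x u h2)) in h1; exact h1.
Qed.

(** Eliminating the parameter: [eta] is the slope f_x of the member through the point. *)
Lemma eta_of_family f h t0 x0 k0 u0 : Om (t0, x0) -> solution_family L f k0 t0 x0 u0 ->
  near3 t0 x0 k0 (fun t x k => family_char Q f t x k = h k * d3 f t x k) ->
  exists eta d r, eta_family Om L f eta t0 x0 k0 u0 d r /\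
    Q0_invariant_solution L Q eta t0 x0 u0.
Proof.
intros hp hfam hh; pose proof hfam as [hf [hf0 hsol]].
apply smooth3_near_box in hf; destruct hf as [df [hdf hf]].
apply near3_locally in hsol.
destruct (implicit_function f t0 x0 k0 df hdf hf (proj1 (near3_pt _ _ _ _ hsol)))
  as [d' [e [K [hd' [hle [he [hK [hb [hinj _]]]]]]]]].
rewrite hf0 in *.
set (eta := fun t x u => d2 f t x (K t x u)).
assert (heta : Cinf (box t0 x0 u0 e) eta).
{ apply (Cinf_graph _ (box t0 x0 k0 df) (d2 f) K); auto using open3_box.
  - exact (Cinf_pd3 _ f Dir_2 hf).
  - intros a b c hbx; apply (box_le _ _ _ d'); auto; apply hb; exact hbx. }
assert (hx : near3 t0 x0 k0 (fun t x k => d2 f t x k = eta t x (f t x k))).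
{ assert (hm : near3 t0 x0 k0 (fun t x k => box t0 x0 u0 e t x (f t x k))).
  { apply (near3_comp (box t0 x0 u0 e) (fun t _ _ => t) (fun _ x _ => x) f).
    - apply cont3_fst.
    - apply cont3_snd.
    - apply (Ck_C0 0 _ _ _ _ _ (hf 0%nat)); apply box_center; exact hdf.
    - rewrite hf0; apply open3_box; apply box_center; exact he. }
  generalize (near3_and _ _ _ _ _ hm (open3_box _ _ _ _ _ _ _ (box_center t0 x0 k0 d' hd'))).
  apply near3_imp; intros t x k [h1 h2]; destruct (hb _ _ _ h1) as [h3 h4].
  unfold eta; rewrite (hinj t x (K t x (f t x k)) k); auto. }
assert (hes : smooth3_near eta t0 x0 u0) by (apply smooth3_near_box; exists e; auto).
destruct (eta_family_intro Om L hOm f eta t0 x0 k0 u0 hp hfam hes hx) as [d [r hE]].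
destruct (proj1 (box_near _ _ _ _) (near3_and _ _ _ _ _ hh
   (open3_box _ _ _ _ _ _ _ (box_center t0 x0 k0 d (ef_d _ _ _ _ _ _ _ _ _ _ hE)))))
  as [d2' [hd2 H]].
set (dm := Rmin d d2').
assert (hdm : 0 < dm) by (apply Rmin_pos; [apply hE|exact hd2]).
pose proof (Rmin_l d d2') as m1; pose proof (Rmin_r d d2') as m2.
assert (hE' : eta_family Om L f eta t0 x0 k0 u0 dm r)
  by (apply (eta_family_shrink Om L f eta t0 x0 k0 u0 d); auto).
exists eta, dm, r; split; [exact hE'|split; [exact hes|]].
apply near3_locally; apply (near3_member f eta t0 x0 k0 u0 dm r); auto.
apply box_near; exists dm; split; [exact hdm|]; intros t x k hbx; split.
- exact (eta_family_DE0 Om L hA hB hC f eta t0 x0 k0 u0 dm r t x k hE' hbx).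
- apply (Q0_invariant_of_multiple Om L Q hxi hz1 hz0 f eta h t0 x0 k0 u0 dm r); auto.
  intros a b c hbc; apply H; apply (box_le _ _ _ dm); auto.
Qed.

Lemma family_of_eta eta t0 x0 u0 : Om (t0, x0) -> Q0_invariant_solution L Q eta t0 x0 u0 ->
  exists f d r, solution_family L f u0 t0 x0 u0 /\ eta_family Om L f eta t0 x0 u0 u0 d r /\
    forall t x k, box t0 x0 u0 d t x k -> Q0_invariant_at Q eta t x (f t x k).
Proof.
intros hp [he hDQ]; apply near3_locally in hDQ.
assert (hD : near3 t0 x0 u0 (DE0_at L eta)) by (revert hDQ; apply near3_imp; tauto).
assert (hQ : near3 t0 x0 u0 (Q0_invariant_at Q eta)) by (revert hDQ; apply near3_imp; tauto).
destruct (frobenius Om L hOm hA hB hC eta t0 x0 u0 hp he hD) as [f [hfam hx]].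
destruct (eta_family_intro Om L hOm f eta t0 x0 u0 u0 hp hfam he hx) as [d [r hE]].
destruct (proj1 (box_near _ _ _ _) (near3_family _ _ _ _ _ _ _ _ _ hE hQ)) as [d' [hd' H]].
exists f, (Rmin d d'), r; split; [exact hfam|split].
- apply (eta_family_shrink Om L f eta t0 x0 u0 u0 d); auto; [|apply Rmin_l].
  apply Rmin_pos; [apply hE|exact hd'].
- intros t x k hb; apply H; apply (box_le _ _ _ (Rmin d d')); auto; apply Rmin_r.
Qed.

(** The members of f1 solve the system of [eta2], hence by [first_integral] each is a member of f2,
    with the parameter read off from the value at (t0, x0). *)
Lemma same_family_of_eta eta1 eta2 f1 f2 k1 k2 t0 x0 u0 d r1 e r2 :
  eta_family Om L f1 eta1 t0 x0 k1 u0 d r1 -> eta_family Om L f2 eta2 t0 x0 k2 u0 e r2 ->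
  near3 t0 x0 u0 (fun t x u => eta1 t x u = eta2 t x u) -> same_family f1 k1 f2 k2 t0 x0.
Proof.
intros hE1 hE2 heq.
pose proof hE1 as [a1 a2 a3 a4 a5 a6 a7 a8 a9 a10 a11].
pose proof hE2 as [b1 b2 b3 b4 b5 b6 b7 b8 b9 b10 b11].
destruct (family_inverse Om L _ _ _ _ _ _ _ _ hE2) as [s [K [hs [hK [hK0 hb]]]]].
assert (hev : near3 t0 x0 u0 (fun t x u => box t0 x0 u0 s t x u /\ eta1 t x u = eta2 t x u /\
   evolution L eta1 t x u = evolution L eta2 t x u)).
{ apply near3_and; [apply open3_box; apply box_center; exact hs|].
  (* [evolution] contains derivatives of [eta], so equality is needed in a neighbourhood of each
     nearby point. *)
  generalize (near3_near3 _ _ _ _ heq); apply near3_imp; intros t x u h.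
  split; [exact (near3_pt _ _ _ _ h)|].
  pose proof (near3_pt _ _ _ _ h) as h0; simpl in h0.
  assert (h2 : d2 eta1 t x u = d2 eta2 t x u) by exact (pd3_ext _ _ Dir_2 _ _ _ h).
  assert (h3 : d3 eta1 t x u = d3 eta2 t x u) by exact (pd3_ext _ _ Dir_3 _ _ _ h).
  unfold evolution; rewrite h0, h2, h3; reflexivity. }
destruct (proj1 (box_near _ _ _ _) (near3_and _ _ _ _ _
  (near3_family _ _ _ _ _ _ _ _ _ hE1 hev)
  (open3_box _ _ _ _ _ _ _ (box_center t0 x0 k1 d a1)))) as [rho [hrho H]].
assert (z0 : forall a s, 0 < s -> Rabs (a - a) < s)
  by (intros; rewrite Rminus_diag, Rabs_R0; assumption).
set (phi := fun k => K t0 x0 (f1 t0 x0 k)).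
assert (hrep : forall t x k, box t0 x0 k1 rho t x k -> f1 t x k = f2 t x (phi k)).
{ intros t x k [q1 [q2 q3]].
  apply (first_integral Om L f2 eta2 t0 x0 k2 u0 e r2 s K (fun t x => f1 t x k) t0 x0 rho); auto.
  intros t' x' ht hx.
  assert (hbx : box t0 x0 k1 rho t' x' k) by (repeat split; auto).
  destruct (H t' x' k hbx) as [[g1 [g2 g3]] g4].
  destruct (Cinf_partials _ f1 t' x' k a4 g4) as [p1 [p2 _]]; simpl pd3 in *.
  rewrite (a10 _ _ _ g4), g3 in p1; rewrite (a9 _ _ _ g4), g2 in p2; auto. }
assert (hphi : Cinf (box t0 x0 k1 rho) (fun _ _ k => phi k)).
{ assert (oB := open3_box t0 x0 k1 rho).
  assert (hf1 : Cinf (box t0 x0 k1 rho) (fun _ _ k => f1 t0 x0 k)).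
  { intros n; apply (Ck_comp n _ (box t0 x0 k1 d) f1 (fun _ _ _ => t0) (fun _ _ _ => x0)
      (fun _ _ k => k)); auto using open3_box.
    - apply Ck_const; auto.
    - apply Ck_const; auto.
    - apply Ck_trd; auto.
    - intros a b c [_ [_ q]]; apply (H t0 x0 c); repeat split; auto. }
  intros n; apply (Ck_comp n _ (box t0 x0 u0 s) K (fun _ _ _ => t0) (fun _ _ _ => x0)
      (fun _ _ k => f1 t0 x0 k)); auto using open3_box.
  - apply Ck_const; auto.
  - apply Ck_const; auto.
  - intros a b c [_ [_ q]]; apply (H t0 x0 c); repeat split; auto. }
assert (hphi1 : phi k1 = k2) by (unfold phi; rewrite a3; exact hK0).
exists phi; split; [split; [exact hphi1|split]|].
(* If phi' vanished at k1, so would f1_k = f2_k phi' at the base point. *)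
- intros h0.
  assert (hc := box_center t0 x0 k1 rho hrho).
  destruct (Cinf_partials _ _ _ _ _ hphi hc) as [_ [_ p3]]; simpl pd3 in p3.
  change (is_derive phi k1 (Derive phi k1)) in p3; rewrite h0 in p3.
  assert (hC1 : C1at f2 t0 x0 (phi k1)).
  { rewrite hphi1; apply (Cinf_C1at _ f2 _ _ _ (open3_box _ _ _ _) b4); apply box_center; auto. }
  pose proof (chain_rule f2 (fun _ => t0) (fun _ => x0) phi k1 0 0 0 hC1
    (is_derive_Rconst _ _) (is_derive_Rconst _ _) p3) as hd.
  apply (a8 t0 x0 k1 (box_center _ _ _ _ a1)); apply is_derive_unique.
  apply (is_derive_ext_loc (fun k => f2 t0 x0 (phi k))).
  + exists (mkposreal rho hrho); intros k hk; symmetry; apply hrep; repeat split; auto.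
  + eapply is_derive_eq; [exact hd|ring].
- exists (mkposreal rho hrho); intros k hk n.
  apply (Cinf_ex_derive_n (box t0 x0 k1 rho) (fun _ _ k => phi k) t0 x0 k n); auto.
  + apply open3_box.
  + repeat split; auto.
- apply locally_3; exists rho; auto.
Qed.

(** Differentiating f1 (t, x, k) = f2 (t, x, phi k) in x at fixed k identifies the slopes through
    each point; the regularity of phi enters only as continuity at k1. *)
Lemma eta_of_same_family eta1 eta2 f1 f2 k1 k2 t0 x0 u0 d r1 e r2 :
  eta_family Om L f1 eta1 t0 x0 k1 u0 d r1 -> eta_family Om L f2 eta2 t0 x0 k2 u0 e r2 ->
  same_family f1 k1 f2 k2 t0 x0 -> near3 t0 x0 u0 (fun t x u => eta1 t x u = eta2 t x u).
Proof.
intros hE1 hE2 [phi [[p0 [_ p1]] hrep]]; apply near3_locally in hrep.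
pose proof hE1 as [a1 a2 a3 a4 a5 a6 a7 a8 a9 a10 a11].
pose proof hE2 as [b1 b2 b3 b4 b5 b6 b7 b8 b9 b10 b11].
apply (near3_member f1 eta1 t0 x0 k1 u0 d r1); auto.
assert (hb2 : near3 t0 x0 k1 (fun t x k => box t0 x0 k2 e t x (phi k))).
{ apply (near3_comp (box t0 x0 k2 e) (fun t _ _ => t) (fun _ x _ => x) (fun _ _ k => phi k)).
  - apply cont3_fst.
  - apply cont3_snd.
  - apply (cont3_fun1 phi (fun _ _ k => k)); [|apply cont3_trd].
    apply (ex_derive_continuous phi); exact (locally_singleton _ _ p1 1%nat).
  - rewrite p0; apply open3_box; apply box_center; exact b1. }
generalize (near3_and _ _ _ _ _ (near3_near3 _ _ _ _ hrep) (near3_and _ _ _ _ _ hb2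
  (open3_box _ _ _ _ _ _ _ (box_center t0 x0 k1 d a1)))).
apply near3_imp; intros t x k [h1 [h2 h3]].
assert (e2 : d2 f1 t x k = d2 f2 t x (phi k)).
{ apply Derive_ext_loc; exact (near3_slice2 _ _ _ _ h1). }
rewrite <- (a9 t x k h3), e2, (b9 _ _ _ h2), <- (near3_pt _ _ _ _ h1); reflexivity.
Qed.

End Correspondence.

Theorem theorem6 (Om : R * R -> Prop) (L : equation) (Q : operator)
  (hOm : open Om)
  (hL : forall t x : R, Om (t, x) ->
     analytic2_at (cA L) t x /\ analytic2_at (cB L) t x /\ analytic2_at (cC L) t x /\
     cA L t x <> 0)
  (hQ : lie_symmetry_on Om L Q)
  (t0 x0 u0 : R) (hp : Om (t0, x0)) (hns : nonsingular_point Q t0 x0 u0) :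
  (* reduction by an invariant solution of DE_0 gives an associated family *)
  (forall eta : R -> R -> R -> R,
     Q0_invariant_solution L Q eta t0 x0 u0 ->
     exists (f : R -> R -> R -> R) (k0 : R),
       reduction L eta f k0 t0 x0 u0 /\
       (nonsingular_for L Q eta t0 x0 u0 -> associated_family L Q f k0 t0 x0 u0)) /\
  (* the points where this applies are dense *)
  (forall eta : R -> R -> R -> R,
     Q0_invariant_solution L Q eta t0 x0 u0 ->
     forall N : R * R * R -> Prop, locally ((t0, x0, u0) : R * R * R) N ->
     exists t x u : R, N (t, x, u) /\ Om (t, x) /\
       nonsingular_point Q t x u /\ Q0_invariant_solution L Q eta t x u /\
       nonsingular_for L Q eta t x u) /\
  (* every associated family arises in this way *)
  (forall (f : R -> R -> R -> R) (k0 : R),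
     associated_family L Q f k0 t0 x0 u0 ->
     exists eta : R -> R -> R -> R,
       Q0_invariant_solution L Q eta t0 x0 u0 /\
       nonsingular_for L Q eta t0 x0 u0 /\
       reduction L eta f k0 t0 x0 u0) /\
  (* the correspondence is one-to-one, families being taken up to
     reparameterization *)
  (forall (eta1 eta2 f1 f2 : R -> R -> R -> R) (k1 k2 : R),
     Q0_invariant_solution L Q eta1 t0 x0 u0 ->
     Q0_invariant_solution L Q eta2 t0 x0 u0 ->
     reduction L eta1 f1 k1 t0 x0 u0 ->
     reduction L eta2 f2 k2 t0 x0 u0 ->
     (locally ((t0, x0, u0) : R * R * R) (fun q =>
        let '(t, x, u) := q in eta1 t x u = eta2 t x u) <->
      same_family f1 k1 f2 k2 t0 x0)).
Proof.
destruct hQ as [htau [hxi [hz1 [hz0 hsym]]]].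
apply Cinf_smooth2 in htau; apply Cinf_smooth2 in hxi;
apply Cinf_smooth2 in hz1; apply Cinf_smooth2 in hz0.
assert (hA : smooth_coef Om (cA L))
  by (apply Cinf_smooth2, analytic2_smooth2; intros; apply hL; assumption).
assert (hB : smooth_coef Om (cB L))
  by (apply Cinf_smooth2, analytic2_smooth2; intros; apply hL; assumption).
assert (hC : smooth_coef Om (cC L))
  by (apply Cinf_smooth2, analytic2_smooth2; intros; apply hL; assumption).
split; [|split; [|split]].
- intros eta heta.
  destruct (family_of_eta Om L Q hOm hA hB hC eta t0 x0 u0 hp heta)
    as [f [d [r [hfam [hE hQd]]]]].
  exists f, u0; split; [apply (reduction_intro Om L f eta t0 x0 u0 u0 d r); auto|].
  pose proof hE as [h1 h2 h3 h4 h5 h6 h7 h8 h9 h10 h11].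
  pose proof (box_center t0 x0 u0 d h1) as hc.
  intros [hne|hz].
  (* A nonzero characteristic at the base point means h (k0) <> 0 for the multiplier h = w / f_k
     taken at (t0, x0), so the family is an orbit. *)
  + right.
    apply (regular_of_multiple Om L Q hOm htau hxi hz1 hz0 f eta
      (fun k => family_char Q f t0 x0 k / d3 f t0 x0 k) t0 x0 u0 u0 d r); auto.
    * assert (hfc : Cinf (box t0 x0 u0 d) (fun t x k => family_char Q f t x k * / d3 f t x k)).
      { intros n; apply Ck_mult; [apply open3_box| |].
        - apply (family_char_Cinf Om Q); auto using open3_box.
          intros t x k hb; apply (h6 t x (f t x k)); auto.
        - apply Ck_inv; auto using open3_box.
          exact (Cinf_pd3 _ f Dir_3 h4 n). }
      intros n; apply (Ck_comp n (box 0 0 u0 d) (box t0 x0 u0 d) _ (fun _ _ _ => t0)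
        (fun _ _ _ => x0) (fun _ _ k => k) (open3_box _ _ _ _) (open3_box _ _ _ _) (hfc n)).
      -- apply Ck_const; apply open3_box.
      -- apply Ck_const; apply open3_box.
      -- apply Ck_trd; apply open3_box.
      -- intros a b c [_ [_ q]]; repeat split; auto; rewrite Rminus_diag, Rabs_R0; exact h1.
    * exact (family_char_multiple Om L hA hB hC Q htau hxi hz1 hz0 hsym f eta
        t0 x0 u0 u0 d r hE hQd).
    * rewrite <- h3 in hne.
      rewrite (characteristic_family Om L Q f eta t0 x0 u0 u0 d r) in hne by auto.
      intros h0; apply hne.
      replace (family_char Q f t0 x0 u0)
        with (family_char Q f t0 x0 u0 / d3 f t0 x0 u0 * d3 f t0 x0 u0)
        by (field; apply h8; exact hc).
      rewrite h0; ring.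
  (* A characteristic vanishing on a neighbourhood makes w vanish on all nearby members, which is
     their Q-invariance. *)
  + left; split; [exact hfam|].
    apply near3_locally in hz; apply near3_locally.
    generalize (near3_and _ _ _ _ _ (near3_family Om L _ _ _ _ _ _ _ _ _ hE hz)
      (open3_box _ _ _ _ _ _ _ hc)).
    apply near3_imp; intros t x k [k1 k2].
    rewrite (characteristic_family Om L Q f eta t0 x0 u0 u0 d r) in k1 by auto.
    unfold family_char in k1; unfold Q_invariant_at, zeta.
    change (dt (fun t x => f t x k) t x) with (d1 f t x k).
    change (dx (fun t x => f t x k) t x) with (d2 f t x k); lra.
- intros eta heta N hN; pose proof heta as [hes hDQ].
  set (R0 := fun t x u => N (t, x, u) /\ Om (t, x) /\
       nonsingular_point Q t x u /\ Q0_invariant_solution L Q eta t x u).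
  assert (hR : near3 t0 x0 u0 R0).
  { apply near3_and; [apply near3_locally; exact hN|].
    apply near3_and; [exact (open3_over Om hOm t0 x0 u0 hp)|].
    apply near3_and.
    - assert (cz : forall c, Cinf (over Om) c -> cont3 c t0 x0 u0)
        by (intros c h; apply (Ck_C0 0 _ _ _ _ _ (h 0%nat)); exact hp).
      destruct hns as [h|[h|h]].
      + generalize (cont3_neq0 _ _ _ _ (cz _ htau) h); apply near3_imp; intros t x u k; left; exact k.
      + generalize (cont3_neq0 _ _ _ _ (cz _ hxi) h); apply near3_imp; intros t x u k; right; left; exact k.
      + assert (hzc : cont3 (zeta Q) t0 x0 u0).
        { unfold zeta; apply cont3_plus; [apply cont3_mult|]; [apply (cz _ hz1)|apply cont3_trd|
          apply (cz _ hz0)]. }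
        generalize (cont3_neq0 _ _ _ _ hzc h); apply near3_imp; intros t x u k; right; right; exact k.
    - apply near3_locally in hDQ.
      generalize (near3_and _ _ _ _ _ (smooth3_near_near _ _ _ _ hes) (near3_near3 _ _ _ _ hDQ)).
      apply near3_imp; intros t x u [k1 k2]; split; [exact k1|]; apply near3_locally; exact k2. }
  (* Either the characteristic vanishes near the point, which is then nonsingular itself, or it is
     nonzero at points arbitrarily close, where the other conditions persist by openness. *)
  destruct (classic (near3 t0 x0 u0 (fun t x u => characteristic L Q eta t x u = 0))) as [hz|hz].
  + exists t0, x0, u0; destruct (near3_pt _ _ _ _ hR) as [k1 [k2 [k3 k4]]].
    repeat (split; [assumption|]); right; apply near3_locally; exact hz.
  + apply NNPP; intros hno; apply hz; revert hR; apply near3_imp.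
    intros t x u [k1 [k2 [k3 k4]]]; apply NNPP; intros hne; apply hno.
    exists t, x, u; repeat (split; [assumption|]); left; exact hne.
- intros f k0 [[hfam hinv]|hreg].
  (* A singular family is the case of the multiplier h = 0. *)
  + assert (hh : near3 t0 x0 k0 (fun t x k => family_char Q f t x k = (fun _ => 0) k * d3 f t x k)).
    { apply near3_locally in hinv; revert hinv; apply near3_imp; intros t x k h.
      unfold Q_invariant_at, zeta in h; unfold family_char.
      change (dt (fun t x => f t x k) t x) with (d1 f t x k) in h.
      change (dx (fun t x => f t x k) t x) with (d2 f t x k) in h; lra. }
    destruct (eta_of_family Om L Q hOm hA hB hC hxi hz1 hz0 f _ t0 x0 k0 u0 hp hfam hh)
      as [eta [d [r [hE hi]]]].
    exists eta; split; [exact hi|split; [|apply (reduction_intro Om L f eta t0 x0 k0 u0 d r); auto]].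
    right; apply near3_locally; apply (near3_member Om L f eta t0 x0 k0 u0 d r); auto.
    generalize (near3_and _ _ _ _ _ hh
      (open3_box _ _ _ _ _ _ _ (box_center t0 x0 k0 d (ef_d _ _ _ _ _ _ _ _ _ _ hE)))).
    apply near3_imp; intros t x k [k1 k2].
    rewrite (characteristic_family Om L Q f eta t0 x0 k0 u0 d r) by auto.
    rewrite k1; ring.
  + pose proof hreg as [hfam _].
    destruct (multiple_of_regular Om L Q hOm htau hxi f t0 x0 k0 u0 hp hreg) as [h [hne hh]].
    destruct (eta_of_family Om L Q hOm hA hB hC hxi hz1 hz0 f _ t0 x0 k0 u0 hp hfam hh)
      as [eta [d [r [hE hi]]]].
    exists eta; split; [exact hi|split; [|apply (reduction_intro Om L f eta t0 x0 k0 u0 d r); auto]].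
    pose proof (box_center t0 x0 k0 d (ef_d _ _ _ _ _ _ _ _ _ _ hE)) as hc.
    left; rewrite <- (ef_center _ _ _ _ _ _ _ _ _ _ hE).
    rewrite (characteristic_family Om L Q f eta t0 x0 k0 u0 d r) by auto.
    rewrite (near3_pt _ _ _ _ hh); intros h0; apply Rmult_integral in h0.
    destruct h0 as [h0|h0]; [exact (hne h0)|exact (ef_k _ _ _ _ _ _ _ _ _ _ hE _ _ _ hc h0)].
- intros eta1 eta2 f1 f2 k1 k2 [he1 _] [he2 _] [hf1 [hx1 _]] [hf2 [hx2 _]].
  apply near3_locally in hx1; apply near3_locally in hx2.
  destruct (eta_family_intro Om L hOm f1 eta1 t0 x0 k1 u0 hp hf1 he1 hx1) as [d [r1 hE1]].
  destruct (eta_family_intro Om L hOm f2 eta2 t0 x0 k2 u0 hp hf2 he2 hx2) as [e [r2 hE2]].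
  split; intros h.
  + apply near3_locally in h.
    exact (same_family_of_eta Om L _ _ _ _ _ _ _ _ _ _ _ _ _ hE1 hE2 h).
  + apply near3_locally.
    exact (eta_of_same_family Om L _ _ _ _ _ _ _ _ _ _ _ _ _ hE1 hE2 h).
Qed.
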